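(* Let $\{\beta_n\}_{n}$ be a sequence of nonnegative reals, let $\mathbf U=\{U_e\}_{e\in E(K_n)}$ be i.i.d. $\mathrm{Unif}[0,1]$ random variables and let $s=s_n\in V(K_n)$. Let $f_1,\dots,f_{n-1}$ be the edges added, in this order, by the Aldous--Broder algorithm started at $s$ on the electric network on $K_n$ with conductances $\{\exp(-\beta_nU_e)\}_{e\in E(K_n)}$, and let $g_1,\dots,g_{n-1}$ be the edges added, in this order, by Prim's invasion algorithm started at $s$ with the same labels $\mathbf U$. Let $\mathbb P_s$ denote the joint law of the two algorithms (randomness of $\mathbf U$ and of the random walk). a) If $\beta_n\gg n^3\log n$, then $\lim_{n\to\infty}\mathbb P_s\left(f_i=g_i\ \forall i\in\{1,\dots,n-1\}\right)=1$. b) If $\beta_n\ll n^3$, then $\lim_{n\to\infty}\mathbb P_s\left(f_i=g_i\ \forall i\in\{1,\dots,n-1\}\right)=0$.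
   Context: $K_n$ is the complete graph on $n$ vertices. For positive sequences, $a_n\gg b_n$ (equivalently $b_n\ll a_n$) means $\lim_{n\to\infty}b_n/a_n=0$. Given conductances $c(e)$, the random walk on the network is the Markov chain on $V(K_n)$ with transition probabilities $p(x,y)=c(x,y)/\sum_{z\neq x}c(x,z)$. Aldous--Broder algorithm started at $s$: given $\mathbf U$, run the random walk on the network with conductances $\exp(-\beta_nU_e)$ from $s$. Set $v_0=s$, $V_0=\{s\}$; given $V_k=\{v_0,\dots,v_k\}$, let $f_{k+1}$ be the first edge between $V_k$ and $V(K_n)\setminus V_k$ crossed by the walk and let $v_{k+1}$ be its endpoint outside $V_k$ ($0\le k\le n-2$). Prim's invasion algorithm started at $s$: set $W_0=\{s\}$; given $W_k$, let $g_{k+1}$ be the edge between $W_k$ and $V(K_n)\setminus W_k$ with minimal label $U_e$, and let $W_{k+1}$ be $W_k$ together with the endpoint of $g_{k+1}$ outside $W_k$. *)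

(* Defs.v *)
From HB Require Import structures.
From mathcomp Require Import all_boot all_order all_algebra.
From mathcomp Require Import all_classical all_reals all_analysis.

Set Implicit Arguments.
Unset Strict Implicit.
Unset Printing Implicit Defensive.

Import Order.TTheory GRing.Theory Num.Theory.
Import numFieldNormedType.Exports.

Local Open Scope classical_set_scope.
Local Open Scope ring_scope.

(* [a >> b]. Positivity of [a] is explicit because [x / 0 = 0] here; it is only
   required eventually, as [n ^ 3 * ln n] vanishes at [n = 0] and [n = 1]. *)
Definition much_larger (R : realType) (a b : nat -> R) : Prop :=
  (\forall n \near \oo, 0 < a n) /\ (b n / a n @[n --> \oo] --> (0 : R)).

(* The edges of the complete graph on ['I_n]. *)
Definition edge (n : nat) : predArgType :=
  {e : {set 'I_n} | #|e| == 2%N}.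

(* The edge [{x, y}]; [None] when [x = y]. *)
Definition edge_of (n : nat) (x y : 'I_n) : option (edge n) :=
  insub [set x; y]%SET.

(* Edges with exactly one endpoint in [A]. *)
Definition cut_edges (n : nat) (A : {set 'I_n}) : {set edge n} :=
  [set e : edge n | #|val e :&: A| == 1%N]%SET.

Section growing_a_tree.
Variable n : nat.
(* [next A] is the edge of [cut_edges A] added to the vertex set [A], if any. *)
Variable next : {set 'I_n} -> option (edge n).
Variable s : 'I_n.

(* As one endpoint of the added edge is already in the set, adding both
   endpoints adds exactly the outer one. *)
Fixpoint grown (k : nat) : {set 'I_n} :=
  if k is k'.+1 then
    let A := grown k' in if next A is Some e then A :|: val e else A
  else [set s]%SET.

(* 0-based: this is the [(k+1)]-st added edge. *)
Definition added_edge (k : nat) : option (edge n) := next (grown k).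

End growing_a_tree.

(* Step [t] of the trajectory [w] traverses an edge of [cut_edges A]. *)
Definition crosses (n : nat) (w : nat -> 'I_n) (A : {set 'I_n}) (t : nat) :
    bool :=
  (w t \in A) != (w t.+1 \in A).

(* The first edge of [cut_edges A] crossed by [w]; [None] if there is none,
   which is a null event for the walk when [A] is a nonempty proper subset. *)
Definition first_crossed (n : nat) (w : nat -> 'I_n) (A : {set 'I_n}) :
    option (edge n) :=
  match pselect (exists t, crosses w A t) with
  | left h => edge_of (w (ex_minn h)) (w (ex_minn h).+1)
  | right _ => None
  end.

(* A minimal-label edge of [cut_edges A], unique unless two labels coincide. *)
Definition min_label_edge (R : realType) (n : nat) (u : edge n -> R)
    (A : {set 'I_n}) : option (edge n) :=
  [pick e in cut_edges A | [forall e' in cut_edges A, u e <= u e']].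

Definition aldous_broder (n : nat) (s : 'I_n) (w : nat -> 'I_n) :
    nat -> option (edge n) :=
  added_edge (first_crossed w) s.

Definition prim (R : realType) (n : nat) (s : 'I_n) (u : edge n -> R) :
    nat -> option (edge n) :=
  added_edge (min_label_edge u) s.

Section network.
Variables (R : realType) (n : nat) (beta : R) (u : edge n -> R).

Definition conductance (x y : 'I_n) : R :=
  if edge_of x y is Some e then expR (- (beta * u e)) else 0.

Definition transition (x y : 'I_n) : R :=
  conductance x y / \sum_(z | z != x) conductance x z.

(* Probability that the walk started at [s] follows [x 0, ..., x k]. *)
Definition path_prob (s : 'I_n) (k : nat) (x : nat -> 'I_n) : R :=
  (x 0%N == s)%:R * \prod_(i < k) transition (x i) (x i.+1).

End network.

Section random_elements.
Context (d : measure_display) (T : measurableType d) (R : realType).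
Variable P : probability T R.

Definition mutually_independent (I : finType) (U : I -> {RV P >-> R}) : Prop :=
  forall (J : {set I}) (B : I -> set R), (forall i, measurable (B i)) ->
    P (\bigcap_(i in [set` J]) (U i @^-1` B i)) =
    (\prod_(i in J) P (U i @^-1` B i))%E.

Definition iid_uniform01 (I : finType) (U : I -> {RV P >-> R}) : Prop :=
  mutually_independent U /\
  forall i (B : set R), measurable B ->
    distribution P (U i) B = uniform_prob (@ltr01 R) B.

Definition sigma_of (I : Type) (U : I -> T -> R) : set_system T :=
  <<s \bigcup_(i in [set: I]) preimage_set_system [set: T] (U i) measurable >>.

(* Conditionally on the sigma-algebra generated by the labels [U], the process
   [X] is the random walk started at [s]: its conditional finite-dimensional
   laws are the products of transition probabilities. *)
Definition walk_given_labels (n : nat) (beta : R) (s : 'I_n)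
    (U : edge n -> {RV P >-> R}) (X : nat -> T -> 'I_n) : Prop :=
  (forall t x, measurable [set w | X t w = x]) /\
  forall (A : set T), sigma_of (fun e => U e : T -> R) A ->
  forall (k : nat) (x : nat -> 'I_n),
    P (A `&` [set w | forall i, (i <= k)%N -> X i w = x i]) =
    (\int[P]_(w in A) (path_prob beta (fun e => U e w) s k x)%:E)%E.

End random_elements.

(* All [n.-1] added edges coincide, in order. *)
Definition same_run (R : realType) (T : Type) (n : nat) (s : 'I_n)
    (U : edge n -> T -> R) (X : nat -> T -> 'I_n) : set T :=
  [set w | forall i, (i < n.-1)%N ->
     aldous_broder s (fun t => X t w) i = prim s (fun e => U e w) i].

(* Main.v *)
Require Import Defs.
From HB Require Import structures.
From mathcomp Require Import all_boot all_order all_algebra.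
From mathcomp Require Import all_classical all_reals all_analysis.
From mathcomp Require Import measurable_realfun.
From mathcomp Require Import zify ring lra.

(* Write [W_k] for Prim's set after [k] steps, [g_k = {y, v}] for the next Prim
   edge, with [v] outside [W_k], and [c] for the conductances. Given the labels,
   the probability [phi a] that the walk from [a] leaves [W_k] within [t] steps
   through prescribed edges is subharmonic, which bounds its Dirichlet energy:
   summing [c (phi a - phi b)^2] over the edges inside [W_k] and [c (phi a)^2]
   over the exits gives at most the sum of [c (phi a)] over the prescribed exits.

   Upper regime. Let the prescribed exits be all but [g_k], and suppose that their
   labels exceed that of [g_k] by at least [delta]. The energy bound makes [phi]
   small at [y], and almost constant along the edges with label at most that of
   [g_k]; such edges join [y] to the newest vertex of [W_k], where the walk
   enters (they span a "pond" of the invasion). So the walk makes a mistake with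
   probability at most [n^3 exp (- beta delta / 2)]. All gaps exceed [n^-3 / K]
   with probability [1 - O(1 / K)]: forgetting the label of [e] shows that a given
   [e] is a close competitor at a given step with probability at most the gap.

   Lower regime. Let [g_k] be the only prescribed exit. A second exit at [y] with
   conductance ratio [q], or one at another vertex joined to [y] by edges of much
   smaller label and with [q >= 1/e], keeps the success probability of step [k]
   away from 1, by [q / (1 + q)] and [1/10] respectively. If [beta] is at most
   about [n log n], edges with label below [640 / n] form an expander, and a
   positive fraction of the steps have such an edge as a second exit at [y].
   Otherwise a connected core of edges with label below [640 / n] is absorbed
   first, and a birthday argument on the vertices outside the core that hang from
   it by a single low edge produces, for every [L], at least [L] steps with two
   exits from the core whose labels differ by less than [K / n^3 <= 1 / beta].

   Labels are discretised into cells of side [1 / M], so that every probability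
   about them becomes a count of labelings with values in ['I_M]. *)

Set Implicit Arguments.
Unset Strict Implicit.
Unset Printing Implicit Defensive.

Import Order.TTheory GRing.Theory Num.Theory.
Import numFieldNormedType.Exports.

Local Open Scope classical_set_scope.
Local Open Scope ring_scope.

(** * Electric networks on the complete graph *)

(** The walk is only run for a finite time [t], so exit probabilities are subharmonic rather than
    harmonic, and no hitting time has to be constructed; an upper bound on the energy needs no more.
    That [t] steps miss some vertex has a probability tending to 0, an error absorbed once, cell by
    cell. Prim's run depends on the labels only through their order, hence is constant on a cell
    with distinct digits; a cell is an event of the labels, so the law of the walk can be integrated
    over it. The lower regime splits because a second low exit at the current vertex has a share of
    order exp (- 640 beta / n). Over order n steps this adds up as long as the share stays above
    order n ^ (- 1 / 2), whence the threshold n log n. Beyond it only exits with labels within about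
    1 / beta of each other compete; these may leave from different vertices, and the core serves to
    make the potentials there nearly equal. The obstacle is then dependence: the core, the isolation
    of the hanging vertices, the link from [s] to the core and the hanging edges are read off
    disjoint sets of edges, so that one family can be resampled while the others stay fixed. *)

Section edges.
Variable n : nat.
Implicit Types (x y a b : 'I_n) (A : {set 'I_n}) (e : edge n).

Lemma edge_ofP x y e :
  edge_of x y = Some e <-> x != y /\ val e = [set x; y]%SET.
Proof.
rewrite /edge_of; case: insubP => [e' h he'|h]; split.
- move=> [<-]; split=> //.
  by move: h; rewrite cards2; case: (x != y).
- by move=> [_ h2]; congr Some; apply: val_inj; rewrite he'.
- by [].
- by move=> [xy h2]; move: h; rewrite cards2 xy.
Qed.

Lemma edge_of_ex x y : x != y -> exists e, edge_of x y = Some e.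
Proof.
move=> xy; have h : #|[set x; y]%SET| == 2%N by rewrite cards2 xy.
by exists (Sub [set x; y]%SET h); apply/edge_ofP; rewrite SubK.
Qed.

Lemma edge_of_neq x y e : edge_of x y = Some e -> x != y.
Proof. by case/edge_ofP. Qed.

Lemma edge_ofxx x : edge_of x x = None.
Proof.
by case h : (edge_of x x) => [e|] //; have := edge_of_neq h; rewrite eqxx.
Qed.

Lemma edge_ofC x y : edge_of x y = edge_of y x.
Proof. by rewrite /edge_of finset.setUC. Qed.

Lemma edge_of_surj e : exists x y, edge_of x y = Some e.
Proof.
have /cards2P [x [y [xy he]]] := valP e.
by exists x, y; apply/edge_ofP; split.
Qed.

Lemma edge_of_cut A a b e :
  a \in A -> b \notin A -> edge_of a b = Some e -> e \in cut_edges A.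
Proof.
move=> aA bA /edge_ofP [ab he]; rewrite inE he.
suff -> : [set a; b]%SET :&: A = [set a]%SET by rewrite cards1.
apply/setP => z; rewrite !inE; have [->|za] := eqVneq z a; first by rewrite aA.
by have [->|//] := eqVneq z b; rewrite (negbTE bA).
Qed.

Lemma cut_edgesP A e : e \in cut_edges A ->
  exists a b, [/\ a \in A, b \notin A & edge_of a b = Some e].
Proof.
have [x [y hxy]] := edge_of_surj e; have /edge_ofP [xy he] := hxy.
rewrite inE he => hc; have [xA|xA] := boolP (x \in A).
  have [yA|yA] := boolP (y \in A); last by exists x, y.
  move: hc; suff -> : ([set x; y] :&: A = [set x; y])%SET by rewrite cards2 xy.
  by apply/finset.setIidPl/fintype.subsetP => z; rewrite !inE => /orP [] /eqP ->.
have [yA|yA] := boolP (y \in A).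
  by exists y, x; split=> //; rewrite edge_ofC.
move: hc; suff -> : ([set x; y] :&: A = finset.set0)%SET by rewrite cards0.
apply/setP => z; rewrite !inE; apply/negbTE/negP => /andP [] /orP [] /eqP ->.
  by rewrite (negbTE xA).
by rewrite (negbTE yA).
Qed.

Lemma edge_of_inj x y a b e : edge_of x y = Some e -> edge_of a b = Some e ->
  (x = a /\ y = b) \/ (x = b /\ y = a).
Proof.
move=> /edge_ofP [xy h1] /edge_ofP [ab h2].
have h z : (z == x) || (z == y) = (z == a) || (z == b).
  by have /setP/(_ z) := etrans (esym h1) h2; rewrite !inE.
have := h x; have := h y; have := h a; rewrite !eqxx /= ?orbT.
case: (eqVneq x a) => [<-|xa] /=.
  case: (eqVneq y b) => [->|yb] /=; first by left.
  by move=> _ /esym; rewrite orbF => /eqP yx; move: xy; rewrite yx eqxx.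
move=> h3 h4 /esym /eqP xb; right; split=> //.
by move: h3 => /eqP ->.
Qed.

Lemma edge_of_cut_inj A x y a b e :
  x \in A -> y \notin A -> a \in A -> b \notin A ->
  edge_of x y = Some e -> edge_of a b = Some e -> x = a /\ y = b.
Proof.
move=> xA yA aA bA h1 h2; have [//|[h3 h4]] := edge_of_inj h1 h2.
by move: bA; rewrite -h3 xA.
Qed.

End edges.

Lemma sumr_ge_two (R : realDomainType) (I : finType) (P : pred I) (F : I -> R)
    (i j : I) : i != j -> P i -> P j -> (forall k, P k -> 0 <= F k) ->
  F i + F j <= \sum_(k | P k) F k.
Proof.
move=> ij Pi Pj F0; rewrite (bigD1 i) //= (bigD1 j) /=; last by rewrite Pj eq_sym.
rewrite addrA lerDl; apply: sumr_ge0 => k /andP [/andP [Pk _] _]; exact: F0.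
Qed.

Section network_theory.
Variables (R : realType) (n : nat) (beta : R) (u : edge n -> R).
Hypothesis n_gt1 : (1 < n)%N.
Implicit Types (x y a b : 'I_n) (A : {set 'I_n}).

Notation c := (conductance beta u).
Notation p := (transition beta u).

Lemma conductanceE a b e : edge_of a b = Some e -> c a b = expR (- (beta * u e)).
Proof. by rewrite /conductance => ->. Qed.

Lemma conductanceC a b : c a b = c b a.
Proof. by rewrite /conductance edge_ofC. Qed.

Lemma conductancexx a : c a a = 0.
Proof. by rewrite /conductance edge_ofxx. Qed.

Lemma conductance_ge0 a b : 0 <= c a b.
Proof. by rewrite /conductance; case: edge_of => [e|//]; exact: expR_ge0. Qed.

Lemma conductance_gt0 a b : a != b -> 0 < c a b.
Proof. by move=> /edge_of_ex [e he]; rewrite (conductanceE he) expR_gt0. Qed.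

Definition total_conductance a : R := \sum_b c a b.
Notation ct := total_conductance.

Lemma total_conductanceE a : \sum_(z | z != a) c a z = ct a.
Proof. by rewrite /ct [RHS](bigD1 a) //= conductancexx add0r. Qed.

Lemma other_vertex a : exists b : 'I_n, b != a.
Proof.
have := cardC1 a; rewrite card_ord => h.
have : (0 < #|predC1 a|)%N by rewrite h; lia.
by case/card_gt0P => b; rewrite !inE => hb; exists b.
Qed.

Lemma total_conductance_gt0 a : 0 < ct a.
Proof.
have [b ba] := other_vertex a.
rewrite /ct (bigD1 b) //=; apply: ltr_pwDl.
  by apply: conductance_gt0; rewrite eq_sym.
by apply: sumr_ge0 => z _; exact: conductance_ge0.
Qed.

Lemma transitionE a b : p a b = c a b / ct a.
Proof. by rewrite /transition total_conductanceE. Qed.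

Lemma total_transition a b : ct a * p a b = c a b.
Proof. by rewrite transitionE mulrC divfK // gt_eqF // total_conductance_gt0. Qed.

Lemma transition_ge0 a b : 0 <= p a b.
Proof.
rewrite transitionE divr_ge0 ?conductance_ge0 //.
exact/ltW/total_conductance_gt0.
Qed.

Lemma sum_transition a : \sum_b p a b = 1.
Proof.
under eq_bigr do rewrite transitionE.
by rewrite -mulr_suml divff // gt_eqF // total_conductance_gt0.
Qed.

Section energy.
Variables (A : {set 'I_n}) (phi h : 'I_n -> R).
Hypothesis phi_ge0 : forall a, 0 <= phi a.
Hypothesis phi_sub : forall a, a \in A ->
  ct a * phi a <= \sum_(b in A) c a b * phi b + h a.

(* Multiply the subharmonicity inequality at [a] by [phi a] and sum over [a]. *)
Lemma energy_le :
  \sum_(a in A) \sum_(b in A) c a b * (phi a - phi b) ^+ 2 +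
    (\sum_(a in A) \sum_(b in ~: A) c a b * phi a ^+ 2) *+ 2 <=
  (\sum_(a in A) phi a * h a) *+ 2.
Proof.
have sE (F : 'I_n -> R) :
    \sum_b F b = \sum_(b in A) F b + \sum_(b in ~: A) F b.
  rewrite (bigID (mem A)) /=; congr (_ + _).
  by apply: eq_bigl => b; rewrite !inE.
have H : \sum_(a in A) phi a * (ct a * phi a - \sum_(b in A) c a b * phi b) <=
    \sum_(a in A) phi a * h a.
  apply: ler_sum => a aA; apply: ler_wpM2l; first exact: phi_ge0.
  by have := phi_sub aA; lra.
apply: le_trans (ler_wMn2r 2 H).
have E1 : \sum_(a in A) \sum_(b in A) c a b * phi b ^+ 2 =
    \sum_(a in A) \sum_(b in A) c a b * phi a ^+ 2.
  rewrite exchange_big /=; apply: eq_bigr => a _; apply: eq_bigr => b _.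
  by rewrite conductanceC.
have -> : \sum_(a in A) \sum_(b in A) c a b * (phi a - phi b) ^+ 2 =
    (\sum_(a in A) \sum_(b in A) c a b * (phi a ^+ 2 - phi a * phi b)) *+ 2.
  have E2 : \sum_(a in A) \sum_(b in A) (c a b * phi b ^+ 2 - c a b * phi a ^+ 2) = 0.
    under eq_bigr do rewrite sumrB.
    by rewrite sumrB E1 subrr.
  rewrite mulr2n -[RHS]addr0 -[X in _ = _ + X]E2.
  rewrite -(big_split +%R) -(big_split +%R) /=; apply: eq_bigr => a _.
  rewrite -(big_split +%R) -(big_split +%R) /=; apply: eq_bigr => b _; ring.
rewrite -mulrnDl ler_wMn2r // -big_split /=.
apply: ler_sum => a aA; rewrite mulrBr mulrCA -expr2 /ct mulr_suml sE mulr_sumr.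
by rewrite addrAC -sumrB lerD2r; apply: ler_sum => b bA; rewrite le_eqVlt; apply/orP; left;
  apply/eqP; ring.
Qed.
End energy.
End network_theory.

(** * Exit probabilities of the walk *)

Section exits.
Variables (R : realType) (n : nat) (beta : R) (u : edge n -> R).
Hypothesis n_gt1 : (1 < n)%N.
Implicit Types (x y a b : 'I_n) (A : {set 'I_n}) (l : seq 'I_n).

Notation c := (conductance beta u).
Notation p := (transition beta u).
Notation ct := (total_conductance beta u).

Section energy_consequences.
Variables (A : {set 'I_n}) (phi h : 'I_n -> R).
Hypothesis phi_ge0 : forall a, 0 <= phi a.
Hypothesis phi_sub : forall a, a \in A ->
  ct a * phi a <= \sum_(b in A) c a b * phi b + h a.

Let E := \sum_(a in A) phi a * h a.

Let term_ge0 a b : 0 <= c a b * (phi a - phi b) ^+ 2.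
Proof. by rewrite mulr_ge0 ?conductance_ge0 // sqr_ge0. Qed.

Let exit_ge0 a b : 0 <= c a b * phi a ^+ 2.
Proof. by rewrite mulr_ge0 ?conductance_ge0 // sqr_ge0. Qed.

(** An inner edge occurs in the double sum in both orientations, which cancels the factor 2 on the
    right-hand side of [energy_le]. *)
Lemma energy_edge a b : a \in A -> b \in A -> c a b * (phi a - phi b) ^+ 2 <= E.
Proof.
move=> aA bA; have := energy_le phi_ge0 phi_sub; rewrite -/E.
have h2 : 0 <= \sum_(a in A) \sum_(b in ~: A) c a b * phi a ^+ 2.
  by apply: sumr_ge0 => i _; apply: sumr_ge0 => j _.
have [<-|ab] := eqVneq a b.
  have h1 : 0 <= \sum_(a in A) \sum_(b in A) c a b * (phi a - phi b) ^+ 2.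
    by apply: sumr_ge0 => i _; apply: sumr_ge0 => j _.
  by rewrite subrr expr0n mulr0; lra.
rewrite pair_big_dep /=.
have : c a b * (phi a - phi b) ^+ 2 + c b a * (phi b - phi a) ^+ 2 <=
   \sum_(i | (i.1 \in A) && (i.2 \in A)) c i.1 i.2 * (phi i.1 - phi i.2) ^+ 2.
  apply: (sumr_ge_two (i := (a, b)) (j := (b, a))
    (F := fun i => c i.1 i.2 * (phi i.1 - phi i.2) ^+ 2)) => //=.
  - by rewrite xpair_eqE (negbTE ab).
  - by rewrite aA bA.
  - by rewrite aA bA.
rewrite (conductanceC beta u b a) -[phi b - phi a]opprB sqrrN; lra.
Qed.

Lemma energy_exits a b a' b' : a \in A -> b \notin A -> a' \in A -> b' \notin A ->
  (a, b) != (a', b') -> c a b * phi a ^+ 2 + c a' b' * phi a' ^+ 2 <= E.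
Proof.
move=> aA bA aA' bA' ne; have := energy_le phi_ge0 phi_sub; rewrite -/E.
have h1 : 0 <= \sum_(a in A) \sum_(b in A) c a b * (phi a - phi b) ^+ 2.
  by apply: sumr_ge0 => i _; apply: sumr_ge0 => j _.
rewrite [X in _ + X *+ 2]pair_big_dep /=.
have : c a b * phi a ^+ 2 + c a' b' * phi a' ^+ 2 <=
   \sum_(i | (i.1 \in A) && (i.2 \in ~: A)) c i.1 i.2 * phi i.1 ^+ 2.
  apply: (sumr_ge_two (i := (a, b)) (j := (a', b'))
    (F := fun i => c i.1 i.2 * phi i.1 ^+ 2)) => //=.
  - by rewrite !inE aA bA.
  - by rewrite !inE aA' bA'.
lra.
Qed.

Lemma energy_exit a b : a \in A -> b \notin A -> c a b * phi a ^+ 2 <= E.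
Proof.
move=> aA bA; have := energy_le phi_ge0 phi_sub; rewrite -/E.
have h1 : 0 <= \sum_(a in A) \sum_(b in A) c a b * (phi a - phi b) ^+ 2.
  by apply: sumr_ge0 => i _; apply: sumr_ge0 => j _.
rewrite [X in _ + X *+ 2]pair_big_dep /=.
have : c a b * phi a ^+ 2 <=
   \sum_(i | (i.1 \in A) && (i.2 \in ~: A)) c i.1 i.2 * phi i.1 ^+ 2.
  rewrite (bigD1 (a, b)) /=; last by rewrite !inE aA bA.
  by rewrite lerDl; apply: sumr_ge0.
lra.
Qed.
End energy_consequences.

(* Probability that the walk from [a] leaves [A] within [t] steps, and does so
   along a step in [tgt]. *)
Fixpoint exit_prob A (tgt : rel 'I_n) t a : R :=
  if t is t'.+1 then
    \sum_b p a b * (if b \in A then exit_prob A tgt t' b else (tgt a b)%:R)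
  else 0.

Section exit_prob_theory.
Variables (A : {set 'I_n}) (tgt : rel 'I_n).

Lemma exit_prob_ge0 t a : 0 <= exit_prob A tgt t a.
Proof.
elim: t a => [//|t IH] a /=; apply: sumr_ge0 => b _.
by rewrite mulr_ge0 ?transition_ge0 //; case: ifP.
Qed.

Lemma exit_prob_le1 t a : exit_prob A tgt t a <= 1.
Proof.
elim: t a => [|t IH] a /=; first exact: ler01.
rewrite -[leRHS](sum_transition beta u n_gt1 a); apply: ler_sum => b _.
by rewrite ler_piMr ?transition_ge0 //; case: ifP => // _; case: tgt.
Qed.

Lemma exit_prob_mono t a : exit_prob A tgt t a <= exit_prob A tgt t.+1 a.
Proof.
elim: t a => [|t IH] a; first exact: exit_prob_ge0.
apply: ler_sum => b _; apply: ler_wpM2l; first exact: transition_ge0.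
by case: ifP => // _; exact: IH.
Qed.

(** The one-step decomposition relates horizon [t.+1] to horizon [t]; monotonicity in the horizon
    turns it into an inequality for a single [t], the form required by [energy_le]. *)
Lemma exit_prob_sub t a : ct a * exit_prob A tgt t a <=
  \sum_(b in A) c a b * exit_prob A tgt t b +
  \sum_(b in ~: A) c a b * (tgt a b)%:R.
Proof.
apply: (@le_trans _ _ (ct a * exit_prob A tgt t.+1 a)).
  rewrite ler_wpM2l ?exit_prob_mono //.
  exact/ltW/total_conductance_gt0.
rewrite /= mulr_sumr (bigID (mem A)) /= lerD //.
  by apply: ler_sum => b bA; rewrite bA mulrA total_transition.
rewrite [leRHS](eq_bigl (fun b => b \notin A)); last by move=> b; rewrite !inE.
by apply: ler_sum => b bA; rewrite (negbTE bA) mulrA total_transition.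
Qed.
End exit_prob_theory.

Section one_step.
Variables (A : {set 'I_n}) (y v : 'I_n).
Hypotheses (yA : y \in A) (vA : v \notin A).

Definition right_exit : rel 'I_n := fun a b => (a == y) && (b == v).
(** Consulted only for steps that end outside [A], so inner steps need not be excluded. *)
Definition wrong_exit : rel 'I_n := fun a b => ~~ right_exit a b.

Lemma right_exit_energy t :
  \sum_(a in A) exit_prob A right_exit t a *
     (\sum_(b in ~: A) c a b * (right_exit a b)%:R) =
  exit_prob A right_exit t y * c y v.
Proof.
rewrite (bigD1 y) //= [X in _ + X]big1 ?addr0; last first.
  move=> a /andP [_ ay]; rewrite big1 ?mulr0 // => b _.
  by rewrite /right_exit (negbTE ay) mulr0.
congr (_ * _); rewrite (bigD1 v) /=; last by rewrite inE.
rewrite /right_exit !eqxx mulr1 big1 ?addr0 // => b /andP [_ bv].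
by rewrite (negbTE bv) andbF mulr0.
Qed.

(** Maximum principle: from [a != y] no single step is the right exit, so the value at [a] is at
    most an average of values inside [A] with one step less. *)
Lemma right_exit_max t a : a \in A ->
  exit_prob A right_exit t a <= exit_prob A right_exit t y.
Proof.
elim: t a => [//|t IH] a aA; have [->//|ay] := eqVneq a y.
apply: le_trans (exit_prob_mono _ _ _ _).
rewrite -[leRHS]mul1r -[X in _ <= X * _](sum_transition beta u n_gt1 a) mulr_suml.
apply: ler_sum => b _; apply: ler_wpM2l; first exact: transition_ge0.
case: ifP => bA; first exact: IH.
by rewrite /right_exit (negbTE ay) /= exit_prob_ge0.
Qed.

(** Both exits see the same potential [q] at [y], so the energy bound reads (c y v + c y w) q ^ 2 <=
    c y v q; divide by [q]. *)
Lemma right_exit_le_shared t a w : a \in A -> w \notin A -> w != v ->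
  exit_prob A right_exit t a <= c y v / (c y v + c y w).
Proof.
move=> aA wA wv; apply: le_trans (right_exit_max t aA) _.
have := energy_exits (exit_prob_ge0 A right_exit t)
  (fun a _ => exit_prob_sub A right_exit t a) yA vA yA wA.
rewrite right_exit_energy xpair_eqE eqxx /= eq_sym => /(_ wv).
have := exit_prob_ge0 A right_exit t y; set q := exit_prob _ _ _ _ => q0 H.
have c1 : 0 < c y v by apply: conductance_gt0; apply: contraNneq vA => <-.
have c2 : 0 <= c y w by exact: conductance_ge0.
rewrite ler_pdivlMr; last by lra.
have [->|qn] := eqVneq q 0; first by rewrite mul0r ltW.
have qp : 0 < q by rewrite lt_def qn.
rewrite -(ler_pM2l qp); apply: le_trans H; rewrite le_eqVlt; apply/orP; left.
by apply/eqP; ring.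
Qed.

(** If the potential at [y] exceeded 9/10, that at [y'] would exceed 8/10, and the two exits alone
    would dissipate at least (0.81 + 0.64 / 2) c y v, more than the available c y v. *)
Lemma right_exit_le_close t a y' w : a \in A -> y' \in A -> w \notin A ->
  (y, v) != (y', w) ->
  `|exit_prob A right_exit t y - exit_prob A right_exit t y'| <= 10%:R^-1 ->
  c y v <= 2 * c y' w ->
  exit_prob A right_exit t a <= 9 / 10.
Proof.
move=> aA yA' wA ne dq cc; apply: le_trans (right_exit_max t aA) _.
have := energy_exits (exit_prob_ge0 A right_exit t)
  (fun a _ => exit_prob_sub A right_exit t a) yA vA yA' wA ne.
rewrite right_exit_energy; move: dq (exit_prob_le1 A right_exit t y).
set q := exit_prob _ _ _ _; set q' := exit_prob _ _ _ _ => dq q1 H.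
have c1 : 0 < c y v by apply: conductance_gt0; apply: contraNneq vA => <-.
rewrite leNgt; apply/negP => q9.
have q'8 : 8 / 10 <= q' by move: dq; rewrite ler_norml => /andP [_]; lra.
have H1 : c y v * q ^+ 2 >= c y v * (81 / 100).
  by rewrite ler_pM2l //; nra.
have H2 : c y' w * q' ^+ 2 >= c y v / 2 * (64 / 100).
  by apply: ler_pM; [lra | lra | lra | nra].
have H3 : q * c y v <= c y v by rewrite ler_piMl // ltW.
lra.
Qed.

Lemma right_exit_edge t a b : a \in A -> b \in A ->
  c a b * (exit_prob A right_exit t a - exit_prob A right_exit t b) ^+ 2 <= c y v.
Proof.
move=> aA bA; apply: le_trans (energy_edge (exit_prob_ge0 A right_exit t)
  (fun a _ => exit_prob_sub A right_exit t a) aA bA) _.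
by rewrite right_exit_energy ler_piMl ?conductance_ge0 ?exit_prob_le1.
Qed.

Section wrong.
Variable r : R.
Hypothesis r_ge0 : 0 <= r.
Hypothesis wrong_small : forall a b, a \in A -> b \notin A -> wrong_exit a b ->
  c a b <= c y v * r ^+ 2.

(** At most n ^ 2 wrong exits contribute. The conductance ratio is given as a square [r ^+ 2]
    because the energy controls squares of potentials: the bounds on potentials then come out as
    [n%:R * r]. *)
Lemma wrong_exit_energy t :
  \sum_(a in A) exit_prob A wrong_exit t a *
     (\sum_(b in ~: A) c a b * (wrong_exit a b)%:R) <=
  c y v * (n%:R * r) ^+ 2.
Proof.
have H0 : 0 <= c y v * r ^+ 2 by rewrite mulr_ge0 ?conductance_ge0 ?sqr_ge0.
have -> : c y v * (n%:R * r) ^+ 2 = \sum_(a : 'I_n) \sum_(b : 'I_n) c y v * r ^+ 2.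
  by rewrite !sumr_const !card_ord -[X in _ = X]mulr_natr -mulr_natr; ring.
rewrite [leRHS](bigID (mem A)) /= -[leLHS]addr0; apply: lerD; last first.
  by apply: sumr_ge0 => a _; apply: sumr_ge0.
apply: ler_sum => a aA.
apply: (@le_trans _ _ (\sum_(b in ~: A) c a b * (wrong_exit a b)%:R)).
  apply: ler_piMl; last exact: exit_prob_le1.
  by apply: sumr_ge0 => b _; rewrite mulr_ge0 ?conductance_ge0.
rewrite [leRHS](bigID (mem (~: A)%SET)) /= -[leLHS]addr0; apply: lerD; last first.
  exact: sumr_ge0.
apply: ler_sum => b; rewrite inE => bA.
by case: (boolP (wrong_exit a b)) => h; rewrite ?mulr1 ?mulr0 ?wrong_small.
Qed.

Let le_of_sqr (x z : R) : 0 <= z -> x ^+ 2 <= z ^+ 2 -> `|x| <= z.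
Proof.
move=> z0; rewrite -[x ^+ 2]real_normK ?num_real // => h.
by rewrite -(ler_pXn2r (n := 2)) // nnegrE.
Qed.

Let cyv : 0 < c y v.
Proof. by apply: conductance_gt0; apply: contraNneq vA => <-. Qed.

Let nr_ge0 : 0 <= n%:R * r.
Proof. by rewrite mulr_ge0. Qed.

Lemma wrong_exit_inner t : exit_prob A wrong_exit t y <= n%:R * r.
Proof.
have := energy_exit (exit_prob_ge0 A wrong_exit t)
  (fun a _ => exit_prob_sub A wrong_exit t a) yA vA.
move=> /le_trans /(_ (wrong_exit_energy t)); rewrite ler_pM2l //.
by move=> /(le_of_sqr nr_ge0); rewrite ger0_norm ?exit_prob_ge0.
Qed.

Lemma wrong_exit_edge t a b : a \in A -> b \in A -> c y v <= c a b ->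
  `|exit_prob A wrong_exit t a - exit_prob A wrong_exit t b| <= n%:R * r.
Proof.
move=> aA bA cab; have := energy_edge (exit_prob_ge0 A wrong_exit t)
  (fun a _ => exit_prob_sub A wrong_exit t a) aA bA.
move=> /le_trans /(_ (wrong_exit_energy t)) H; apply: le_of_sqr => //.
rewrite -(ler_pM2l cyv); apply: le_trans H.
by rewrite ler_wpM2r // sqr_ge0.
Qed.
End wrong.
End one_step.

(* [path_sum t a B]: probability that the next [t] positions of the walk from
   [a] form a sequence satisfying [B]. *)
Fixpoint path_sum t a (B : pred (seq 'I_n)) : R :=
  if t is t'.+1 then \sum_b p a b * path_sum t' b (fun l => B (b :: l))
  else (B [::])%:R.

Lemma eq_path_sum t a (B B' : pred (seq 'I_n)) : B =1 B' ->
  path_sum t a B = path_sum t a B'.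
Proof.
elim: t a B B' => [|t IH] a B B' e /=; first by rewrite e.
by apply: eq_bigr => b _; congr (_ * _); apply: IH => l; apply: e.
Qed.

Lemma path_sum_false t a B : B =1 xpred0 -> path_sum t a B = 0.
Proof.
elim: t a B => [|t IH] a B e /=; first by rewrite e.
by rewrite big1 // => b _; rewrite IH ?mulr0 // => l; apply: e.
Qed.

Lemma path_sum_le1 t a B : path_sum t a B <= 1.
Proof.
elim: t a B => [|t IH] a B /=; first by case: (B _).
rewrite -[leRHS](sum_transition beta u n_gt1 a); apply: ler_sum => b _.
by rewrite ler_piMr ?transition_ge0.
Qed.

Lemma path_sumU t a (B B' : pred (seq 'I_n)) :
  path_sum t a (predU B B') <= path_sum t a B + path_sum t a B'.
Proof.
elim: t a B B' => [|t IH] a B B' /=.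
  by case: (B _); case: (B' _) => //=; rewrite ?addr0 ?add0r // ?lerDl.
rewrite -big_split /=; apply: ler_sum => b _; rewrite -mulrDr.
by apply: ler_wpM2l; [exact: transition_ge0 | exact: IH].
Qed.

Lemma path_sum_has (I : Type) (r : seq I) t a (B : I -> pred (seq 'I_n)) :
  path_sum t a (fun l => has (B^~ l) r) <= \sum_(i <- r) path_sum t a (B i).
Proof.
elim: r => [|i r IH].
  by rewrite big_nil path_sum_false.
rewrite big_cons; apply: le_trans (lerD (lexx _) IH).
exact: path_sumU.
Qed.

Lemma path_sum_avoid (eps : R) z t a : eps <= 1 ->
  (forall a, a != z -> eps <= p a z) ->
  path_sum t a (fun l => z \notin a :: l) <= (1 - eps) ^+ t.
Proof.
move=> e1 H; elim: t a => [|t IH] a /=; first by case: (_ \notin _).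
have [<-|az] := eqVneq a z.
  rewrite big1 ?exprn_ge0 ?subr_ge0 // => b _.
  by rewrite path_sum_false ?mulr0 // => l; rewrite !inE eqxx.
rewrite (bigD1 z) //= path_sum_false ?mulr0 ?add0r; last first.
  by move=> l; rewrite !inE eqxx orbT.
rewrite exprS; apply: (@le_trans _ _ (\sum_(b | b != z) p a b * (1 - eps) ^+ t)).
  apply: ler_sum => b bz; apply: ler_wpM2l; first exact: transition_ge0.
  apply: le_trans (IH b); rewrite le_eqVlt; apply/orP; left; apply/eqP.
  by apply: eq_path_sum => l; rewrite !inE eq_sym (negbTE az).
rewrite -mulr_suml; apply: ler_wpM2r; first by rewrite exprn_ge0 ?subr_ge0.
have := sum_transition beta u n_gt1 a; rewrite (bigD1 z) //=.
by have := H a az; lra.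
Qed.

Section invasion.
Variables (W : nat -> {set 'I_n}) (y v : nat -> 'I_n) (K : nat).
Hypothesis inv_in : forall k, (k < K)%N -> y k \in W k.
Hypothesis inv_out : forall k, (k < K)%N -> v k \notin W k.
Hypothesis inv_step : forall k, (k < K)%N -> W k.+1 = (v k |: W k)%SET.

(** A path that ends before step [K] is neither a success nor a failure; both predicates are
    compared with the runs only for paths that visit every vertex. *)
Fixpoint success k a l : bool :=
  if (K <= k)%N then true else
  if l is b :: l' then
    if b \in W k then success k b l' else
    if right_exit (y k) (v k) a b then success k.+1 b l' else false
  else false.

Fixpoint failure k a l : bool :=
  if (K <= k)%N then false else
  if l is b :: l' then
    if b \in W k then failure k b l' else
    if right_exit (y k) (v k) a b then failure k.+1 b l' else true
  else false.

(** The factor of the current step is kept as an exact exit probability, so that the induction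
    follows the recursion of [exit_prob] inside [W k]; it is replaced by [Q] only on entering the
    next set. *)
Lemma success_path_sum (Q : nat -> R) :
  (forall k t a, (k < K)%N -> a \in W k ->
     exit_prob (W k) (right_exit (y k) (v k)) t a <= Q k) ->
  (forall k, 0 <= Q k) ->
  forall t k a, (k < K)%N -> a \in W k ->
  path_sum t a (success k a) <=
    exit_prob (W k) (right_exit (y k) (v k)) t a * \prod_(k.+1 <= j < K) Q j.
Proof.
move=> HQ Q0; elim=> [|t IH] k a kK aW.
  by rewrite /= leqNgt kK mul0r.
have P0 : 0 <= \prod_(k.+1 <= j < K) Q j by apply: prodr_ge0.
rewrite /= mulr_suml; apply: ler_sum => b _; rewrite -mulrA.
apply: ler_wpM2l; first exact: transition_ge0.
rewrite leqNgt kK /=; case: ifP => bW; first exact: IH.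
case: (boolP (right_exit _ _ a b)) => ab; last by rewrite path_sum_false ?mul0r.
rewrite mul1r; have [k1|k1] := ltnP k.+1 K; last first.
  by rewrite big_geq // path_sum_le1.
have bW1 : b \in W k.+1.
  by move/andP: ab => [_ /eqP ->]; rewrite inv_step // !inE eqxx.
apply: le_trans (IH _ _ k1 bW1) _; rewrite [leRHS]big_ltn //.
apply: ler_wpM2r; first by apply: prodr_ge0.
exact: HQ.
Qed.

(** The walk enters [W k.+1] at [v k] when no mistake has been made, so after the first step only
    exit probabilities from the newest vertex have to be small. *)
Lemma failure_path_sum (eps : nat -> R) :
  (forall k t, (k.+1 < K)%N ->
     exit_prob (W k.+1) (wrong_exit (y k.+1) (v k.+1)) t (v k) <= eps k.+1) ->
  (forall k, 0 <= eps k) ->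
  forall t k a, (k < K)%N -> a \in W k ->
  path_sum t a (failure k a) <=
    exit_prob (W k) (wrong_exit (y k) (v k)) t a + \sum_(k.+1 <= j < K) eps j.
Proof.
move=> He e0; elim=> [|t IH] k a kK aW.
  by rewrite /= leqNgt kK add0r sumr_ge0.
have P0 : 0 <= \sum_(k.+1 <= j < K) eps j by apply: sumr_ge0.
rewrite /= -[X in _ <= _ + X]mul1r -[X in _ <= _ + X * _](sum_transition beta u n_gt1 a) mulr_suml.
rewrite -big_split /=; apply: ler_sum => b _; rewrite -mulrDr.
apply: ler_wpM2l; first exact: transition_ge0.
rewrite leqNgt kK /=; case: ifP => bW; first exact: IH.
rewrite /wrong_exit; case: (boolP (right_exit _ _ a b)) => ab /=; last first.
  by apply: le_trans (path_sum_le1 _ _ _) _; rewrite lerDl.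
rewrite add0r; have [k1|k1] := ltnP k.+1 K; last first.
  rewrite path_sum_false // => l; by case: l => [|b' l] /=; rewrite k1.
have bv : b = v k by move/andP: ab => [_ /eqP].
have bW1 : b \in W k.+1 by rewrite bv inv_step // !inE eqxx.
apply: le_trans (IH _ _ k1 bW1) _; rewrite [leRHS]big_ltn //.
by rewrite lerD2r bv He.
Qed.
End invasion.
End exits.

(** * Ponds of the invasion and trajectories of the walk *)

Section prim_theory.
Variables (R : realType) (n : nat) (u : edge n -> R) (s : 'I_n).
Hypothesis n_gt1 : (1 < n)%N.
Implicit Types (a b : 'I_n) (A : {set 'I_n}) (e : edge n).

Definition label a b : R := if edge_of a b is Some e then u e else 0.

Lemma labelE a b e : edge_of a b = Some e -> label a b = u e.
Proof. by rewrite /label => ->. Qed.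

Lemma conductance_label beta a b : a != b ->
  conductance beta u a b = expR (- (beta * label a b)).
Proof. by move=> /edge_of_ex [e he]; rewrite (conductanceE _ _ he) (labelE he). Qed.

Lemma min_label_edge_some A e : min_label_edge u A = Some e ->
  e \in cut_edges A /\ forall e', e' \in cut_edges A -> u e <= u e'.
Proof.
rewrite /min_label_edge; case: pickP => // e1 /andP [h1 /forallP h2] [<-].
by split=> // e' he'; have := h2 e'; rewrite he'.
Qed.

Lemma min_label_edge_ex A a b : a \in A -> b \notin A ->
  exists e, min_label_edge u A = Some e.
Proof.
move=> aA bA; have ab : a != b by apply: contraNneq bA => <-.
have [e he] := edge_of_ex ab; have hc := edge_of_cut aA bA he.
rewrite /min_label_edge; case: pickP => [e1 _|h]; first by exists e1.
case: (arg_minP u hc) => e1 h1 h2; have /negP[] := negbT (h e1).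
by apply/andP; split=> //; apply/forallP => e2; apply/implyP; exact: h2.
Qed.

Definition prim_vertices k : {set 'I_n} := grown (min_label_edge u) s k.
Notation W := prim_vertices.

Definition prim_run (y v : nat -> 'I_n) : Prop := forall k, (k < n.-1)%N ->
  [/\ y k \in W k, v k \notin W k, prim s u k = edge_of (y k) (v k),
      W k.+1 = (v k |: W k)%SET &
      forall a b, a \in W k -> b \notin W k -> label (y k) (v k) <= label a b].

Lemma prim_stepP k : #|W k| = k.+1 -> (k < n.-1)%N -> exists yv : 'I_n * 'I_n,
  [/\ yv.1 \in W k, yv.2 \notin W k, prim s u k = edge_of yv.1 yv.2,
      W k.+1 = (yv.2 |: W k)%SET &
      forall a b, a \in W k -> b \notin W k -> label yv.1 yv.2 <= label a b].
Proof.
move=> cW kn.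
have [a aW] : exists a, a \in W k by apply/card_gt0P; rewrite cW.
have [b bW] : exists b, b \notin W k.
  apply/existsP; rewrite -negb_forall; apply/negP => /forallP h.
  have : (#|W k| = #|'I_n|) by apply: eq_card => z; rewrite h.
  by rewrite cW card_ord; lia.
have [e he] := min_label_edge_ex aW bW.
have [h1 h2] := min_label_edge_some he.
have [y [v [yW vW hyv]]] := cut_edgesP h1.
exists (y, v); split => //=.
- by rewrite /prim /added_edge -/(W k) he hyv.
- rewrite /prim_vertices /= -/(W k) he.
  have /edge_ofP [_ ->] := hyv.
  by apply/setP => z; rewrite !inE; case: (eqVneq z y) => [->|]; rewrite ?yW ?orbT //= orbC.
- move=> a' b' aW' bW'; have ab' : a' != b' by apply: contraNneq bW' => <-.
  have [e' he'] := edge_of_ex ab'.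
  by rewrite (labelE hyv) (labelE he') h2 // (edge_of_cut aW' bW' he').
Qed.

Lemma card_prim_vertices k : (k <= n.-1)%N -> #|W k| = k.+1.
Proof.
elim: k => [|k IH] kn; first by rewrite /prim_vertices /= cards1.
have h := IH (ltnW kn); have [[y v] [_ vW _ -> _]] := prim_stepP h kn.
by rewrite /= in vW; rewrite cardsU1 vW h.
Qed.

Lemma prim_run_ex : exists y v, prim_run y v.
Proof.
have H k : exists yv : 'I_n * 'I_n, (k < n.-1)%N ->
  [/\ yv.1 \in W k, yv.2 \notin W k, prim s u k = edge_of yv.1 yv.2,
      W k.+1 = (yv.2 |: W k)%SET &
      forall a b, a \in W k -> b \notin W k -> label yv.1 yv.2 <= label a b].
  have [kn|kn] := ltnP k n.-1; last by exists (s, s).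
  have [yv h] := prim_stepP (card_prim_vertices (ltnW kn)) kn.
  by exists yv.
have [f hf] := choice H.
by exists (fun k => (f k).1), (fun k => (f k).2).
Qed.

Section run.
Variables (y v : nat -> 'I_n).
Hypothesis yvP : prim_run y v.

Lemma prim_vertices_mono j k : (j <= k)%N -> (k <= n.-1)%N -> W j \subset W k.
Proof.
elim: k => [|k IH]; first by rewrite leqn0 => /eqP ->.
rewrite leq_eqVlt => /orP [/eqP -> //|jk kn].
have [_ _ _ -> _] := yvP kn.
exact: fintype.subset_trans (IH jk (ltnW kn)) (finset.subsetUr _ _).
Qed.

Definition newest k : 'I_n := if k is k'.+1 then v k' else s.

(* [S] is the current pond of the invasion at level [t]: the vertices added
   since the last edge with a label larger than [t]. *)
Lemma pond k t : (k <= n.-1)%N -> exists S : {set 'I_n},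
  [/\ S \subset W k, newest k \in S,
      forall a b, a \in W k -> a \notin S -> b \notin W k -> t < label a b &
      forall (phi : 'I_n -> R) theta, 0 <= theta ->
        (forall a b, a \in W k -> b \in W k -> a != b -> label a b <= t ->
           `|phi a - phi b| <= theta) ->
        forall a b, a \in S -> b \in S -> `|phi a - phi b| <= k%:R * theta].
Proof.
elim: k => [|k IH] kn.
  exists [set s]%SET; split=> //; first by rewrite inE.
    by move=> a b -> .
  move=> phi theta th0 _ a b; rewrite !inE => /eqP -> /eqP ->.
  by rewrite subrr normr0 mul0r.
have [S [SW xS Sout Sdiam]] := IH (ltnW kn).
have [yW vW _ WE minyv] := yvP kn.
have vW1 : v k \in W k.+1 by rewrite WE !inE eqxx.
(* A label above [t] starts a new pond at [v k]: by minimality every other exit of [W k] lies above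
   [t] as well. Otherwise [v k] joins the old pond. *)
have [lt|lt] := leP (label (y k) (v k)) t; last first.
  exists [set v k]%SET; split.
  - by apply/fintype.subsetP => z; rewrite inE => /eqP ->.
  - by rewrite inE.
  - move=> a b; rewrite WE !inE negb_or => /orP [->//|aW] _ /andP [_ bW].
    exact: lt_le_trans lt (minyv _ _ aW bW).
  - move=> phi theta th0 _ a b; rewrite !inE => /eqP -> /eqP ->.
    by rewrite subrr normr0 mulr_ge0.
(* Vertices outside the pond have only exits with labels above [t], so an edge with label at most
   [t] must start in it. *)
have yS : y k \in S.
  by apply/negPn/negP => yS; have := Sout _ _ yW yS vW; rewrite ltNge lt.
exists (v k |: S)%SET; split.
- by rewrite WE finset.setUS.
- by rewrite !inE eqxx.
- move=> a b; rewrite WE !inE !negb_or => /orP [->//|aW] /andP [_ aS] /andP [_ bW].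
  exact: Sout.
move=> phi theta th0 H.
have H' a b : a \in W k -> b \in W k -> a != b -> label a b <= t ->
           `|phi a - phi b| <= theta.
  by move=> aW bW; apply: H; rewrite WE !inE ?aW ?bW orbT.
have D := Sdiam phi theta th0 H'.
have Hv a : a \in S -> `|phi a - phi (v k)| <= k.+1%:R * theta.
  move=> aS; have h1 := D _ _ aS yS.
  have h2 : `|phi (y k) - phi (v k)| <= theta.
    by apply: H => //; [rewrite WE !inE yW orbT | apply: contraNneq vW => <-].
  rewrite -[phi a](subrK (phi (y k))) -addrA; apply: le_trans (ler_normD _ _) _.
  by rewrite -natr1; lra.
move=> a b; rewrite !inE => /orP [/eqP ->|aS] /orP [/eqP ->|bS].
- by rewrite subrr normr0 mulr_ge0.
- by rewrite distrC Hv.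
- exact: Hv.
- by apply: le_trans (D _ _ aS bS) _; rewrite ler_wpM2r // ler_nat.
Qed.

(** The potential is at most n r at [y k], with r the square root of the conductance ratio, and
    changes by at most n r along each pond edge; at most [k] such edges lead to the newest vertex,
    and k + 1 <= n. *)
Lemma wrong_exit_gap beta delta k t : 0 <= beta -> (k < n.-1)%N ->
  (forall a b, a \in W k -> b \notin W k -> wrong_exit (y k) (v k) a b ->
     label (y k) (v k) + delta <= label a b) ->
  exit_prob beta u (W k) (wrong_exit (y k) (v k)) t (newest k) <=
    n%:R * (n%:R * expR (- (beta * delta / 2))).
Proof.
move=> b0 kn gap; have [yW vW _ WE minyv] := yvP kn.
have yv : y k != v k by apply: contraNneq vW => <-.
set r := expR _.
have r0 : 0 <= r by exact: expR_ge0.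
have r2 : r ^+ 2 = expR (- (beta * delta)).
  by rewrite /r expr2 -expRD; congr expR; field.
have small a b : a \in W k -> b \notin W k -> wrong_exit (y k) (v k) a b ->
    conductance beta u a b <= conductance beta u (y k) (v k) * r ^+ 2.
  move=> aW bW ab; rewrite r2 !conductance_label //; last first.
    by apply: contraNneq bW => <-.
  rewrite -expRD ler_expR; have := ler_wpM2l b0 (gap _ _ aW bW ab); lra.
have [S [SW xS Sout Sdiam]] := pond (label (y k) (v k)) (ltnW kn).
have yS : y k \in S.
  by apply/negPn/negP => yS; have := Sout _ _ yW yS vW; rewrite ltxx.
set phi := exit_prob beta u (W k) (wrong_exit (y k) (v k)) t.
have th0 : 0 <= n%:R * r by rewrite mulr_ge0.
have h1 := wrong_exit_inner n_gt1 yW vW r0 small t.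
have h2 : `|phi (newest k) - phi (y k)| <= k%:R * (n%:R * r).
  apply: (Sdiam phi _ th0) => // a b aW bW ab lab; apply: (wrong_exit_edge n_gt1 yW vW r0 small) => //.
  by rewrite !conductance_label // ler_expR lerN2 ler_wpM2l.
have h3 : phi (newest k) <= phi (y k) + k%:R * (n%:R * r).
  by move: h2; rewrite ler_norml => /andP [_]; lra.
apply: le_trans h3 _; apply: (@le_trans _ _ (k.+1%:R * (n%:R * r))).
  by rewrite -natr1 mulrDl mul1r addrC lerD.
by apply: ler_wpM2r => //; rewrite ler_nat; lia.
Qed.

Section trajectory.
Variable w : nat -> 'I_n.
Hypothesis w0 : w 0%N = s.

Definition suffix i m : seq 'I_n := [seq w j | j <- iota i.+1 m].

Lemma first_crossedE A i : (forall j, (j <= i)%N -> w j \in A) ->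
  w i.+1 \notin A -> first_crossed w A = edge_of (w i) (w i.+1).
Proof.
move=> hin hout; rewrite /first_crossed; case: pselect => [h|h]; last first.
  by exfalso; apply: h; exists i; rewrite /crosses hin // (negbTE hout).
case: (ex_minnP h) => m hm hmin; suff -> : m = i by [].
apply/eqP; rewrite eqn_leq hmin /=; last by rewrite /crosses hin // (negbTE hout).
rewrite leqNgt; apply/negP => mi; move: hm.
by rewrite /crosses !hin // ltnW.
Qed.

(** As long as the runs agree they have the same vertex set, so every step of the walk can be tested
    against Prim's sets instead of the sets grown by the walk. *)
Lemma same_run_first_crossed :
  (forall k, (k < n.-1)%N -> aldous_broder s w k = prim s u k) <->
  (forall k, (k < n.-1)%N -> first_crossed w (W k) = prim s u k).
Proof.
split=> H.
  have G k : (k <= n.-1)%N -> grown (first_crossed w) s k = W k.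
    elim: k => [//|k IH] kn /=; have := H k kn.
    by rewrite /aldous_broder /prim /added_edge /prim_vertices /= IH ?(ltnW kn) // => ->.
  by move=> k kn; rewrite -H // /aldous_broder /added_edge G // ltnW.
have G k : (k <= n.-1)%N -> grown (first_crossed w) s k = W k.
  elim: k => [//|k IH] kn /=; rewrite IH ?(ltnW kn) // H //.
by move=> k kn; rewrite -H // /aldous_broder /added_edge G // ltnW.
Qed.

Lemma prim_vertices_not_full k : (k < n.-1)%N -> exists z, z \notin W k.
Proof. by move=> kn; have [_ vW _ _ _] := yvP kn; exists (v k). Qed.

Variable t : nat.
Hypothesis cover : forall z, z \in s :: suffix 0 t.

Lemma cover_le z : exists2 j, (j <= t)%N & w j = z.
Proof.
have := cover z; rewrite inE => /orP [/eqP ->|]; first by exists 0%N.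
by move=> /mapP [j]; rewrite mem_iota => h ->; exists j => //; lia.
Qed.

(** The path cannot end while still inside [W k]: some vertex is missing from [W k], but the path
    covers everything. *)
Lemma same_run_success_from m i k :
  (forall k, (k < n.-1)%N -> first_crossed w (W k) = prim s u k) ->
  (i + m = t)%N -> (k <= n.-1)%N -> (forall j, (j <= i)%N -> w j \in W k) ->
  success W y v n.-1 k (w i) (suffix i m).
Proof.
move=> H; elim: m i k => [|m IH] i k it kn hin.
  rewrite addn0 in it; have [h|h] := ltnP k n.-1; last by rewrite /= h.
  have [z zW] := prim_vertices_not_full h; have [j jt jz] := cover_le z.
  by move: zW; rewrite -jz hin // it.
have [h|h] := ltnP k n.-1; last by rewrite /= h.
rewrite /= leqNgt h /=; case: ifPn => hW.
  apply: (IH i.+1) => //; first by rewrite addSnnS.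
  by move=> j; rewrite leq_eqVlt => /orP [/eqP -> //|]; exact: hin.
have [yW vW hyv WE _] := yvP h.
have := first_crossedE hin hW; rewrite H // hyv => e.
have yv : y k != v k by apply: contraNneq vW => <-.
have [e1 he1] := edge_of_ex yv.
have [ey ev] := edge_of_cut_inj yW vW (hin i (leqnn i)) hW he1 (etrans (esym e) he1).
rewrite /right_exit ey ev !eqxx /=; apply: (IH i.+1) => //; first by rewrite addSnnS.
move=> j; rewrite leq_eqVlt WE !inE => /orP [/eqP ->|ji].
  by rewrite ev eqxx.
by rewrite hin ?orbT.
Qed.

Lemma not_failure_same_run_from m i k :
  (i + m = t)%N -> (k <= n.-1)%N -> (forall j, (j <= i)%N -> w j \in W k) ->
  (forall k', (k' < k)%N -> first_crossed w (W k') = prim s u k') ->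
  ~~ failure W y v n.-1 k (w i) (suffix i m) ->
  (forall k, (k < n.-1)%N -> first_crossed w (W k) = prim s u k).
Proof.
elim: m i k => [|m IH] i k it kn hin H.
  rewrite addn0 in it; have [h|h] := ltnP k n.-1; last first.
    by move=> _ k' k'n; apply: H; lia.
  have [z zW] := prim_vertices_not_full h; have [j jt jz] := cover_le z.
  by move: zW; rewrite -jz hin // it.
have [h|h] := ltnP k n.-1; last by move=> _ k' k'n; apply: H; lia.
rewrite /= leqNgt h /=; case: ifPn => hW.
  apply: (IH i.+1) => //; first by rewrite addSnnS.
  by move=> j; rewrite leq_eqVlt => /orP [/eqP -> //|]; exact: hin.
have [yW vW hyv WE _] := yvP h.
have e := first_crossedE hin hW.
case: ifPn => // /andP [/eqP e1 /eqP e2].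
apply: (IH i.+1) => //; first by rewrite addSnnS.
  move=> j; rewrite leq_eqVlt WE !inE => /orP [/eqP ->|ji]; first by rewrite e2 eqxx.
  by rewrite hin ?orbT.
move=> k'; rewrite ltnS leq_eqVlt => /orP [/eqP ->|]; last exact: H.
by rewrite e e1 e2 hyv.
Qed.

Lemma same_run_success :
  (forall k, (k < n.-1)%N -> aldous_broder s w k = prim s u k) ->
  success W y v n.-1 0 s (suffix 0 t).
Proof.
move=> /same_run_first_crossed H; rewrite -{1}w0.
apply: same_run_success_from => // j; rewrite leqn0 => /eqP ->.
by rewrite w0 inE.
Qed.

Lemma not_failure_same_run :
  ~~ failure W y v n.-1 0 s (suffix 0 t) ->
  forall k, (k < n.-1)%N -> aldous_broder s w k = prim s u k.
Proof.
rewrite -{1}w0 => H; apply/same_run_first_crossed.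
apply: not_failure_same_run_from H => // j; rewrite leqn0 => /eqP ->.
by rewrite w0 inE.
Qed.
End trajectory.
End run.
End prim_theory.

(** * Measurability of the comparison of the two runs *)

Section finite_measurability.
Context d (T : measurableType d).

Lemma measurable_iff (A B : set T) :
  (forall w, A w <-> B w) -> measurable A -> measurable B.
Proof. by move=> h; suff -> : A = B by []; apply/seteqP; split=> w /h. Qed.

Lemma measurable_forall_fin (I : finType) (F : I -> set T) :
  (forall i, measurable (F i)) -> measurable [set w | forall i, F i w].
Proof.
move=> mF; suff H (r : seq I) : measurable [set w | forall i, i \in r -> F i w].
  apply: measurable_iff (H (enum I)) => w /=; split=> h i; last by move=> _; exact: h.
  by apply: h; rewrite mem_enum.
elim: r => [|i r IH]; first by apply: measurable_iff (@measurableT _ T).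
apply: measurable_iff (measurableI _ _ (mF i) IH) => w /=; split.
  by move=> [h1 h2] j; rewrite inE => /orP [/eqP ->//|]; exact: h2.
by move=> h; split=> [|j jr]; apply: h; rewrite inE ?eqxx ?jr ?orbT.
Qed.

Lemma measurable_exists_fin (I : finType) (F : I -> set T) :
  (forall i, measurable (F i)) -> measurable [set w | exists i, F i w].
Proof.
move=> mF; have := measurable_forall_fin (fun i => measurableC (mF i)).
move/measurableC; apply: measurable_iff => w /=; split.
  by move/existsNP => [i /contrapT h]; exists i.
by move=> [i h] /(_ i).
Qed.

(** Measurability of a map with finitely many values, stated through its fibres so that no
    sigma-algebra on the target has to be fixed. *)
Definition fibers_measurable (F : Type) (g : T -> F) : Prop :=
  forall x, measurable [set w | g w = x].

Lemma fibers_measurable_comp (F : finType) (F' : Type) (h : F -> F') (g : T -> F) :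
  fibers_measurable g -> fibers_measurable (h \o g).
Proof.
move=> mg y; rewrite (_ : mkset _ = [set w | exists x, [set w | g w = x /\ h x = y] w]).
  apply: measurable_exists_fin => x; have [hx|hx] := pselect (h x = y).
    by apply: measurable_iff (mg x) => w /=; split=> [|[]].
  by apply: measurable_iff measurable0 => w /=; split=> [|[]].
apply/seteqP; split=> w /=; first by move=> e; exists (g w).
by move=> [x [-> ->]].
Qed.

Lemma fibers_measurable_pred (F : finType) (g : T -> F) (Q : F -> Prop) :
  fibers_measurable g -> measurable [set w | Q (g w)].
Proof.
move=> /(fibers_measurable_comp Q) /(_ True); apply: measurable_iff => w /=.
by split=> [->|h] //; apply/propext.
Qed.

Lemma fibers_measurable_pair (F F' : finType) (g : T -> F) (g' : T -> F') :
  fibers_measurable g -> fibers_measurable g' -> fibers_measurable (fun w => (g w, g' w)).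
Proof.
move=> m m' [x x']; apply: measurable_iff (measurableI _ _ (m x) (m' x')) => w /=.
by split=> [[-> ->]|[-> ->]].
Qed.

Lemma fibers_measurable_grown n (s : 'I_n) (next : T -> {set 'I_n} -> option (edge n)) :
  (forall A, fibers_measurable (next^~ A)) ->
  forall k, fibers_measurable (fun w => grown (next w) s k).
Proof.
move=> mn; elim=> [|k IH] /=.
  move=> x; have [->|hx] := pselect ([set s]%SET = x).
    by apply: measurable_iff (@measurableT _ T).
  by apply: measurable_iff measurable0.
move=> B; rewrite (_ : mkset _ = [set w | exists A : {set 'I_n}, [set w | grown (next w) s k = A] w /\
   [set w | (if next w A is Some e then A :|: val e else A)%SET = B] w]).
  apply: measurable_exists_fin => A; apply: measurableI; first exact: IH.
  exact: (fibers_measurable_comp (fun o : option (edge n) => if o is Some e then A :|: val e else A)%SET (mn A) B).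
by apply/seteqP; split=> w /=; [move=> e; eexists; split; first by []|move=> [A [-> ->]]].
Qed.

Lemma fibers_measurable_added_edge n (s : 'I_n) (next : T -> {set 'I_n} -> option (edge n)) :
  (forall A, fibers_measurable (next^~ A)) ->
  forall k, fibers_measurable (fun w => added_edge (next w) s k).
Proof.
move=> mn k o; rewrite (_ : mkset _ = [set w | exists A : {set 'I_n}, [set w | grown (next w) s k = A] w /\
   [set w | next w A = o] w]).
  apply: measurable_exists_fin => A; apply: measurableI; last exact: mn.
  exact: fibers_measurable_grown.
apply/seteqP; split=> w /=; rewrite /added_edge; last by move=> [A [->]].
by move=> <-; exists (grown (next w) s k).
Qed.

End finite_measurability.

Section same_run_measurable.
Context d (T : measurableType d) (R : realType) (n : nat) (s : 'I_n).
Variables (U : edge n -> T -> R) (X : nat -> T -> 'I_n).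
Hypothesis mU : forall e, measurable_fun [set: T] (U e).
Hypothesis mX : forall t x, measurable [set w | X t w = x].

Lemma fibers_measurable_first_crossed A :
  fibers_measurable (fun w => first_crossed (fun t => X t w) A).
Proof.
have mc t : measurable [set w | crosses (fun t => X t w) A t].
  exact: (fibers_measurable_pred (fun p => is_true ((p.1 \in A) != (p.2 \in A)))
    (fibers_measurable_pair (mX t) (mX t.+1))).
have me : measurable [set w | exists t, crosses (fun t => X t w) A t].
  rewrite (_ : mkset _ = \bigcup_t [set w | crosses (fun t => X t w) A t]).
    exact: bigcupT_measurable.
  by apply/seteqP; split=> w /= [t]; exists t.
move=> o.
(* The event that the first crossing takes place at time [t], along an edge with value [o]; the
   remaining case is that there is no crossing. *)
pose S t := [set w | [/\ crosses (fun t => X t w) A t,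
   (forall j : 'I_t, ~ crosses (fun t => X t w) A j) & edge_of (X t w) (X t.+1 w) = o]].
have mS t : measurable (S t).
  rewrite (_ : S t = [set w | crosses (fun t => X t w) A t] `&`
    ([set w | forall j : 'I_t, (~` [set w | crosses (fun t => X t w) A j]) w] `&`
     [set w | edge_of (X t w) (X t.+1 w) = o])); last first.
    by apply/seteqP; split=> w; [case=> ? ? ?; do !split | case=> ? [? ?]; split].
  apply: measurableI => //; apply: measurableI.
    by apply: measurable_forall_fin => j; exact: measurableC.
  exact: (fibers_measurable_comp (fun p => edge_of p.1 p.2)
    (fibers_measurable_pair (mX t) (mX t.+1))).
rewrite (_ : mkset _ = (\bigcup_t S t) `|`
   ((~` [set w | exists t, crosses (fun t => X t w) A t]) `&` [set _ | None = o])).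
  apply: measurableU; first exact: bigcupT_measurable.
  apply: measurableI; first exact: measurableC.
  have [h|h] := pselect (None = o).
    by apply: measurable_iff (@measurableT _ T).
  by apply: measurable_iff measurable0.
apply/seteqP; split=> w /=.
  rewrite /first_crossed; case: pselect => h; last by right.
  case: (ex_minnP h) => m hm hmin ho; left; exists m => //; split=> // j hj.
  by have := hmin _ hj; rewrite leqNgt ltn_ord.
case=> [[m _ [hm hmin ho]]|[h ho]]; rewrite /first_crossed; case: pselect => h' //.
  case: (ex_minnP h') => m' hm' hmin'; suff -> : m' = m by [].
  apply/eqP; rewrite eqn_leq hmin' //= leqNgt; apply/negP => mm.
  exact: (hmin (Ordinal mm)).
by exfalso; apply: h'; exists m.
Qed.

(** The minimal edge is a function of the finite table of comparisons between labels, and each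
    comparison is a measurable event. *)
Lemma fibers_measurable_min_label_edge A :
  fibers_measurable (fun w => min_label_edge (fun e => U e w) A).
Proof.
pose g w : {ffun edge n * edge n -> bool} := [ffun p => U p.1 w <= U p.2 w].
have mg : fibers_measurable g.
  move=> x; rewrite (_ : mkset _ = [set w | forall p, [set w | (U p.1 w <= U p.2 w) = x p] w]).
    apply: measurable_forall_fin => p.
    have := measurable_fun_ler (mU p.1) (mU p.2) measurableT (Y := [set x p]) I.
    by rewrite setTI.
  apply/seteqP; split=> w /=; first by move=> <- p; rewrite ffunE.
  by move=> h; apply/ffunP => p; rewrite ffunE h.
have := fibers_measurable_comp (fun x : {ffun edge n * edge n -> bool} =>
   [pick e in cut_edges A | [forall e' in cut_edges A, x (e, e')]]) mg.
move=> H o; apply: measurable_iff (H o) => w /=.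
rewrite /min_label_edge (_ : [pick e in _ | _] =
   [pick e in cut_edges A | [forall e' in cut_edges A, U e w <= U e' w]]) //.
apply: eq_pick => e /=; congr (_ && _).
by apply: eq_forallb => e'; rewrite ffunE.
Qed.

Lemma measurable_same_run : measurable (same_run s U X).
Proof.
rewrite (_ : same_run _ _ _ = [set w | forall i : 'I_n.-1,
  [set w | aldous_broder s (fun t => X t w) i = prim s (fun e => U e w) i] w]).
  apply: measurable_forall_fin => i.
  apply: (fibers_measurable_pred (fun p => p.1 = p.2) (g := fun w =>
     (aldous_broder s (fun t => X t w) i, prim s (fun e => U e w) i))).
  apply: fibers_measurable_pair; apply: fibers_measurable_added_edge.
    exact: fibers_measurable_first_crossed.
  exact: fibers_measurable_min_label_edge.
apply/seteqP; split=> w /= h i; first by apply: h.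
by move=> hi; exact: (h (Ordinal hi)).
Qed.
End same_run_measurable.

(** * Discretisation of the labels *)

Section path_weights.
Variables (R : realType) (n : nat) (beta : R) (u : edge n -> R).

Fixpoint path_weight a (l : seq 'I_n) : R :=
  if l is b :: l' then transition beta u a b * path_weight b l' else 1.

Lemma path_weightE s a l : path_weight a l =
  \prod_(i < size l) transition beta u (nth s (a :: l) i) (nth s (a :: l) i.+1).
Proof.
elim: l a => [|b l IH] a /=; first by rewrite big_ord0.
by rewrite big_ord_recl /= IH.
Qed.

Lemma big_tuple_cons (T : finType) t (F : seq T -> R) :
  \sum_(l : t.+1.-tuple T) F l = \sum_b \sum_(l : t.-tuple T) F (b :: l).
Proof.
rewrite pair_big /=.
rewrite (reindex (fun p : T * t.-tuple T => cons_tuple p.1 p.2)) //=.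
exists (fun l : t.+1.-tuple T => (thead l, behead_tuple l)).
  by move=> [b l] _ /=; congr (_, _); apply/val_inj.
by move=> l _ /=; rewrite [l in RHS]tuple_eta.
Qed.

Lemma path_sumE t a (B : pred (seq 'I_n)) :
  path_sum beta u t a B = \sum_(l : t.-tuple 'I_n) path_weight a l * (B l)%:R.
Proof.
elim: t a B => [|t IH] a B /=.
  rewrite (big_pred1 [tuple]) ?mul1r // => l; symmetry; apply/eqP.
  by rewrite tuple0; apply: val_inj.
rewrite (big_tuple_cons t (fun l => path_weight a l * (B l)%:R)) /=.
apply: eq_bigr => b _; rewrite IH mulr_sumr.
by apply: eq_bigr => l _; rewrite mulrA.
Qed.

End path_weights.

Section subadditivity.
Context d (T : measurableType d) (R : realType) (P : probability T R).

Lemma measure_le_sum (I : eqType) (r : seq I) (F : I -> set T) (E : set T) :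
  measurable E -> (forall i, measurable (F i)) ->
  (forall w, E w -> exists2 i, i \in r & F i w) ->
  (P E <= \sum_(i <- r) P (F i))%E.
Proof.
move=> mE mF; elim: r E mE => [|i r IH] E mE H.
  rewrite big_nil (_ : E = set0) ?measure0 //.
  by apply/seteqP; split=> w // /H [].
rewrite big_cons.
have mEF : measurable (E `\` F i) by apply: measurableD.
apply: (@le_trans _ _ (P (F i `|` (E `\` F i)))).
  apply: le_measure; rewrite ?inE //; first exact: measurableU.
  by move=> w Ew; have [h|h] := pselect (F i w); [left|right].
apply: le_trans (measureU2 _ _ _) _ => //; apply: leeD => //.
apply: IH => // w [Ew nF]; have [j] := H w Ew.
by rewrite inE => /orP [/eqP ->//|jr] Fj; exists j.
Qed.

Lemma measure_le_sum_fin (I : finType) (F : I -> set T) (E : set T) :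
  measurable E -> (forall i, measurable (F i)) ->
  (forall w, E w -> exists i, F i w) ->
  (P E <= \sum_i P (F i))%E.
Proof.
move=> mE mF H; apply: measure_le_sum => // w /H [i Fi].
by exists i => //; rewrite mem_index_enum.
Qed.
End subadditivity.

Section cells.
Context d (T : measurableType d) (R : realType) (P : probability T R).
Variables (n : nat) (beta : R) (s : 'I_n).
Variables (U : edge n -> {RV P >-> R}) (X : nat -> T -> 'I_n).
Hypothesis n_gt1 : (1 < n)%N.
Hypothesis beta_ge0 : 0 <= beta.
Hypothesis iidU : iid_uniform01 U.
Hypothesis walkX : walk_given_labels beta s U X.

Notation lab w := (fun e => U e w).

Lemma measurable_label e : measurable_fun [set: T] (U e).
Proof. exact: measurable_funPT. Qed.

Lemma measurable_position t x : measurable [set w | X t w = x].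
Proof. by case: walkX. Qed.

Lemma measurable_conductance a b :
  measurable_fun [set: T] (fun w => conductance beta (lab w) a b).
Proof.
rewrite /conductance; case: (edge_of a b) => [e|//].
under eq_fun do rewrite -mulNr.
apply: measurableT_comp => //.
by apply: measurable_funM => //; exact: measurable_label.
Qed.

Lemma measurable_transition a b :
  measurable_fun [set: T] (fun w => transition beta (lab w) a b).
Proof.
under eq_fun => w.
  rewrite transitionE -powR_inv1; last first.
    exact/ltW/total_conductance_gt0.
  over.
apply: measurable_funM; first exact: measurable_conductance.
apply: (measurableT_comp (f := fun x : R => x `^ (-1))); first exact: measurable_powR.
apply: measurable_sum => c; exact: measurable_conductance.
Qed.

Lemma measurable_path_weight a l :
  measurable_fun [set: T] (fun w => path_weight beta (lab w) a l).
Proof.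
elim: l a => [//|b l IH] a /=.
by apply: measurable_funM => //; exact: measurable_transition.
Qed.

Lemma path_weight_ge0 (u : edge n -> R) a l : 0 <= path_weight beta u a l.
Proof.
by elim: l a => [//|b l IH] a /=; rewrite mulr_ge0 ?transition_ge0.
Qed.

Definition follows (l : seq 'I_n) : set T :=
  [set w | forall i, (i <= size l)%N -> X i w = nth s (s :: l) i].

Lemma measurable_follows l : measurable (follows l).
Proof.
apply: (@measurable_iff _ _ [set w | forall i : 'I_(size l).+1,
   [set w | X i w = nth s (s :: l) i] w]).
  move=> w; split=> [h i hi|h i /=]; first exact: (h (Ordinal (hi : (i < (size l).+1)%N))).
  by apply: h; rewrite -ltnS.
by apply: measurable_forall_fin => i; exact: measurable_position.
Qed.

Lemma prob_follows (A : set T) l : sigma_of (fun e => U e : T -> R) A ->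
  P (A `&` follows l) = (\int[P]_(w in A) (path_weight beta (lab w) s l)%:E)%E.
Proof.
move=> sA; have [_ H] := walkX.
rewrite (H A sA (size l) (fun i => nth s (s :: l) i)).
apply: eq_integral => w _; congr (_%:E).
by rewrite /path_prob eqxx mul1r -path_weightE.
Qed.

(** The conditional law for paths of length 0 gives weight 0 to every start other than [s]. It is
    needed because [follows] forces the start to be [s]. *)
Lemma start_ae : P [set w | X 0%N w != s] = 0%E.
Proof.
apply/eqP; rewrite -measure_le0.
apply: (@le_trans _ _ (\sum_(a : 'I_n | a != s) P [set w | X 0%N w = a])%E).
  rewrite big_mkcond /=; apply: (@le_trans _ _ (\sum_(a : 'I_n)
     P ([set w | X 0%N w = a /\ a != s]))%E).
    apply: measure_le_sum_fin.
    - exact: (fibers_measurable_pred (fun x => is_true (x != s)) (measurable_position 0)).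
    - move=> a; have [->|h] := eqVneq a s.
        by apply: measurable_iff measurable0 => w; split=> // [[]].
      by apply: measurable_iff (measurable_position 0 a) => w /=; split=> [|[]].
    - by move=> w /= h; exists (X 0%N w).
  apply: lee_sum => a _; case: ifPn => [h|h].
    by rewrite (_ : [set w | X 0%N w = a /\ true] = [set w | X 0%N w = a]) //;
       apply/seteqP; split=> w /= => [[]|].
  rewrite (_ : mkset _ = set0) ?measure0 //.
  by apply/seteqP; split=> w //= [].
rewrite big1 // => a as_; have [_ H] := walkX.
have := H setT _ 0%N (fun=> a).
rewrite (_ : [set: T] `&` _ = [set w | X 0%N w = a]); last first.
  apply/seteqP; split=> w /=; first by move=> [_ /(_ 0%N)] -> //.
  by move=> h; split=> // i; rewrite leqn0 => /eqP ->.
move=> ->; last exact: (@measurableT _ (g_sigma_algebraType _)).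
by rewrite /path_prob (negbTE as_) /=; under eq_integral do rewrite mul0r; rewrite integral0.
Qed.

(** Transfer from the walk to finite sums: split the event by the path of the first [t] steps. Since
    [A] is determined by the labels, each path contributes the integral over [A] of its weight, and
    these weights add up to [path_sum]. *)
Lemma prob_path_le (A E : set T) (B : pred (seq 'I_n)) t (kappa : R) :
  measurable A -> measurable E -> sigma_of (fun e => U e : T -> R) A ->
  (forall w, A w -> path_sum beta (lab w) t s B <= kappa) ->
  (forall w, A w -> E w -> X 0%N w = s -> B [seq X i w | i <- iota 1 t]) ->
  (P (A `&` E) <= kappa%:E * P A)%E.
Proof.
move=> mA mE sA hk hB.
pose F (l : t.-tuple 'I_n) := A `&` (follows l `&` [set _ | B l]).
have mF l : measurable (F l).
  apply: measurableI => //; case hl : (B l).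
    by apply: measurable_iff (measurable_follows l) => w; split=> [|[]].
  by apply: measurable_iff measurable0 => w; split=> // [[_]].
have mN : measurable [set w | X 0%N w != s].
  exact: (fibers_measurable_pred (fun x => is_true (x != s)) (measurable_position 0)).
apply: (@le_trans _ _ (P ([set w | X 0%N w != s] `|` (A `&` E `\` [set w | X 0%N w != s])))).
  apply: le_measure; rewrite ?inE //.
  - exact: measurableI.
  - by apply: measurableU => //; apply: measurableD => //; exact: measurableI.
  - by move=> w h; have [h'|h'] := pselect (X 0%N w != s); [left|right].
apply: le_trans (measureU2 _ _ _) _ => //.
  by apply: measurableD => //; exact: measurableI.
rewrite [X in (X + _)%E](_ : _ = 0%E) ?add0e; last exact: start_ae.
apply: (@le_trans _ _ (\sum_(l : t.-tuple 'I_n) P (F l))%E).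
  apply: measure_le_sum_fin => //.
    by apply: measurableD => //; exact: measurableI.
  move=> w [[Aw Ew] /= /negP]; rewrite negbK => /eqP X0.
  have hs : size [seq X i w | i <- iota 1 t] == t by rewrite size_map size_iota.
  exists (Tuple hs); split=> //; split; last exact: hB.
  move=> i /=; rewrite size_map size_iota => it.
  case: i it => [|i] it //=.
  by rewrite (nth_map 0%N) ?size_iota // nth_iota // add1n.
have -> : (\sum_(l : t.-tuple 'I_n) P (F l) =
    \sum_(l : t.-tuple 'I_n) \int[P]_(w in A) (path_weight beta (lab w) s l * (B l)%:R)%:E)%E.
  apply: eq_bigr => l _; rewrite /F; case hl : (B l).
    rewrite (_ : follows l `&` _ = follows l); last first.
      by apply/seteqP; split=> w; [case | split].
    by rewrite prob_follows //; apply: eq_integral => w _; rewrite mulr1.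
  rewrite (_ : _ `&` _ = set0) ?measure0; last first.
    by apply/seteqP; split=> w //= [_ []].
  by under eq_integral do rewrite mulr0; rewrite integral0.
rewrite -ge0_integral_sum //; last 2 first.
  - move=> l; apply/measurable_EFinP; apply: measurable_funTS.
    by apply: measurable_funM => //; exact: measurable_path_weight.
  - by move=> l w _; rewrite lee_fin mulr_ge0 ?path_weight_ge0.
rewrite -integral_cst //.
apply: ge0_le_integral => //.
- by move=> w _; apply: sume_ge0 => l _; rewrite lee_fin mulr_ge0 ?path_weight_ge0.
- apply: emeasurable_sum => l; apply/measurable_EFinP; apply: measurable_funTS.
  by apply: measurable_funM => //; exact: measurable_path_weight.
- by move=> w Aw; rewrite sumEFin lee_fin -path_sumE; exact: hk.
Qed.
End cells.

Lemma uniform_prob_itv (R : realType) (a b : R) : 0 <= a -> a < b -> b <= 1 ->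
  uniform_prob (@ltr01 R) `[a, b[%classic = (b - a)%:E.
Proof.
move=> a0 ab b1; rewrite /uniform_prob integral_uniform_pdf setIidl; last first.
  by move=> x /=; rewrite !in_itv /=; lra.
rewrite (eq_integral (fun=> 1%E)); last first.
  move=> x; rewrite inE/= in_itv/= /uniform_pdf => /andP [ax xb].
  by rewrite ifT ?subr0 ?invr1 //; lra.
by rewrite integral_cst //= mul1e lebesgue_measure_itv /= lte_fin ab.
Qed.

Section cells.
Context d (T : measurableType d) (R : realType) (P : probability T R).
Variables (n : nat) (beta : R) (s : 'I_n).
Variables (U : edge n -> {RV P >-> R}) (X : nat -> T -> 'I_n).
Hypothesis n_gt1 : (1 < n)%N.
Hypothesis beta_ge0 : 0 <= beta.
Hypothesis iidU : iid_uniform01 U.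
Hypothesis walkX : walk_given_labels beta s U X.
Variable M : nat.
Hypothesis M_gt0 : (0 < M)%N.

Notation lab w := (fun e => U e w).
Notation labeling := {ffun edge n -> 'I_M}.

(* [f e] is the first base-[M] digit of [u e]. *)
Definition in_cell (f : labeling) (u : edge n -> R) : Prop :=
  forall e, (f e)%:R / M%:R <= u e < (f e).+1%:R / M%:R.

Definition cell (f : labeling) : set T := [set w | in_cell f (lab w)].

Let itv (j : nat) : set R := `[j%:R / M%:R, j.+1%:R / M%:R[%classic.

Let MR_gt0 : 0 < M%:R :> R.
Proof. by rewrite ltr0n. Qed.

Lemma measurable_label_preimage e (B : set R) : measurable B ->
  measurable (U e @^-1` B).
Proof.
move=> mB; rewrite -[_ @^-1` _]setTI.
by apply: (@measurable_funPT _ _ _ _ (U e)).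
Qed.

Lemma cellE f : cell f = [set w | forall e, (U e @^-1` itv (f e)) w].
Proof. by apply/seteqP; split=> w /= h e; have := h e; rewrite /itv /= in_itv. Qed.

Lemma measurable_cell f : measurable (cell f).
Proof.
rewrite cellE; apply: measurable_forall_fin => e.
exact: (measurable_label_preimage e (measurable_itv _)).
Qed.

Lemma sigma_cell f : sigma_of (fun e => U e : T -> R) (cell f).
Proof.
rewrite cellE.
apply: (@measurable_forall_fin _ (g_sigma_algebraType
  (\bigcup_(i in [set: edge n]) preimage_set_system [set: T] (U i) measurable))) => e.
apply: sub_sigma_algebra; exists e => //; exists (itv (f e)).
  exact: measurable_itv.
by rewrite setTI.
Qed.

Let prob_itv e (j : 'I_M) : P (U e @^-1` itv j) = M%:R^-1%:E.
Proof.
have [_ H] := iidU; rewrite (_ : P _ = distribution P (U e) (itv j)) // H; last exact: measurable_itv.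
rewrite uniform_prob_itv.
- by congr (_%:E); rewrite -mulrBl -natr1 addrAC subrr add0r div1r.
- by rewrite divr_ge0.
- by rewrite ltr_pM2r ?invr_gt0 // ltr_nat.
- by rewrite ler_pdivrMr // mul1r ler_nat.
Qed.

Lemma prob_cell f : P (cell f) = (#|{: labeling}|%:R^-1)%:E.
Proof.
have [H _] := iidU.
have := H [set: edge n]%SET (fun e => itv (f e)) (fun e => measurable_itv _).
rewrite (_ : \bigcap_(i in _) _ = cell f); last first.
  rewrite cellE; apply/seteqP; split=> w /=; first by move=> h e; apply: h; rewrite /= inE.
  by move=> h e _; exact: h.
move=> ->; rewrite (eq_bigr (fun=> (M%:R^-1)%:E)); last by move=> e _; exact: prob_itv.
rewrite prodEFin; congr (_%:E); rewrite prodr_const card_ffun card_ord natrX exprVn.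
by congr ((_ ^+ _)^-1); apply: eq_card => e; rewrite inE.
Qed.

(** Cells are half open, so a label equal to 1 lies in no cell and has to be discarded as a null
    event. *)
Lemma labels_in01_ae : P [set w | exists e, ~ (0 <= U e w < 1)] = 0%E.
Proof.
have mI e : measurable (U e @^-1` `[0, 1[%classic).
  exact: (measurable_label_preimage e (measurable_itv _)).
have E (e : edge n) : [set w | ~ (0 <= U e w < 1)] = ~` (U e @^-1` `[0, 1[%classic).
  by apply/seteqP; split=> w /=; rewrite in_itv.
have mE (e : edge n) : measurable [set w | ~ (0 <= U e w < 1)].
  by rewrite E; exact: measurableC.
apply/eqP; rewrite -measure_le0.
pose F e := [set w | ~ (0 <= U e w < 1)].
apply: (@le_trans _ _ (\sum_(e : edge n) P (F e))%E).
  by apply: measure_le_sum_fin => //; exact: measurable_exists_fin.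
rewrite big1 // => e _; rewrite /F E probability_setC //.
have [_ H] := iidU; rewrite (_ : P _ = distribution P (U e) `[0, 1[%classic) // H; last exact: measurable_itv.
by rewrite uniform_prob_itv // subr0 subee.
Qed.

Lemma in_cell_ex u : (forall e, 0 <= u e < 1) -> exists f, in_cell f u.
Proof.
move=> hu.
have lt e : (Num.truncn (u e * M%:R) < M)%N.
  have /andP [u0 u1] := hu e.
  by rewrite truncn_lt_nat ?mulr_ge0 // gtr_pMl.
exists [ffun e => Ordinal (lt e)] => e; rewrite ffunE /=.
have /andP [u0 u1] := hu e.
rewrite ler_pdivrMr // ltr_pdivlMr //.
by have := truncn_itv (mulr_ge0 u0 (ltW MR_gt0)).
Qed.

Lemma in_cell01 f u : in_cell f u -> forall e, 0 <= u e <= 1.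
Proof.
move=> h e; have /andP [h1 h2] := h e; apply/andP; split.
  by apply: le_trans h1; rewrite divr_ge0.
by apply: le_trans (ltW h2) _; rewrite ler_pdivrMr // mul1r ler_nat.
Qed.

(** Cells are equally likely: the bad ones are charged in full, which costs their proportion, and
    the others cost a fraction [kappa] each. *)
Lemma prob_le_cells (E : set T) (bad : pred labeling) (kappa : R) :
  measurable E -> 0 <= kappa ->
  (forall f, ~~ bad f -> (P (cell f `&` E) <= kappa%:E * P (cell f))%E) ->
  (P E <= (kappa + #|bad|%:R / #|{: labeling}|%:R)%:E)%E.
Proof.
move=> mE k0 H; pose N := [set w | exists e, ~ (0 <= U e w < 1)].
have mU e : measurable_fun [set: T] (U e) by exact: measurable_funPT.
have mN : measurable N.
  apply: measurable_exists_fin => e; apply: measurable_iff (measurableC (A := U e @^-1` `[0, 1[%classic) _).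
    by move=> w /=; rewrite in_itv.
  exact: (measurable_label_preimage e (measurable_itv _)).
have mEN : measurable (E `\` N) by exact: measurableD.
apply: (@le_trans _ _ (P (N `|` (E `\` N)))).
  apply: le_measure; rewrite ?inE //; first exact: measurableU.
  by move=> w h; have [h'|h'] := pselect (N w); [left|right].
apply: le_trans (measureU2 _ _ _) _ => //.
rewrite [X in (X + _)%E](_ : _ = 0%E) ?add0e; last exact: labels_in01_ae.
have mcE f : measurable (cell f `&` E).
  by apply: measurableI => //; exact: measurable_cell.
apply: (@le_trans _ _ (\sum_(f : labeling) P (cell f `&` E))%E).
  apply: measure_le_sum_fin => //.
  move=> w [Ew Nw]; have [|f hf] := @in_cell_ex (lab w).
    by move=> e; apply: contrapT => h; apply: Nw; exists e.
  by exists f.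
set c : R := #|{: labeling}|%:R^-1.
have card_gt0 : 0 < #|{: labeling}|%:R :> R.
  by rewrite ltr0n card_ffun card_ord expn_gt0 M_gt0.
have c0 : 0 <= c by rewrite invr_ge0 ltW.
apply: (@le_trans _ _ (\sum_(f : labeling) (kappa * c + (if bad f then c else 0))%:E)%E).
  apply: lee_sum => f _; case: ifPn => bf.
    apply: (@le_trans _ _ (P (cell f))).
      apply: le_measure; rewrite ?inE //; exact: measurable_cell.
    by rewrite prob_cell lee_fin lerDr mulr_ge0.
  by apply: le_trans (H _ bf) _; rewrite prob_cell addr0 EFinM.
rewrite sumEFin lee_fin big_split /= -big_mkcond /= !sumr_const.
rewrite -[X in X + _ <= _]mulr_natr -[X in _ + X <= _]mulr_natl /c -mulrA mulVf ?mulr1 //.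
exact: lt0r_neq0.
Qed.
End cells.

(** * Prim's run as a function of the order of the labels *)

Section same_order.
Variables (R : realType) (n : nat) (u u' : edge n -> R) (s : 'I_n).
Hypothesis n_gt1 : (1 < n)%N.
Hypothesis uu' : forall e e', (u e <= u e') = (u' e <= u' e').

Lemma min_label_edge_same_order A : min_label_edge u A = min_label_edge u' A.
Proof.
apply: eq_pick => e /=; congr (_ && _).
by apply: eq_forallb => e'; rewrite uu'.
Qed.

Lemma prim_vertices_same_order k : prim_vertices u s k = prim_vertices u' s k.
Proof.
rewrite /prim_vertices; elim: k => [//|k IH] /=.
by rewrite IH min_label_edge_same_order.
Qed.

Lemma prim_same_order k : prim s u k = prim s u' k.
Proof.
rewrite /prim /added_edge min_label_edge_same_order.
by have := prim_vertices_same_order k; rewrite /prim_vertices => ->.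
Qed.

Lemma prim_run_same_order y v : prim_run u s y v -> prim_run u' s y v.
Proof.
move=> H k kn; have [yW vW h1 h2 h3] := H k kn.
rewrite -!prim_vertices_same_order -prim_same_order; split=> // a b aW bW.
have ab : a != b by apply: contraNneq bW => <-.
have yv : y k != v k by apply: contraNneq vW => <-.
have [e he] := edge_of_ex ab; have [e' he'] := edge_of_ex yv.
by have := h3 a b aW bW; rewrite !(labelE _ he) !(labelE _ he') uu'.
Qed.
End same_order.

(** * Bounds for the walk with fixed labels *)

Section walk_bounds.
Variables (R : realType) (n : nat) (beta : R) (u : edge n -> R) (s : 'I_n).
Hypothesis n_gt1 : (1 < n)%N.
Hypothesis beta_ge0 : 0 <= beta.
Hypothesis u01 : forall e, 0 <= u e <= 1.

(** Labels in [0, 1] give conductances between exp (- beta) and 1. This crude bound only ensures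
    that all vertices are covered in the long run; its value does not enter the final estimates. *)
Definition min_transition : R := expR (- beta) / n%:R.

Lemma min_transition_gt0 : 0 < min_transition.
Proof. by rewrite divr_gt0 ?expR_gt0 // ltr0n; lia. Qed.

Lemma min_transition_le1 : min_transition <= 1.
Proof.
rewrite /min_transition ler_pdivrMr ?mul1r ?ltr0n; last by lia.
apply: (@le_trans _ _ 1); last by rewrite ler1n; lia.
by rewrite -expR0 ler_expR oppr_le0.
Qed.

Lemma transition_ge_min a z : a != z -> min_transition <= transition beta u a z.
Proof.
move=> az; rewrite transitionE /min_transition.
have [e he] := edge_of_ex az; rewrite (conductanceE _ _ he).
apply: ler_pM.
- exact: expR_ge0.
- by rewrite invr_ge0.
- rewrite ler_expR lerN2 -[leRHS]mulr1 ler_wpM2l //.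
  by have /andP [] := u01 e.
- rewrite lef_pV2 ?posrE ?ltr0n; [|lia|exact: total_conductance_gt0].
  rewrite /total_conductance -[n in leRHS]card_ord -sum1_card natr_sum.
  apply: ler_sum => b _; rewrite /conductance; case: edge_of => [e'|//].
  rewrite -expR0 ler_expR oppr_le0 mulr_ge0 //.
  by have /andP [] := u01 e'.
Qed.

Lemma path_sum_not_cover t :
  path_sum beta u t s (fun l => [exists z, z \notin s :: l]) <=
    n%:R * (1 - min_transition) ^+ t.
Proof.
pose B' l := has (fun z => z \notin s :: l) (enum 'I_n).
have -> : path_sum beta u t s (fun l => [exists z, z \notin s :: l]) =
    path_sum beta u t s B'.
  apply: eq_path_sum => l; apply/existsP/hasP => [[z hz]|[z _ hz]]; exists z => //.
  by rewrite mem_enum.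
apply: le_trans (path_sum_has beta u n_gt1 (enum 'I_n) t s (fun z l => z \notin s :: l)) _.
apply: (@le_trans _ _ (\sum_(z <- enum 'I_n) (1 - min_transition) ^+ t)).
  apply: ler_sum => z _; apply: path_sum_avoid => //.
    exact: min_transition_le1.
  by move=> a; exact: transition_ge_min.
by rewrite big_enum /= sumr_const card_ord mulr_natl.
Qed.

Variables (y v : nat -> 'I_n).
Hypothesis yvP : prim_run u s y v.
Notation W := (prim_vertices u s).

Lemma failure_le delta t :
  (forall k a b, (k < n.-1)%N -> a \in W k -> b \notin W k ->
     wrong_exit (y k) (v k) a b -> label u (y k) (v k) + delta <= label u a b) ->
  path_sum beta u t s (failure W y v n.-1 0 s) <=
    n%:R * (n%:R * (n%:R * expR (- (beta * delta / 2)))).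
Proof.
move=> gap; set eps := n%:R * (n%:R * expR _).
have e0 : 0 <= eps by rewrite !mulr_ge0 ?expR_ge0.
have n0 : (0 < n.-1)%N by lia.
have H k t' : (k < n.-1)%N ->
    exit_prob beta u (W k) (wrong_exit (y k) (v k)) t' (newest s v k) <= eps.
  by move=> kn; apply: wrong_exit_gap => // a b; exact: gap.
have s0 : s \in W 0 by rewrite inE.
have He k t' : (k.+1 < n.-1)%N -> exit_prob beta u (W k.+1)
    (wrong_exit (y k.+1) (v k.+1)) t' (v k) <= (fun=> eps) k.+1.
  by move=> kn; exact: (H k.+1 t' kn).
apply: le_trans (failure_path_sum n_gt1 _ He (fun=> e0) t n0 s0) _.
  by move=> k kn; have [] := yvP kn.
rewrite sumr_const_nat; apply: (@le_trans _ _ (eps + eps *+ (n.-1 - 1))).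
  by rewrite lerD2r; exact: (H 0%N t n0).
by rewrite -mulrS -[leLHS]mulr_natl ler_wpM2r // ler_nat; lia.
Qed.

(** Steps without a nontrivial bound contribute a factor 1, so only the number of [good] steps
    matters. *)
Lemma success_le (good : pred nat) (q : R) t : 0 <= q -> q <= 1 ->
  (forall k t a, (k < n.-1)%N -> good k -> a \in W k ->
     exit_prob beta u (W k) (right_exit (y k) (v k)) t a <= q) ->
  path_sum beta u t s (success W y v n.-1 0 s) <=
    q ^+ (\sum_(0 <= k < n.-1) good k)%N.
Proof.
move=> q0 q1 H.
pose Q k := if good k then q else 1.
have HQ k t' a : (k < n.-1)%N -> a \in W k ->
    exit_prob beta u (W k) (right_exit (y k) (v k)) t' a <= Q k.
  move=> kn aW; rewrite /Q; case: ifP => gk; first exact: H.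
  exact: exit_prob_le1.
have Q0 k : 0 <= Q k by rewrite /Q; case: ifP.
have n0 : (0 < n.-1)%N by lia.
have s0 : s \in W 0 by rewrite inE.
apply: le_trans (success_path_sum n_gt1 _ HQ Q0 t n0 s0) _.
  by move=> k kn; have [] := yvP kn.
have -> : q ^+ (\sum_(0 <= k < n.-1) good k)%N = \prod_(0 <= k < n.-1) Q k.
  by rewrite -prodrXr; apply: eq_bigr => k _; rewrite /Q; case: (good k).
rewrite [leRHS]big_ltn //; apply: ler_wpM2r; first exact: prodr_ge0.
exact: HQ.
Qed.
End walk_bounds.

Section cell_bounds.
Context d (T : measurableType d) (R : realType) (P : probability T R).
Variables (n : nat) (beta : R) (s : 'I_n).
Variables (U : edge n -> {RV P >-> R}) (X : nat -> T -> 'I_n).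
Hypothesis n_gt1 : (1 < n)%N.
Hypothesis beta_ge0 : 0 <= beta.
Hypothesis iidU : iid_uniform01 U.
Hypothesis walkX : walk_given_labels beta s U X.
Variable M : nat.
Hypothesis M_gt0 : (0 < M)%N.
Variables (f : {ffun edge n -> 'I_M}) (y v : nat -> 'I_n).
Hypothesis f_inj : injective f.

Definition digits : edge n -> R := fun e => (f e)%:R.

Hypothesis yvP : prim_run digits s y v.
Notation W := (prim_vertices digits s).

Lemma in_cell_order (u : edge n -> R) : in_cell f u -> forall e e', (u e <= u e') = (digits e <= digits e').
Proof.
move=> hu.
have MR_gt0 : 0 < M%:R :> R by rewrite ltr0n.
have lt e e' : (f e < f e')%N -> u e < u e'.
  move=> h; have /andP [_ h1] := hu e; have /andP [h2 _] := hu e'.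
  apply: lt_le_trans h1 (le_trans _ h2).
  by rewrite ler_pM2r ?invr_gt0 // ler_nat.
move=> e e'; rewrite /digits ler_nat.
case: (ltngtP (f e) (f e')) => h; first by rewrite ltW ?lt.
  by apply/negbTE; rewrite -ltNge lt.
by rewrite (f_inj (val_inj h)) lexx.
Qed.

Lemma in_cell_run (u : edge n -> R) : in_cell f u -> prim_run u s y v /\ prim_vertices u s = W.
Proof.
move=> hu; have h := in_cell_order hu; split.
  by apply: prim_run_same_order yvP => // e e'; rewrite h.
by apply/funext => k; apply: prim_vertices_same_order.
Qed.

(** Paths that miss a vertex are added to [B]. Their weight is below any [e] for large [t],
    uniformly on the cell, and [e] is arbitrary; this is why [kappa] has to be valid for every
    [t]. *)
Lemma cell_le (E : set T) (B : pred (seq 'I_n)) (kappa : R) : measurable E ->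
  0 <= kappa ->
  (forall u t, in_cell f u -> path_sum beta u t s B <= kappa) ->
  (forall w t, cell U f w -> E w -> X 0%N w = s ->
     (forall z, z \in s :: [seq X i w | i <- iota 1 t]) ->
     B [seq X i w | i <- iota 1 t]) ->
  (P (cell U f `&` E) <= kappa%:E * P (cell U f))%E.
Proof.
move=> mE k0 hk hB; apply/lee_addgt0Pr => e e0.
have m0 := @min_transition_gt0 R n beta n_gt1 beta_ge0; have m1 := min_transition_le1 n_gt1 beta_ge0.
have [t ht] : exists t, n%:R * (1 - min_transition n beta) ^+ t <= e.
  have : `|1 - min_transition n beta| < 1.
    by rewrite ger0_norm; lra.
  move=> /cvg_expr /cvgrPdist_le H.
  have n0 : 0 < n%:R :> R by rewrite ltr0n; lia.
  have [t _ /(_ t (leqnn t))] := H _ (divr_gt0 e0 n0).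
  rewrite sub0r normrN /= ler_pdivlMr // mulrC => h; exists t.
  by apply: le_trans h; rewrite ler_pM2l // ler_norm.
have -> : (kappa%:E * P (cell U f) + e%:E = (kappa%:E * P (cell U f) + e%:E * 1))%E.
  by rewrite mule1.
apply: (@le_trans _ _ ((kappa + e)%:E * P (cell U f))%E).
  apply: (prob_path_le (t := t) n_gt1 walkX
     (B := predU B (fun l => [exists z, z \notin s :: l]))) => //.
  - exact: measurable_cell.
  - exact: sigma_cell.
  - move=> w hw; apply: le_trans (path_sumU _ _ n_gt1 _ _ _ _) _; apply: lerD; first exact: hk.
    apply: le_trans ht; apply: path_sum_not_cover => //.
    exact: (in_cell01 M_gt0 hw).
  - move=> w hw Ew X0 /=; case: (boolP [exists z, _]) => h; rewrite ?orbT // orbF.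
    apply: hB => // z; move: h; rewrite negb_exists => /forallP /(_ z).
    by rewrite negbK.
rewrite EFinD ge0_muleDl ?lee_fin ?(ltW e0) // leeD2l // lee_wpmul2l ?lee_fin ?(ltW e0) //.
by apply: probability_le1; exact: measurable_cell.
Qed.

Notation same := (same_run s (fun e => U e : T -> R) X).

Lemma measurable_same : measurable same.
Proof.
apply: measurable_same_run; last exact: measurable_position walkX.
by move=> e; exact: measurable_label.
Qed.

Lemma cell_not_same_run kappa : 0 <= kappa ->
  (forall u t, in_cell f u -> path_sum beta u t s (failure W y v n.-1 0 s) <= kappa) ->
  (P (cell U f `&` ~` same) <= kappa%:E * P (cell U f))%E.
Proof.
move=> k0 hk; apply: cell_le hk _ => //; first exact: measurableC measurable_same.
move=> w t hw ns X0 cov; have [run WE] := in_cell_run hw.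
rewrite -WE; apply: contrapT => /negP nf; apply: ns => k kn.
by apply: (not_failure_same_run (w := fun t => X t w) _ run X0 cov nf).
Qed.

Lemma cell_same_run kappa : 0 <= kappa ->
  (forall u t, in_cell f u -> path_sum beta u t s (success W y v n.-1 0 s) <= kappa) ->
  (P (cell U f `&` same) <= kappa%:E * P (cell U f))%E.
Proof.
move=> k0 hk; apply: cell_le hk _ => //; first exact: measurable_same.
move=> w t hw sw X0 cov; have [run WE] := in_cell_run hw.
rewrite -WE; apply: (same_run_success (w := fun t => X t w) _ run X0 cov) => //.
Qed.
End cell_bounds.

(** * Uniform labelings *)

Section uniform_labelings.
Variables (R : realType) (E : finType) (M : nat).
Hypothesis M_gt0 : (0 < M)%N.
Notation labeling := {ffun E -> 'I_M}.
Implicit Types (F G : labeling -> R) (B : pred labeling) (D : {set E}).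

Definition mean F : R := (\sum_f F f) / #|{: labeling}|%:R.
Definition freq B : R := mean (fun f => (B f)%:R).

Lemma card_labeling_gt0 : 0 < #|{: labeling}|%:R :> R.
Proof. by rewrite ltr0n card_ffun card_ord expn_gt0 M_gt0. Qed.

Lemma freqE B : freq B = #|B|%:R / #|{: labeling}|%:R.
Proof.
rewrite /freq /mean -natr_sum; congr (_%:R / _).
rewrite -sum1_card [RHS]big_mkcond; apply: eq_bigr => f _.
by rewrite unfold_in; case: (B f).
Qed.

Lemma mean_le F G : (forall f, F f <= G f) -> mean F <= mean G.
Proof. by move=> h; rewrite ler_pM2r ?invr_gt0 ?card_labeling_gt0 // ler_sum. Qed.

Lemma eq_mean F G : F =1 G -> mean F = mean G.
Proof. by move=> h; rewrite /mean (eq_bigr _ (fun f _ => h f)). Qed.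

Lemma mean_cst c : mean (fun=> c) = c.
Proof.
rewrite /mean sumr_const -[X in X / _]mulr_natr mulfK //.
by rewrite gt_eqF // card_labeling_gt0.
Qed.

Lemma meanZ c F : mean (fun f => c * F f) = c * mean F.
Proof. by rewrite /mean -mulr_sumr mulrA. Qed.

Lemma mean_sum (I : Type) (r : seq I) (Q : pred I) (F : I -> labeling -> R) :
  mean (fun f => \sum_(i <- r | Q i) F i f) = \sum_(i <- r | Q i) mean (F i).
Proof. by rewrite /mean exchange_big /= mulr_suml. Qed.

Lemma meanD F G : mean (fun f => F f + G f) = mean F + mean G.
Proof. by rewrite /mean big_split /= mulrDl. Qed.

Lemma mean_ge0 F : (forall f, 0 <= F f) -> 0 <= mean F.
Proof. by move=> h; rewrite -(mean_cst 0); apply: mean_le. Qed.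

Lemma freq_sub B B' : (forall f, B f -> B' f) -> freq B <= freq B'.
Proof.
by move=> h; apply: mean_le => f; have := h f; case: (B f) => [/(_ isT) ->|].
Qed.

Lemma freqU B B' : freq (predU B B') <= freq B + freq B'.
Proof.
rewrite -meanD; apply: mean_le => f /=.
by case: (B f); case: (B' f) => /=; rewrite ?addr0 ?add0r // lerDl.
Qed.

Lemma freq_exists (I : finType) (B : I -> pred labeling) (Q : pred I) :
  freq (fun f => [exists i, Q i && B i f]) <= \sum_(i | Q i) freq (B i).
Proof.
rewrite -mean_sum; apply: mean_le => f; case: (boolP [exists i, _]) => [/existsP [i /andP [Qi Bi]]|_].
  by rewrite (bigD1 i) //= Bi lerDl sumr_ge0.
exact: sumr_ge0.
Qed.

Lemma markov_mean (F : labeling -> R) B c : 0 < c -> (forall f, 0 <= F f) ->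
  (forall f, B f -> c <= F f) -> freq B <= mean F / c.
Proof.
move=> c0 F0 h; rewrite mulrC -meanZ; apply: mean_le => f.
case: (boolP (B f)) => [/h H|_]; last by rewrite mulr_ge0 ?invr_ge0 ?(ltW c0).
by rewrite mulrC ler_pdivlMr // mul1r.
Qed.

Definition mix D (f g : labeling) : labeling :=
  [ffun e => if e \in D then g e else f e].

(* Resampling the labels of [D]: the map (f, g) |-> (mix D f g, mix D g f) is an
   involution. *)
Lemma mean_mix D F : mean F = mean (fun f => mean (fun g => F (mix D f g))).
Proof.
have c0 := lt0r_neq0 card_labeling_gt0.
have H : \sum_f \sum_g F (mix D f g) = #|{: labeling}|%:R * \sum_f F f.
  rewrite pair_big /=.
  rewrite (reindex_inj (h := fun p : labeling * labeling => (mix D p.1 p.2, mix D p.2 p.1))) /=.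
    rewrite -(pair_big predT predT (fun f g => F (mix D (mix D f g) (mix D g f)))) /=.
    transitivity (\sum_f \sum_(g : labeling) F f).
      apply: eq_bigr => f _; apply: eq_bigr => g _; congr F.
      by apply/ffunP => e; rewrite !ffunE; case: (e \in D).
    rewrite mulr_sumr; apply: eq_bigr => f _.
    by rewrite sumr_const -[LHS]mulr_natl.
  move=> [f g] [f' g'] /= [/ffunP h1 /ffunP h2]; congr pair; apply/ffunP => e.
    by have := h1 e; have := h2 e; rewrite !ffunE; case: (e \in D).
  by have := h1 e; have := h2 e; rewrite !ffunE; case: (e \in D).
rewrite /mean -mulr_suml H [X in _ = X / _ / _]mulrC mulfK //.
Qed.

(** The hypotheses say that [F] reads only the labels in [D] and [G] only those outside [D]. *)
Lemma mean_indep D F G :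
  (forall f g, F (mix D f g) = F g) -> (forall f g, G (mix D f g) = G f) ->
  mean (fun f => F f * G f) = mean F * mean G.
Proof.
move=> hF hG; rewrite (mean_mix D).
transitivity (mean (fun f => mean F * G f)); last by rewrite meanZ.
apply: eq_mean => f; rewrite mulrC -meanZ; apply: eq_mean => g.
by rewrite hF hG mulrC.
Qed.

Lemma mean_prod (a : E -> 'I_M -> R) :
  mean (fun f => \prod_e a e (f e)) = \prod_e ((\sum_j a e j) / M%:R).
Proof.
rewrite /mean -(bigA_distr_bigA (fun e j => a e j)) big_split /=; congr (_ * _).
by rewrite prodr_const card_ffun card_ord natrX exprVn.
Qed.

Lemma freq_forall (S : E -> pred 'I_M) :
  freq (fun f => [forall e, S e (f e)]) = \prod_e (#|S e|%:R / M%:R).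
Proof.
rewrite (_ : \prod_e _ = \prod_e ((\sum_j (S e j)%:R) / M%:R)); last first.
  apply: eq_bigr => e _; rewrite -natr_sum; congr (_%:R / _).
  rewrite -sum1_card [LHS]big_mkcond; apply: eq_bigr => j _.
  by rewrite unfold_in; case: (S e j).
rewrite -mean_prod; apply: eq_mean => f.
case: (boolP [forall e, _]) => [/forallP h|].
  by rewrite big1 // => e _; rewrite h.
by rewrite negb_forall => /existsP [e /negbTE h]; rewrite (bigD1 e) //= h mul0r.
Qed.

Lemma freq_at e (S : pred 'I_M) : freq (fun f => S (f e)) = #|S|%:R / M%:R.
Proof.
have MR : M%:R != 0 :> R by rewrite pnatr_eq0 -lt0n.
transitivity (freq (fun f => [forall e', (fun j => (e' == e) ==> S j) (f e')])).
  apply: eq_mean => f; congr (_%:R); congr nat_of_bool.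
  apply/idP/forallP => [h e'|/(_ e)]; last by rewrite eqxx.
  by apply/implyP => /eqP ->.
rewrite (freq_forall (fun e' j => (e' == e) ==> S j)) (bigD1 e) //= [X in _ * X]big1 ?mulr1.
  by congr (_%:R / _); apply: eq_card => j; rewrite unfold_in /= eqxx.
move=> e' /negbTE h; rewrite (_ : #|_| = M) ?divff //.
by rewrite -[RHS]card_ord; apply: eq_card => j; rewrite unfold_in /= h.
Qed.

(** With all labels but one frozen, that label hits a given value with frequency 1 / M. *)
Lemma freq_not_injective : freq (fun f => ~~ injectiveb f) <= (#|E| ^ 2)%:R / M%:R.
Proof.
pose B (p : E * E) (f : labeling) := f p.1 == f p.2.
apply: (@le_trans _ _ (freq (fun f => [exists p, (p.1 != p.2) && B p f]))).
  apply: freq_sub => f /injectivePn [x [y xy h]]; apply/existsP; exists (x, y).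
  by rewrite xy /B /= h eqxx.
apply: le_trans (freq_exists B (fun p => p.1 != p.2)) _.
apply: (@le_trans _ _ (\sum_(p : E * E) M%:R^-1)); last first.
  by rewrite sumr_const card_prod -[leLHS]mulr_natl.
rewrite big_mkcond /=; apply: ler_sum => -[x y] _ /=; case: ifP => xy; last first.
  by rewrite invr_ge0.
rewrite /freq (mean_mix [set x]%SET) -[leRHS]mean_cst; apply: mean_le => f.
under eq_mean => g do rewrite /B !ffunE /= !inE eqxx [y == x]eq_sym (negbTE xy).
have := freq_at x (fun j => j == f y); rewrite /freq => ->.
by rewrite (_ : #|_| = 1%N) ?mul1r // -(card1 (f y)); apply: eq_card.
Qed.

End uniform_labelings.

Lemma card_ord_itv M a b : (b <= M)%N ->
  #|[pred j : 'I_M | (a <= j < b)%N]| = (b - a)%N.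
Proof.
move=> bM; have [ab|ab] := leqP b a.
  rewrite (eqP ab); apply: eq_card0 => j; rewrite !inE.
  by apply/negbTE/negP; lia.
rewrite cardE -(size_map val) -[RHS](size_iota a); apply: perm_size.
apply: uniq_perm; [by rewrite map_inj_uniq ?enum_uniq //; exact: val_inj|exact: iota_uniq|].
move=> i; rewrite mem_iota subnKC ?(ltnW ab) //; apply/mapP/idP.
  by move=> [j]; rewrite mem_enum inE => h ->.
move=> /andP [ai ib]; exists (Ordinal (leq_trans ib bM)) => //.
by rewrite mem_enum inE /= ai.
Qed.

Lemma card_ord_itv_le M a b : (#|[pred j : 'I_M | (a <= j < b)%N]| <= b - a)%N.
Proof.
have [bM|bM] := leqP b M; first by rewrite card_ord_itv.
apply: (@leq_trans #|[pred j : 'I_M | (a <= j < M)%N]|).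
  by apply: subset_leq_card; apply/fintype.subsetP => j; rewrite !inE => /andP [-> _] /=.
by rewrite card_ord_itv //; lia.
Qed.

Lemma card_edge_le n : (#|{: edge n}| <= n ^ 2)%N.
Proof.
rewrite card_sig (_ : #|_| = 'C(n, 2)); last first.
  by rewrite -[in RHS](card_ord n) -card_draws; apply: eq_card => e; rewrite !inE.
by rewrite bin2 -[X in (_ <= X)%N]doubleK -divn2; lia.
Qed.

(** * The upper regime *)

Section close_calls.
Variables (R : realType) (n : nat) (s : 'I_n) (M Delta : nat).
Hypothesis n_gt1 : (1 < n)%N.
Hypothesis M_gt0 : (0 < M)%N.
Notation labeling := {ffun edge n -> 'I_M}.
Implicit Types (f : labeling) (e g : edge n).
Notation W f := (prim_vertices (digits R f) s).
Notation pr f := (prim s (digits R f)).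

(** An edge still in the cut at step [k] has not been added before, so until then each step took the
    minimum over the other edges, whose labels agree. Both runs thus reach the same set and choose
    the same edge there. *)
Lemma prim_forget_label f f' e k g g' : injective f -> injective f' ->
  (forall e', e' != e -> f e' = f' e') -> (k < n.-1)%N ->
  e \in cut_edges (W f k) -> e \in cut_edges (W f' k) ->
  pr f k = Some g -> pr f' k = Some g' -> g != e -> g' != e -> g = g'.
Proof.
move=> inj inj' ff' kn ec ec' hg hg' ge ge'.
have [y [v run]] := prim_run_ex (digits R f) s n_gt1.
have [y' [v' run']] := prim_run_ex (digits R f') s n_gt1.
have same_next j h h' : (j < n.-1)%N -> W f j = W f' j -> pr f j = Some h ->
    pr f' j = Some h' -> h != e -> h' != e -> h = h'.
  move=> jn WE hh hh' he he'.
  have [h1 h2] := min_label_edge_some hh.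
  have [h1' h2'] := min_label_edge_some hh'.
  move: h1 h2 h1' h2'; rewrite -!/(prim_vertices _ _ _) WE => h1 h2 h1' h2'.
  have := h2 _ h1'; have := h2' _ h1; rewrite /digits !ler_nat -(ff' _ he) -(ff' _ he').
  by move=> l1 l2; apply: inj; apply: val_inj; apply/eqP; rewrite eqn_leq l1 l2.
have [a [b [aW bW hab]]] := cut_edgesP ec.
have [a' [b' [aW' bW' hab']]] := cut_edgesP ec'.
have WE j : (j <= k)%N -> W f j = W f' j.
  elim: j => [//|j IH] jk; have WE := IH (ltnW jk).
  have jn : (j < n.-1)%N by exact: leq_trans jk (ltnW kn).
  have [yW vW hyv WS _] := run j jn; have [yW' vW' hyv' WS' _] := run' j jn.
  have yv : y j != v j by apply: contraNneq vW => <-.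
  have yv' : y' j != v' j by apply: contraNneq vW' => <-.
  have [h hh] := edge_of_ex yv; have [h' hh'] := edge_of_ex yv'.
  have sub : W f j.+1 \subset W f k by apply: prim_vertices_mono run _ _ jk (ltnW kn).
  have sub' : W f' j.+1 \subset W f' k by apply: prim_vertices_mono run' _ _ jk (ltnW kn).
  (* Had [e] been added at a step before [k], both its endpoints would lie in [W f k]. *)
  have he : h != e.
    apply: contraNneq bW => he; move: hh; rewrite he => hh.
    have [[_ <-]|[ey _]] := edge_of_inj hh hab.
      by rewrite (fintype.subsetP sub) // WS !inE eqxx.
    by rewrite -ey (fintype.subsetP sub) // WS !inE yW orbT.
  have he' : h' != e.
    apply: contraNneq bW' => he'; move: hh'; rewrite he' => hh'.
    have [[_ <-]|[ey _]] := edge_of_inj hh' hab'.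
      by rewrite (fintype.subsetP sub') // WS' !inE eqxx.
    by rewrite -ey (fintype.subsetP sub') // WS' !inE yW' orbT.
  have E := same_next j h h' jn WE (etrans hyv hh) (etrans hyv' hh') he he'.
  move: hh'; rewrite -E => hh'; rewrite WE in yW vW.
  by have [_ ev] := edge_of_cut_inj yW vW yW' vW' hh hh'; rewrite WS WS' WE ev.
exact: same_next kn (WE k (leqnn k)) hg hg' ge ge'.
Qed.

Definition close_call e k f : bool :=
  [&& injectiveb f, e \in cut_edges (W f k) &
      if pr f k is Some g then (g != e) && (f e <= f g + Delta)%N else false].

(** Freeze all labels except that of [e]. On the event, the edge [h] chosen at step [k] is always
    the same, so the label of [e] is confined to the [Delta.+1] values starting at [f h]. *)
Lemma freq_close_call e k : (k < n.-1)%N ->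
  freq R (close_call e k) <= Delta.+1%:R / M%:R.
Proof.
move=> kn; rewrite /freq (mean_mix M_gt0 [set e]%SET) -[leRHS](mean_cst (edge n) M_gt0).
apply: mean_le => // f.
(* A reference labeling in the event determines [h]; without one the frequency is 0. *)
have [[g0 h0]|none] := pselect (exists g : labeling, close_call e k (mix [set e]%SET f g)); last first.
  apply: (@le_trans _ _ (mean (fun _ : labeling => 0 : R))); last by rewrite mean_cst.
  by apply: mean_le => // g; case: (boolP (close_call _ _ _)) => // h; case: none; exists g.
move: h0; rewrite /close_call; case eh : (pr (mix [set e]%SET f g0) k) => [h|];
  last by rewrite !andbF.
move=> /and3P [/injectiveP inj0 ec0 /andP [he _]].
apply: (@le_trans _ _ (freq R (fun g : labeling => (f h <= g e < f h + Delta.+1)%N))); last first.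
  have := freq_at R M_gt0 e (fun j : 'I_M => (f h <= j < f h + Delta.+1)%N).
  move=> ->; rewrite ler_pM2r ?invr_gt0 ?ltr0n // ler_nat.
  apply: leq_trans (card_ord_itv_le M (f h) (f h + Delta.+1)) _; lia.
apply: freq_sub => // g; rewrite /close_call; case eh' : (pr (mix [set e]%SET f g) k) => [h'|];
  last by rewrite !andbF.
move=> /and3P [/injectiveP inj1 ec1 /andP [he' close]].
have E : h = h'.
  apply: (prim_forget_label inj0 inj1 _ kn ec0 ec1 eh eh' he he') => e' e'e.
  by rewrite !ffunE !inE (negbTE e'e).
move: close eh'; rewrite -E !ffunE !inE eqxx (negbTE he) => close eh'.
have [_ /(_ e ec1)] := min_label_edge_some eh'.
by rewrite /digits ler_nat !ffunE !inE eqxx (negbTE he) => ->; rewrite addnS ltnS close.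
Qed.

Definition risky f : bool :=
  ~~ injectiveb f || [exists p : edge n * 'I_n.-1, close_call p.1 p.2 f].

Lemma freq_risky : freq R risky <= (n ^ 4)%:R / M%:R + (n ^ 3)%:R * (Delta.+1%:R / M%:R).
Proof.
have MR0 : 0 <= M%:R^-1 :> R by rewrite invr_ge0.
apply: le_trans (freqU _ M_gt0 _ _) _; apply: lerD.
  apply: le_trans (freq_not_injective _ _ M_gt0) _; rewrite ler_wpM2r // ler_nat.
  by rewrite (expnM n 2 2) leq_exp2r // card_edge_le.
have := freq_exists R M_gt0 (I := (edge n * 'I_n.-1)%type) (fun p => close_call p.1 p.2) predT.
move=> /le_trans; apply.
apply: (@le_trans _ _ (\sum_(p : edge n * 'I_n.-1) Delta.+1%:R / M%:R)).
  by apply: ler_sum => p _; exact: freq_close_call.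
rewrite sumr_const card_prod card_ord -[leLHS]mulr_natl ler_wpM2r ?divr_ge0 // ler_nat.
by rewrite expnSr leq_mul ?card_edge_le ?leq_pred.
Qed.

(** Digits more than [Delta] apart leave a gap of [Delta] cells once one cell is lost to
    rounding. *)
Lemma not_risky_gap f (u : edge n -> R) y v k a b : ~~ risky f -> in_cell f u ->
  prim_run (digits R f) s y v -> (k < n.-1)%N -> a \in W f k -> b \notin W f k ->
  wrong_exit (y k) (v k) a b ->
  label u (y k) (v k) + Delta%:R / M%:R <= label u a b.
Proof.
rewrite negb_or negbK => /andP [/injectiveP inj ncc] hu run kn aW bW wr.
have [yW vW hyv WS _] := run k kn.
have yv : y k != v k by apply: contraNneq vW => <-.
have ab : a != b by apply: contraNneq bW => <-.
have [g hg] := edge_of_ex yv; have [e he] := edge_of_ex ab.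
rewrite (labelE _ hg) (labelE _ he).
have ge : g != e.
  apply: contraNneq wr => ge; move: hg; rewrite ge => hg.
  have [-> ->] := edge_of_cut_inj yW vW aW bW hg he.
  by rewrite /right_exit !eqxx.
have far : (f g + Delta < f e)%N.
  rewrite ltnNge; apply/negP => close; move/negP: ncc; apply.
  apply/existsP; exists (e, Ordinal kn) => /=.
  apply/and3P; split; first exact/injectiveP.
    exact: edge_of_cut aW bW he.
  by rewrite hyv hg ge close.
have /andP [_ h1] := hu g; have /andP [h2 _] := hu e.
apply: le_trans h2; apply: (@le_trans _ _ ((f g).+1%:R / M%:R + Delta%:R / M%:R)).
  by rewrite lerD2r ltW.
by rewrite -mulrDl ler_pM2r ?invr_gt0 ?ltr0n // -natrD ler_nat; lia.
Qed.
End close_calls.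

Section upper_regime.
Context d (T : measurableType d) (R : realType) (P : probability T R).
Variables (n : nat) (beta : R) (s : 'I_n).
Variables (U : edge n -> {RV P >-> R}) (X : nat -> T -> 'I_n).
Hypothesis n_gt1 : (1 < n)%N.
Hypothesis beta_ge0 : 0 <= beta.
Hypothesis iidU : iid_uniform01 U.
Hypothesis walkX : walk_given_labels beta s U X.
Notation same := (same_run s (fun e => U e : T -> R) X).

Lemma prob_not_same_run M Delta : (0 < M)%N ->
  (P (~` same) <= (n%:R ^+ 3 * expR (- (beta * (Delta%:R / M%:R) / 2)) +
     ((n ^ 4)%:R / M%:R + (n ^ 3)%:R * (Delta.+1%:R / M%:R)))%:E)%E.
Proof.
move=> M_gt0; set kappa := _ * expR _.
have k0 : 0 <= kappa by rewrite mulr_ge0 ?exprn_ge0 ?expR_ge0.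
have mS : measurable (~` same) by apply: measurableC; exact: measurable_same walkX.
apply: le_trans (prob_le_cells iidU M_gt0 (bad := risky R s Delta) mS k0 _) _; last first.
  by rewrite lee_fin lerD2l -freqE freq_risky.
move=> f nr; have [y [v run]] := prim_run_ex (digits R f) s n_gt1.
have inj : injective f by move: nr; rewrite negb_or negbK => /andP [/injectiveP].
apply: (cell_not_same_run n_gt1 beta_ge0 walkX M_gt0 inj run k0) => u t hu.
have [runu WE] := in_cell_run M_gt0 inj run hu.
rewrite -WE; apply: le_trans (failure_le n_gt1 beta_ge0 runu _ _) _.
  move=> k a b kn; rewrite WE => aW bW; exact: not_risky_gap nr hu run kn aW bW.
by rewrite /kappa !exprS expr0 mulr1 !mulrA.
Qed.
End upper_regime.

Lemma leq_card_rel (I J : finType) (S : {set I}) (Y : {set J}) (r : I -> J -> Prop) :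
  (forall i, i \in S -> exists2 j, j \in Y & r i j) ->
  (forall i i' j, i \in S -> i' \in S -> r i j -> r i' j -> i = i') ->
  (#|S| <= #|Y|)%N.
Proof.
move=> ex inj; have [->|[i0 i0S]] := set_0Vmem S; first by rewrite cards0.
have [j0 _ _] := ex _ i0S.
have H i : exists j, i \in S -> j \in Y /\ r i j.
  case: (boolP (i \in S)) => [/ex [j jY rj]|_]; first by exists j.
  by exists j0.
have [h hh] := choice H.
rewrite -(card_in_imset (f := h) (D := S)); last first.
  move=> i i' iS i'S E; have [_ r1] := hh i iS; have [_ r2] := hh i' i'S.
  by apply: (inj _ _ (h i)) => //; rewrite E.
apply: subset_leq_card; apply/fintype.subsetP => j /imsetP [i iS ->].
by have [] := hh i iS.
Qed.

(** * Expansion of the edges with low labels *)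

Section cross_edges.
Variable n : nat.
Implicit Types (Y D : {set 'I_n}) (e : edge n).

Definition cross Y D : {set edge n} :=
  [set e | [exists a in Y, exists b in D, edge_of a b == Some e]]%SET.

Lemma crossP Y D e : reflect (exists a b, [/\ a \in Y, b \in D & edge_of a b = Some e])
  (e \in cross Y D).
Proof.
rewrite inE; apply: (iffP existsP) => [[a /andP [aY /existsP [b /andP [bD /eqP h]]]]|[a [b [aY bD h]]]].
  by exists a, b.
by exists a; rewrite aY /=; apply/existsP; exists b; rewrite bD /= h.
Qed.

Lemma card_cross Y D : Y \subset (~: D)%SET -> #|cross Y D| = (#|Y| * #|D|)%N.
Proof.
move=> dis; have disj a : a \in Y -> a \notin D.
  by move=> /(fintype.subsetP dis); rewrite inE.
rewrite -cardsX -(card_imset (f := @Some (edge n))); last by move=> e e' [].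
rewrite -(card_in_imset (f := fun p : 'I_n * 'I_n => edge_of p.1 p.2)); last first.
  move=> [a b] [a' b'] /setXP /= [aY bD] /setXP /= [aY' bD'] h.
  have ab : a != b by by apply: contraTneq (disj a aY) => ->; rewrite bD.
  have [e he] := edge_of_ex ab.
  have [[-> ->] //|[aa _]] := edge_of_inj he (etrans (esym h) he).
  by move: (disj a aY); rewrite aa bD'.
congr #|pred_of_set _|; apply/setP => o; apply/imsetP/imsetP.
  move=> [e /crossP [a [b [aY bD h]]] ->]; exists (a, b) => //.
  by apply/setXP.
move=> [[a b] /setXP /= [aY bD] ->].
have ab : a != b by by apply: contraTneq (disj a aY) => ->; rewrite bD.
have [e he] := edge_of_ex ab; exists e => //; apply/crossP; by exists a, b.
Qed.

End cross_edges.

Section expander.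
Variables (R : realType) (n M : nat).
Hypothesis M_gt0 : (0 < M)%N.
Notation labeling := {ffun edge n -> 'I_M}.
Implicit Types (f : labeling) (Y D : {set 'I_n}).

Section level.
Variable p : nat.

Definition low_edges f Y D : {set edge n} := [set e in cross Y D | (f e < p)%N]%SET.

Definition large_disjoint (Z : {set 'I_n} * {set 'I_n}) : bool :=
  [&& Z.1 \subset (~: Z.2)%SET, (n <= 8 * #|Z.1|)%N & (n <= 8 * #|Z.2|)%N].

(** Connectivity would need one low edge between the two sets. More than [#|Z.1|] of them are
    required because the count of second exits compares with one edge per vertex. *)
Definition expander f : bool :=
  [forall Z, large_disjoint Z ==> (#|Z.1| < #|low_edges f Z.1 Z.2|)%N].

Lemma expanderP f Y D : expander f -> Y \subset (~: D)%SET -> (n <= 8 * #|Y|)%N ->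
  (n <= 8 * #|D|)%N -> (#|Y| < #|low_edges f Y D|)%N.
Proof.
by move=> /forallP /(_ (Y, D)); rewrite /large_disjoint /= => /implyP h ? ? ?; apply: h; apply/and3P.
Qed.

Lemma le1_expR (x : R) : 1 - x <= expR (- x).
Proof. exact: expR_ge1Dx. Qed.

(* Exponential moment: [1[c <= k] <= 2 ^ k * 2 ^ - c]. *)
Lemma freq_few_low_edges Y D : (p <= M)%N -> Y \subset (~: D)%SET ->
  freq R (fun f => (#|low_edges f Y D| <= #|Y|)%N) <=
    2 ^+ #|Y| * expR (- (p%:R / M%:R / 2)) ^+ (#|Y| * #|D|).
Proof.
move=> pM dis; have MR : 0 < M%:R :> R by rewrite ltr0n.
pose a (e : edge n) (j : 'I_M) : R := if (e \in cross Y D) && (j < p)%N then 2^-1 else 1.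
have E f : \prod_e a e (f e) = 2^-1 ^+ #|low_edges f Y D|.
  rewrite -prodr_const [RHS]big_mkcond; apply: eq_bigr => e _.
  by rewrite /a !inE.
have a0 f : 0 <= \prod_e a e (f e) by rewrite E exprn_ge0 ?invr_ge0.
apply: le_trans (markov_mean (F := fun f => \prod_e a e (f e)) (c := 2^-1 ^+ #|Y|) M_gt0 _ a0 _) _.
- by rewrite exprn_gt0 ?invr_gt0.
- move=> f h; rewrite E; by apply: ler_wiXn2l => //; lra.
rewrite mean_prod mulrC -exprVn invrK; apply: ler_wpM2l; first exact: exprn_ge0.
rewrite -card_cross // -prodr_const [leRHS]big_mkcond /=; apply: ler_prod => e _.
have S0 : 0 <= \sum_j a e j.
  by apply: sumr_ge0 => j _; rewrite /a; case: ifP => // _; rewrite invr_ge0.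
rewrite divr_ge0 //= /a; case: (e \in cross Y D) => /=; last first.
  by rewrite sumr_const card_ord divff ?gt_eqF.
have -> : \sum_(j < M) (if (j < p)%N then 2^-1 else 1 : R) = M%:R - p%:R / 2.
  have -> : M%:R - p%:R / 2 = \sum_(j < M) (1 : R) - \sum_(j < M | (j < p)%N) (2^-1 : R).
    rewrite !sumr_const card_ord; congr (_ - _); rewrite -[RHS]mulr_natl; congr (_%:R * _).
    by rewrite -[LHS](subn0 p) -(card_ord_itv 0 pM); apply: eq_card => j; rewrite !inE.
  rewrite [X in _ = _ - X]big_mkcond -sumrB; apply: eq_bigr => j _.
  by case: ifP => _; [field | rewrite subr0].
apply: le_trans (le1_expR _); rewrite mulrBl divff ?gt_eqF //.
by rewrite le_eqVlt; apply/orP; left; apply/eqP; field; exact: lt0r_neq0.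
Qed.

Lemma expR_2 : (2 : R) <= expR 1.
Proof. by apply: le_trans (expR_ge1Dx 1); rewrite -natr1 addrC. Qed.

(** Since q / K = 640 / m and c >= m ^ 2 / 64, the exponent is at least (320 / m) (m ^ 2 / 64) = 5
    m, and e >= 2 bounds exp (- 5) by 1 / 32. *)
Lemma expR_pow_le (m c q K : nat) : (0 < K)%N -> (m * m <= 64 * c)%N ->
  (q * m = 640 * K)%N -> expR (- (q%:R / K%:R / 2)) ^+ c <= 32^-1 ^+ m :> R.
Proof.
move=> K0 mc qm; have KR : 0 < K%:R :> R by rewrite ltr0n.
rewrite -expRM_natr; apply: (@le_trans _ _ (expR (- 5 * m%:R))).
  rewrite ler_expR.
  have h : (m * m)%:R <= (64 * c)%:R :> R by rewrite ler_nat.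
  have qm' : q%:R * m%:R = 640 * K%:R :> R by rewrite -!natrM qm.
  move: h; rewrite !natrM => h.
  have [m0|m0] := posnP m.
    by rewrite m0 mulr0 mulNr oppr_le0 !mulr_ge0 ?invr_ge0 ?(ltW KR).
  have mR : 0 < m%:R :> R by rewrite ltr0n.
  have -> : q%:R / K%:R = 640 / m%:R :> R.
    by rewrite -[q%:R](mulfK (lt0r_neq0 mR)) qm'; field; rewrite !lt0r_neq0.
  rewrite -(ler_pM2r mR).
  have -> : - (640 / m%:R / 2) * c%:R * m%:R = - (320 * c%:R) :> R.
    by field; exact: lt0r_neq0.
  by rewrite -mulrA; lra.
rewrite expRM_natr; apply: lerXn2r; rewrite ?nnegrE ?expR_ge0 ?invr_ge0 //.
rewrite expRN lef_pV2 ?posrE ?expR_gt0 //.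
have -> : (5 : R) = 1 * 5%:R by rewrite mul1r.
rewrite expRM_natr; apply: le_trans (lerXn2r 5 _ _ expR_2); rewrite ?nnegrE ?expR_ge0 //.
by rewrite -natrX ler_nat.
Qed.

(* [640 = 5 * 128] makes the entropy [8 ^ n] negligible against
   [exp (- 640 / 128) <= 1 / 32]. *)
Lemma freq_not_expander : (p <= M)%N -> (p * n = 640 * M)%N ->
  freq R (fun f => ~~ expander f) <= 4^-1 ^+ n.
Proof.
move=> pM pn; have MR : 0 < M%:R :> R by rewrite ltr0n.
apply: (@le_trans _ _ (freq R (fun f => [exists Z, large_disjoint Z &&
     (#|low_edges f Z.1 Z.2| <= #|Z.1|)%N]))).
  apply: freq_sub => // f; rewrite negb_forall => /existsP [Z].
  by rewrite negb_imply -leqNgt => h; apply/existsP; exists Z.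
apply: le_trans (freq_exists R M_gt0
  (fun Z f => (#|low_edges f Z.1 Z.2| <= #|Z.1|)%N) large_disjoint) _.
(* Each pair costs at most 2 ^ n / 32 ^ n = 16 ^ - n, and there are 4 ^ n pairs. *)
apply: (@le_trans _ _ (\sum_(Z : {set 'I_n} * {set 'I_n}) 16^-1 ^+ n)).
  rewrite big_mkcond; apply: ler_sum => -[Y D] _; case: ifP => //= /and3P [/= dis hY hD].
  apply: le_trans (freq_few_low_edges pM dis) _.
  apply: (@le_trans _ _ (2 ^+ n * 32^-1 ^+ n)); last first.
    by rewrite -exprMn; apply: lerXn2r; rewrite ?nnegrE; lra.
  apply: ler_pM; rewrite ?exprn_ge0 ?expR_ge0 //.
    apply: ler_weXn2l; first by rewrite ler1n.
    by rewrite -[X in (_ <= X)%N](card_ord n) max_card.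
  apply: (expR_pow_le M_gt0 _ pn).
  by rewrite -[64%N]/(8 * 8)%N mulnACA leq_mul.
have cset : #|{: {set 'I_n}}| = (2 ^ n)%N.
  by rewrite -cardsT -powersetT card_powerset cardsT card_ord.
rewrite sumr_const card_prod cset -[leLHS]mulr_natl natrM natrX -!exprMn.
by rewrite le_eqVlt; apply/orP; left; apply/eqP; congr (_ ^+ _); field.
Qed.
End level.
End expander.

(** * Second exits through edges with low labels *)

Section low_labels.
Variables (R : realType) (n M : nat).
Hypothesis M_gt0 : (0 < M)%N.
Variable f : {ffun edge n -> 'I_M}.
Implicit Types (a b : 'I_n) (e : edge n).

Definition low p a b : bool := if edge_of a b is Some e then (f e < p)%N else false.

Lemma lowC p a b : low p a b = low p b a.
Proof. by rewrite /low edge_ofC. Qed.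

Lemma low_label (u : edge n -> R) p a b : in_cell f u -> low p a b ->
  label u a b <= p%:R / M%:R.
Proof.
rewrite /low /label => hu; case: edge_of => // e fe.
have /andP [_ h] := hu e; apply: le_trans (ltW h) _.
by rewrite ler_pM2r ?invr_gt0 ?ltr0n // ler_nat.
Qed.

Lemma low_edges_ex p Y D : (0 < #|low_edges p f Y D|)%N ->
  exists a b, [/\ a \in Y, b \in D & low p a b].
Proof.
move=> /card_gt0P [e]; rewrite inE => /andP [/crossP [a [b [aY bD h]]] fe].
by exists a, b; split=> //; rewrite /low h.
Qed.

Variables (s : 'I_n) (y v : nat -> 'I_n).
Hypothesis n_gt1 : (1 < n)%N.
Hypothesis run : prim_run (digits R f) s y v.
Notation W := (prim_vertices (digits R f) s).

Lemma run_low p k a b : (k < n.-1)%N -> a \in W k -> b \notin W k -> low p a b ->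
  low p (y k) (v k).
Proof.
move=> kn aW bW ab; have [yW vW _ _ /(_ a b aW bW)] := run kn.
have yv : y k != v k by apply: contraNneq vW => <-.
have [e he] := edge_of_ex yv; move: ab; rewrite /low /label he.
case: edge_of => // e' fe'; rewrite /digits ler_nat => h.
exact: leq_ltn_trans h fe'.
Qed.

Variable p : nat.
Hypothesis f_exp : expander p f.

(** The two bounds on [k] keep [W k] and the complement of [W n./2] above size n / 8, so that
    expansion applies to them. *)
Definition second_exit k : bool :=
  [&& (k < n./2)%N, (n <= 8 * k.+1)%N &
      [exists w, [&& w \notin W k, w != v k & low p (y k) w]]].

(* A vertex can be the inner endpoint of a step without a second low exit only
   once, and then has no other low edge to the final complement; so by expansion
   there are few such steps. *)
Lemma count_second_exit : (16 <= n)%N ->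
  (n <= 8 * \sum_(0 <= k < n.-1) second_exit k)%N.
Proof.
move=> n16; set h := n./2.
have n2 : (n = odd n + h.*2)%N by rewrite odd_double_half.
have hn : (h < n.-1)%N by rewrite -mul2n in n2; case: (odd n) n2 => /=; lia.
pose bad := [set k : 'I_h | (n <= 8 * k.+1)%N && ~~ second_exit k]%SET.
pose Y := [set y k | k : 'I_h in bad]%SET.
pose D := (~: W h)%SET.
have cW k : (k <= n.-1)%N -> #|W k| = k.+1 by apply: card_prim_vertices.
have cD : #|D| = (n - h.+1)%N.
  by have := cardsC (W h); rewrite cW ?(ltnW hn) // card_ord -/D; lia.
have D8 : (n <= 8 * #|D|)%N by rewrite cD; rewrite -mul2n in n2; case: (odd n) n2 => /=; lia.
have sub k : (k <= h)%N -> W k \subset W h.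
  by move=> kh; apply: prim_vertices_mono run _ _ kh (ltnW hn).
have dis k : (k <= h)%N -> W k \subset (~: D)%SET by rewrite /D finset.setCK; exact: sub.
have ylow k : (k < h)%N -> (n <= 8 * k.+1)%N -> low p (y k) (v k).
  move=> kh k8; have kn : (k < n.-1)%N by lia.
  have := expanderP f_exp (dis k (ltnW kh)); rewrite cW ?(ltnW kn) // => /(_ k8 D8).
  move=> /(leq_trans _) - /(_ 1%N isT) /low_edges_ex [a [b [aW bD ab]]].
  apply: run_low ab => //; move: bD; rewrite inE; apply: contra.
  exact: (fintype.subsetP (sub k (ltnW kh))).
have second k w : k \in bad -> w \notin W k -> low p (y k) w -> w = v k.
  rewrite inE => /andP [k8 ns] wW kw; apply/eqP; apply: contraNT ns => wv.
  rewrite /second_exit ltn_ord k8 /=; apply/existsP; exists w.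
  by rewrite wW wv.
(* If two bad steps shared their inner endpoint, the outer vertex of the later one would be a second
   low exit at the earlier one. *)
have yinj : {in bad &, injective (fun k : 'I_h => y k)}.
  have H (k k' : 'I_h) : k \in bad -> k' \in bad -> (k < k')%N -> y k <> y k'.
    move=> kb kb' kk E; have kn : (k < n.-1)%N by have := ltn_ord k; lia.
    have k'n : (k' < n.-1)%N by have := ltn_ord k'; lia.
    have [_ _ _ WS _] := run kn; have [_ vW' _ _ _] := run k'n.
    have sub' : W k.+1 \subset W k' by apply: prim_vertices_mono run _ _ kk (ltnW k'n).
    have vW : v k' \notin W k.+1.
      by apply: contra vW'; exact: (fintype.subsetP sub').
    move: vW; rewrite WS !inE negb_or => /andP [/eqP vv vW]; apply: vv.
    apply: second kb vW _; rewrite E; apply: ylow => //.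
    by move: kb'; rewrite inE => /andP [].
  move=> k k' kb kb' E; apply: val_inj; case: (ltngtP k k') => // kk.
    by case: (H k k').
  by case: (H k' k).
have cY : #|Y| = #|bad| by apply: card_in_imset.
(* A low edge from [Y] to [D] must be the Prim edge of the step that brought its endpoint into [Y],
   so there is at most one per vertex of [Y]. Expansion then forces [Y] to be small. *)
have few : (#|low_edges p f Y D| <= #|Y|)%N.
  pose r (e : edge n) (a : 'I_n) := a \in Y /\ exists2 b, b \in D & edge_of a b = Some e.
  apply: (leq_card_rel (r := r)).
    move=> e; rewrite inE => /andP [/crossP [a [b [aY bD he]]] _].
    by exists a => //; split=> //; exists b.
  move=> e e' a; rewrite !inE => /andP [_ fe] /andP [_ fe'].
  move=> [/imsetP [k kb ->] [b bD he]] [_ [b' bD' he']].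
  have out z : z \in D -> z \notin W k.
    by rewrite inE; apply: contra; apply: (fintype.subsetP (sub k (ltnW (ltn_ord k)))).
  have e1 : b = v k by apply: second kb (out _ bD) _; rewrite /low he.
  have e2 : b' = v k by apply: second kb (out _ bD') _; rewrite /low he'.
  by apply: Some_inj; rewrite -he -he' e1 e2.
have Y8 : (8 * #|Y| < n)%N.
  rewrite ltnNge; apply/negP => Y8.
  have YD : Y \subset (~: D)%SET.
    apply/fintype.subsetP => a /imsetP [k _ ->]; rewrite finset.setCK.
    apply: (fintype.subsetP (sub k (ltnW (ltn_ord k)))).
    by have [] := run (k := k); first by have := ltn_ord k; lia.
  by have := expanderP f_exp YD Y8 D8; rewrite ltnNge few.
have split_h : (\sum_(k < h) (n <= 8 * k.+1) <= #|bad| + \sum_(0 <= k < n.-1) second_exit k)%N.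
  rewrite (big_cat_nat (n := h)) //= ?(ltnW hn) // addnA; apply: leq_trans (leq_addr _ _).
  rewrite big_mkord -sum1_card [X in (_ <= X + _)%N]big_mkcond -big_split /=.
  apply: leq_sum => k _; rewrite inE; case: (n <= _)%N => //=.
  by case: (second_exit k).
have late : (h - (n %/ 8).+1 <= \sum_(k < h) (n <= 8 * k.+1))%N.
  have hh : (n %/ 8 <= h)%N by rewrite -mul2n in n2; case: (odd n) n2 => /=; lia.
  rewrite -(big_mkord predT (fun k => nat_of_bool (n <= 8 * k.+1)%N)).
  rewrite (big_cat_nat (n := (n %/ 8)%N)) //=; apply: leq_trans (leq_addl _ _).
  rewrite (eq_big_nat _ _ (F2 := fun=> 1%N)); first by rewrite sum_nat_const_nat muln1; lia.
  by move=> k kk; rewrite (_ : (n <= _)%N = true) //; apply/idP; lia.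
rewrite cY in Y8; move: split_h late; rewrite -mul2n in n2.
set S1 := (\sum_(k < h) _)%N; set S2 := (\sum_(0 <= k < n.-1) _)%N.
move: Y8 (leq_trunc_div n 8) (leq_b1 (odd n)) n2.
have arith (B x z q h' o : nat) : (8 * B < n -> q * 8 <= n -> o <= 1 -> n = o + 2 * h' ->
    x <= B + z -> h' - q.+1 <= x -> n <= 8 * z)%N by lia.
exact: arith.
Qed.

(** With both conductances at most 1 and the second one at least [q], the share of the second exit
    is at least [q / 2]. *)
Lemma second_exit_bound beta (u : edge n -> R) k t a : 0 <= beta -> injective f ->
  in_cell f u -> (k < n.-1)%N -> second_exit k -> a \in W k ->
  exit_prob beta u (W k) (right_exit (y k) (v k)) t a <=
    1 - expR (- (beta * (p%:R / M%:R))) / 2.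
Proof.
move=> b0 inj hu kn /and3P [_ _ /existsP [w /and3P [wW wv lw]]] aW.
have [yW vW _ _ _] := run kn.
have yv : y k != v k by apply: contraNneq vW => <-.
have yw : y k != w by apply: contraNneq wW => <-.
apply: le_trans (@right_exit_le_shared R n beta u n_gt1 (W k) (y k) (v k) yW vW t a w aW wW wv) _.
set c := conductance beta u _ _; set c' := conductance beta u _ w; set q := expR _.
have c0 : 0 < c by exact: conductance_gt0.
have q0 : 0 < q by exact: expR_gt0.
have [_ /(_ _) c1] : True /\ (forall a b, a != b -> conductance beta u a b <= 1).
  split=> // a' b' ab; rewrite conductance_label // -expR0 ler_expR oppr_le0 mulr_ge0 //.
  rewrite /label; case: edge_of => // e.
  by have /andP [] := in_cell01 M_gt0 hu e.
have c'q : q <= c'.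
  rewrite /c' conductance_label // ler_expR lerN2 ler_wpM2l //.
  exact: low_label hu lw.
have cc := c1 _ _ yv; have cc' := c1 _ _ yw; rewrite -/c -/c' in cc cc'.
rewrite ler_pdivrMr; last by lra.
nra.
Qed.
End low_labels.

(** * The lower regime for small beta *)

Section small_beta.
Context d (T : measurableType d) (R : realType) (P : probability T R).
Variables (n : nat) (beta : R) (s : 'I_n).
Variables (U : edge n -> {RV P >-> R}) (X : nat -> T -> 'I_n).
Hypothesis beta_ge0 : 0 <= beta.
Hypothesis iidU : iid_uniform01 U.
Hypothesis walkX : walk_given_labels beta s U X.
Notation same := (same_run s (fun e => U e : T -> R) X).

Lemma prob_same_run_small_beta M p : (16 <= n)%N -> (0 < M)%N -> (p <= M)%N ->
  (p * n = 640 * M)%N ->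
  (P same <= (expR (- (n%:R * expR (- (beta * (640 / n%:R))) / 16)) +
     ((n ^ 4)%:R / M%:R + 4^-1 ^+ n))%:E)%E.
Proof.
move=> n16 M_gt0 pM pn; set kappa := expR (- (_ / 16)).
have n_gt1 : (1 < n)%N by lia.
have nR : 0 < n%:R :> R by rewrite ltr0n; lia.
have MR : 0 < M%:R :> R by rewrite ltr0n.
have k0 : 0 <= kappa by exact: expR_ge0.
have mS : measurable same by exact: measurable_same walkX.
apply: le_trans (prob_le_cells iidU M_gt0
  (bad := fun f => ~~ injectiveb f || ~~ expander p f) mS k0 _) _; last first.
  rewrite lee_fin lerD2l -freqE; apply: le_trans (freqU _ M_gt0 _ _) _; apply: lerD.
    apply: le_trans (freq_not_injective _ _ M_gt0) _.
    rewrite ler_pM2r ?invr_gt0 // ler_nat.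
    by rewrite (expnM n 2 2) leq_exp2r // card_edge_le.
  exact: freq_not_expander.
move=> f; rewrite negb_or !negbK => /andP [/injectiveP inj fexp].
have [y [v run]] := prim_run_ex (digits R f) s n_gt1.
apply: (cell_same_run n_gt1 beta_ge0 walkX M_gt0 inj run k0) => u t hu.
have [runu WE] := in_cell_run M_gt0 inj run hu.
have pE : p%:R / M%:R = 640 / n%:R :> R.
  have pn' : p%:R * n%:R = 640 * M%:R :> R by rewrite -!natrM pn.
  by rewrite -[p%:R](mulfK (lt0r_neq0 nR)) pn'; field; rewrite !lt0r_neq0.
set x := expR (- (beta * (640 / n%:R))).
have x0 : 0 < x by exact: expR_gt0.
have x1 : x <= 1.
  rewrite /x -pE expR_le1 oppr_le0; apply: mulr_ge0; first exact: beta_ge0.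
  exact: divr_ge0.
rewrite -WE; apply: le_trans (success_le (good := second_exit R f s y v p)
  (q := 1 - x / 2) n_gt1 beta_ge0 runu _ _ _ _) _.
- lra.
- lra.
- move=> k t' a kn gk; rewrite WE => aW; rewrite /x -pE.
  exact: (second_exit_bound M_gt0 n_gt1 run).
have cnt := count_second_exit M_gt0 n_gt1 run fexp n16.
apply: (@le_trans _ _ (expR (- (x / 2)) ^+ (\sum_(0 <= k < n.-1) second_exit R f s y v p k)%N)).
  by apply: lerXn2r; rewrite ?nnegrE ?expR_ge0; [lra| |exact: le1_expR].
rewrite -expRM_natr ler_expR.
have : n%:R <= 8 * (\sum_(0 <= k < n.-1) second_exit R f s y v p k)%N%:R :> R.
  by rewrite -natrM ler_nat.
set S := (\sum_(0 <= _ < _) _)%N%:R; rewrite -/x => h.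
by have := ler_wpM2r (ltW x0) h; lra.
Qed.
End small_beta.

(** * The lower regime for large beta *)

Section low_connected.
Variables (n M : nat) (f : {ffun edge n -> 'I_M}).
Implicit Types (S A C : {set 'I_n}) (a b : 'I_n).

(** Connectivity stated through cuts: it follows directly from minimality in [giantP], and it
    supplies an edge leaving any proper part of [C]. *)
Definition low_connected p C : Prop := forall S, S \subset C -> S != finset.set0 -> S != C ->
  exists a b, [/\ a \in S, b \in C, b \notin S & low f p a b].

Lemma low_connected_dist (R : realType) p C (phi : 'I_n -> R) theta : 0 <= theta ->
  low_connected p C ->
  (forall a b, a \in C -> b \in C -> low f p a b -> `|phi a - phi b| <= theta) ->
  forall a b, a \in C -> b \in C -> `|phi a - phi b| <= n%:R * theta.
Proof.
move=> th0 conn H a b aC bC.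
(* Grow a set from [a], one vertex at a time; each new vertex adds at most [theta] to the distance
   from [phi a]. *)
have grow m : exists S, [/\ S \subset C, a \in S, (m < #|S|)%N \/ S = C &
    forall c, c \in S -> `|phi a - phi c| <= m%:R * theta].
  elim: m => [|m [S [SC aS szS dS]]].
    exists [set a]%SET; split; rewrite ?inE //.
    - by apply/fintype.subsetP => x; rewrite inE => /eqP ->.
    - by left; rewrite cards1.
    - by move=> c; rewrite inE => /eqP ->; rewrite subrr normr0 mul0r.
  have dS' c : c \in S -> `|phi a - phi c| <= m.+1%:R * theta.
    by move=> cS; apply: le_trans (dS c cS) _; rewrite ler_wpM2r // ler_nat.
  have [SeC|SnC] := eqVneq S C; first by exists S; split=> //; right.
  have S0 : S != finset.set0 by apply/set0Pn; exists a.
  have [x [z [xS zC zS xz]]] := conn S SC S0 SnC.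
  exists (z |: S)%SET; split.
  - by rewrite finset.subUset SC andbT; apply/fintype.subsetP => x'; rewrite inE => /eqP ->.
  - by rewrite !inE aS orbT.
  - by left; case: szS => [h|h]; [rewrite cardsU1 zS | move: SnC; rewrite h eqxx].
  - move=> c; rewrite !inE => /orP [/eqP ->|]; last exact: dS'.
    have h1 := dS x xS; have h2 := H x z (fintype.subsetP SC x xS) zC xz.
    rewrite -[phi a](subrK (phi x)) -addrA; apply: le_trans (ler_normD _ _) _.
    by rewrite -natr1; lra.
have [S [SC aS szS dS]] := grow n; apply: dS; case: szS => [h|-> //].
by have := max_card (mem S); rewrite card_ord leqNgt h.
Qed.

Definition low_closed p A S : bool :=
  (S \subset A) && [forall a in S, forall b in A :\: S, ~~ low f p a b].

(** Taken minimal among the unions of low components of [A] with at least n / 8 vertices, rather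
    than as the component of some vertex: minimality gives connectivity, and the set depends only on
    the labels inside [A]. *)
Definition giant p A : {set 'I_n} :=
  [arg min_(S < A | low_closed p A S && (n <= 8 * #|S|)) #|S|]%N.

Hypothesis n_gt0 : (0 < n)%N.

(** If [C] split into two closed parts, each would have fewer than n / 8 vertices by minimality, and
    so would [A :\: C] by expansion; but [A] has at least n / 2. *)
Lemma giantP p A : (n <= 2 * #|A|)%N -> expander p f ->
  [/\ giant p A \subset A, (n <= 8 * #|giant p A|)%N & low_connected p (giant p A)].
Proof.
move=> A2 fexp; have P0 : low_closed p A A && (n <= 8 * #|A|)%N.
  rewrite /low_closed fintype.subxx finset.setDv /=; apply/andP; split; last first.
    by apply: leq_trans A2 _; rewrite leq_mul2r orbT.
  by apply/forallP => a; apply/implyP => _; apply/forallP => b; rewrite inE.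
rewrite /giant; case: (@arg_minnP _ A (fun S => low_closed p A S && (n <= 8 * #|S|)%N) (fun S : {set 'I_n} => #|S|) P0) => C /andP [clC C8] minC.
have /andP [CA /forallP ncl] := clC.
have out a b : a \in C -> b \in A -> b \notin C -> ~~ low f p a b.
  move=> aC bA bC; have := ncl a; rewrite aC /= => /forallP /(_ b).
  by rewrite inE bA bC.
split=> // S SC S0 SnC; apply: contrapT => none.
have far a b : a \in S -> b \in C -> b \notin S -> ~~ low f p a b.
  by move=> aS bC bS; apply/negP => ab; apply: none; exists a, b.
have clS : low_closed p A S.
  rewrite /low_closed (fintype.subset_trans SC CA) /=.
  apply/forallP => a; apply/implyP => aS; apply/forallP => b; apply/implyP.
  rewrite inE => /andP [bS bA]; have [bC|bC] := boolP (b \in C); first exact: far.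
  by apply: out => //; exact: (fintype.subsetP SC).
have clS' : low_closed p A (C :\: S).
  rewrite /low_closed (fintype.subset_trans (finset.subsetDl _ _) CA) /=.
  apply/forallP => a; apply/implyP; rewrite inE => /andP [aS aC].
  apply/forallP => b; apply/implyP; rewrite !inE negb_and negbK => /andP [/orP [bS|bC] bA].
    by rewrite lowC; apply: far.
  exact: out.
have cC := cardsID S C; rewrite (finset.setIidPr SC) in cC.
have S_gt0 : (0 < #|S|)%N by rewrite card_gt0.
have CS_gt0 : (0 < #|C :\: S|)%N.
  rewrite card_gt0; apply: contra SnC => /eqP h; rewrite finset.eqEsubset SC /=.
  by rewrite -finset.setD_eq0 h.
have smallS : (8 * #|S| < n)%N.
  rewrite ltnNge; apply/negP => h; have := minC S; rewrite clS h => /(_ isT).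
  by rewrite leqNgt -cC -[X in (X < _)%N]addn0 ltn_add2l CS_gt0.
have smallS' : (8 * #|C :\: S| < n)%N.
  rewrite ltnNge; apply/negP => h; have := minC (C :\: S)%SET; rewrite clS' h => /(_ isT).
  by rewrite leqNgt -cC -[X in (X < _)%N]add0n ltn_add2r S_gt0.
have smallA : (8 * #|A :\: C| < n)%N.
  rewrite ltnNge; apply/negP => h.
  have dis : C \subset (~: (A :\: C))%SET.
    by apply/fintype.subsetP => a aC; rewrite !inE aC.
  have := expanderP fexp dis C8 h; move/(leq_trans _) => /(_ 1%N isT).
  move=> /low_edges_ex [a [b [aC]]]; rewrite inE => /andP [bC bA].
  exact/negP/out.
have := cardsID C A; rewrite (finset.setIidPr CA) -cC => cA.
have arith (x1 x2 x3 a : nat) : (x1 + x2 + x3 = a -> n <= 2 * a -> 8 * x1 < n ->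
  8 * x2 < n -> 8 * x3 < n -> False)%N by lia.
exact: arith cA A2 smallS smallS' smallA.
Qed.

End low_connected.

(** * Pairs of competing exits from a connected core *)

Section close_steps.
Variables (R : realType) (n M : nat).
Hypothesis n_gt1 : (1 < n)%N.
Hypothesis M_gt0 : (0 < M)%N.
Variable f : {ffun edge n -> 'I_M}.
Variables (s : 'I_n) (y v : nat -> 'I_n).
Hypothesis run : prim_run (digits R f) s y v.
Notation W := (prim_vertices (digits R f) s).
Implicit Types (a b z : 'I_n).

Definition digit a b : nat := if edge_of a b is Some e then nat_of_ord (f e) else 0%N.

Lemma lowE p a b : a != b -> low f p a b = (digit a b < p)%N.
Proof. by rewrite /low /digit => /edge_of_ex [e ->]. Qed.

Lemma digitC a b : digit a b = digit b a.
Proof. by rewrite /digit edge_ofC. Qed.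

Lemma run_added z : z != s -> exists2 k, (k < n.-1)%N & v k = z.
Proof.
move=> zs; have H k : (k <= n.-1)%N -> z \in W k -> exists2 j, (j < k)%N & v j = z.
  elim: k => [|k IH] kn; first by rewrite inE (negbTE zs).
  have [_ _ _ -> _] := run kn; rewrite !inE => /orP [/eqP ->|/IH]; first by exists k.
  by case=> [|j jk e]; [exact: ltnW | exists j => //; exact: ltnW].
apply: (H n.-1) => //; have : W n.-1 == finset.setT.
  by rewrite eqEcard finset.subsetT cardsT card_ord card_prim_vertices //; lia.
by move=> /eqP ->; rewrite inE.
Qed.

(** [p0] is the level at which the core [C] is connected; the windows start at [q0], well above [p0]
    in the application, and end below [p1], the level at which the edges of the vertices in [B]
    count as low. *)
Variables (B C : {set 'I_n}) (p0 q0 width p1 cells : nat).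
Hypothesis sB : s \notin B.
Hypothesis CB : C \subset (~: (s |: B))%SET.
Hypothesis C_conn : low_connected f p0 C.
Hypothesis p0q0 : (p0 <= q0)%N.
Hypothesis q0p1 : (q0 + cells * width <= p1)%N.
Hypothesis width_gt0 : (0 < width)%N.

Definition low_isolated z : bool := [forall z' in B, ~~ low f p1 z z'].

(* The only low edge of [z] leaving [B] goes to [C], and its label belongs to the
   [c]-th window of the given width above [q0]. *)
Definition spot z c : bool :=
  [exists a in C, [&& (q0 + c * width <= digit z a)%N, (digit z a < q0 + c.+1 * width)%N &
    [forall b in (~: B)%SET, (b != a) ==> ~~ low f p1 z b]]].

Hypothesis s_conn : exists2 a, a \in C & low f p1 s a.

Lemma C_notin_B a : a \in C -> a \notin B.
Proof. by move=> /(fintype.subsetP CB); rewrite !inE negb_or => /andP []. Qed.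

Lemma spot_window z c : z \in B -> spot z c -> (c < cells)%N ->
  exists2 a, a \in C & [/\ (q0 + c * width <= digit z a)%N,
    (digit z a < q0 + c.+1 * width)%N, low f p1 z a &
    forall b, b \notin B -> low f p1 z b -> b = a].
Proof.
move=> zB /existsP [a /andP [aC /and3P [h1 h2 /forallP h3]]] cc.
have za : z != a by apply: contraTneq zB => ->; exact: C_notin_B.
exists a => //; split=> //.
  rewrite lowE //; apply: leq_trans h2 _; apply: leq_trans q0p1.
  by rewrite leq_add2l leq_mul2r cc orbT.
move=> b bB zb; apply/eqP; apply: contraTT zb => ba.
by have := h3 b; rewrite inE bB ba.
Qed.

Lemma spot_inj z c c' : z \in B -> (c < cells)%N -> (c' < cells)%N ->
  spot z c -> spot z c' -> c = c'.
Proof.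
move=> zB cc cc' /(spot_window zB) /(_ cc) [a aC [h1 h2 h3 h4]].
move=> /(spot_window zB) /(_ cc') [a' aC' [h1' h2' h3' h4']].
have E : a = a' by apply: h4' => //; exact: C_notin_B.
rewrite -E in h1' h2'.
have l1 : (c * width < c'.+1 * width)%N.
  by rewrite -(ltn_add2l q0); exact: leq_ltn_trans h1 h2'.
have l2 : (c' * width < c.+1 * width)%N.
  by rewrite -(ltn_add2l q0); exact: leq_ltn_trans h1' h2.
move: l1 l2; rewrite !ltn_pmul2r // !ltnS => l1 l2.
by apply/eqP; rewrite eqn_leq l1 l2.
Qed.

(** While [z] is missing, some edge below [p1] leaves the current set, so [z] itself is added
    through such an edge, and the only candidate comes from [C]. Its label is at least [q0 >= p0],
    so every core edge is preferred to it and [C] is complete by then. *)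
Lemma spot_added z c : z \in B -> low_isolated z -> (c < cells)%N -> spot z c ->
  exists k, [/\ (k < n.-1)%N, v k = z, y k \in C, C \subset W k &
    (q0 + c * width <= digit (y k) (v k) < q0 + c.+1 * width)%N].
Proof.
move=> zB iz cc sz; have [a aC [h1 h2 h3 h4]] := spot_window zB sz cc.
have zs : z != s by apply: contraNneq sB => <-.
have [k kn vk] := run_added zs; have [yW vW _ WS _] := run kn.
have p01 : (p0 <= p1)%N by apply: leq_trans (leq_trans p0q0 _) q0p1; exact: leq_addr.
have low01 x x' : low f p0 x x' -> low f p1 x x'.
  by rewrite /low; case: edge_of => // e h; exact: leq_trans h p01.
have cutC : ~~ (C \subset W k) -> (exists2 x, x \in C & x \in W k) ->
    exists x x', [/\ x \in W k, x' \notin W k & low f p0 x x'].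
  move=> CW [x xC xW]; have [|||x1 [x2 [h5 h6 h7 h8]]] := C_conn (S := C :&: W k).
  - exact: finset.subsetIl.
  - by apply/set0Pn; exists x; rewrite inE xC.
  - by apply: contra CW => /eqP {1}<-; exact: finset.subsetIr.
  exists x1, x2; move: h5 h7; rewrite !inE h6 => /andP [_ ->] /=.
  by split.
(* Three sources of a low exit: the edge from [a] to [z] if [a] is present, a core edge if only a
   part of [C] is, and the link from [s] if [C] is untouched. *)
have yv1 : low f p1 (y k) (v k).
  have [aW|aW] := boolP (a \in W k).
    by apply: (run_low (R := R) run kn aW vW); rewrite vk lowC.
  have [/existsP [x /andP [xC xW]]|none] := boolP [exists x, (x \in C) && (x \in W k)].
    have [|x1 [x2 [g1 g2 g3]]] := cutC _ (ex_intro2 _ _ x xC xW).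
      by apply: contra aW => /fintype.subsetP; apply.
    by apply: (run_low (R := R) run kn g1 g2); exact: low01.
  have [x xC sx] := s_conn; apply: (run_low (R := R) run kn _ _ sx).
    have s0 : s \in W 0 by rewrite inE.
    have sub : W 0 \subset W k by apply: prim_vertices_mono run _ _ _ (ltnW kn).
    exact: (fintype.subsetP sub).
  by move: none; rewrite negb_exists => /forallP /(_ x); rewrite xC.
have yB : y k \notin B.
  apply/negP => yB; move/forallP: iz => /(_ (y k)); rewrite yB /= lowC -vk yv1.
  by [].
have ya : y k = a by apply: h4 => //; rewrite lowC -vk.
exists k; rewrite ya vk digitC h1 h2; split=> //.
apply: contrapT => /negP CW.
have aW : a \in W k by rewrite -ya.
have [x1 [x2 [g1 g2 g3]]] := cutC CW (ex_intro2 _ _ a aC aW).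
have := run_low (R := R) run kn g1 g2 g3; rewrite ya vk lowE; last first.
  by apply: contraTneq zB => <-; exact: C_notin_B.
rewrite digitC ltnNge => /negP; apply.
exact: leq_trans p0q0 (leq_trans (leq_addr _ _) h1).
Qed.

(** The bound [q0] makes the exit much less conducting than the core edges, which flattens the
    potential on [C]. *)
Definition close_step k : bool :=
  [&& C \subset W k, y k \in C, (q0 <= digit (y k) (v k))%N &
   [exists yw : 'I_n * 'I_n, [&& yw.1 \in C, yw.2 \notin W k, yw != (y k, v k) &
      (digit yw.1 yw.2 < digit (y k) (v k) + width)%N]]].

(** At the earlier of the two additions the edge of the other vertex is already an exit from [C],
    with a label in the same window. *)
Lemma spot_pair_close z z' c : z \in B -> z' \in B -> z != z' -> low_isolated z -> low_isolated z' ->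
  (c < cells)%N -> spot z c -> spot z' c ->
  exists k, [/\ (k < n.-1)%N, close_step k, v k \in B & spot (v k) c].
Proof.
move=> zB zB' zz iz iz' cc sz sz'.
have [k [kn vk yC CW /andP [d1 d2]]] := spot_added zB iz cc sz.
have [k' [kn' vk' yC' CW' /andP [d1' d2']]] := spot_added zB' iz' cc sz'.
have key j j' : (j < j')%N -> (j' < n.-1)%N -> v j != v j' -> y j \in C -> y j' \in C ->
    C \subset W j -> (q0 + c * width <= digit (y j) (v j))%N ->
    (digit (y j') (v j') < q0 + c.+1 * width)%N -> close_step j.
  move=> jj jn' vv yCj yCj' CWj l1 l2; apply/and4P; split=> //; first exact: leq_trans (leq_addr _ _) l1.
  apply/existsP; exists (y j', v j') => /=; apply/and4P; split=> //.
  - have [_ vW' _ _ _] := run jn'; apply: contra vW'.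
    have sub : W j \subset W j' by apply: prim_vertices_mono run _ _ (ltnW jj) (ltnW jn').
    exact: (fintype.subsetP sub).
  - by rewrite xpair_eqE negb_and [v j' == _]eq_sym vv orbT.
  - move: l1 l2; rewrite mulSn /=; move: (c * width)%N (digit (y j') _) (digit (y j) _); clear; lia.
case: (ltngtP k k') => kk.
- exists k; split=> //; rewrite ?vk //.
  by apply: key kk kn' _ yC yC' CW d1 d2'; rewrite vk vk'.
- exists k'; split=> //; rewrite ?vk' //.
  by apply: key kk kn _ yC' yC CW' d1' d2; rewrite vk vk' eq_sym.
- by move: zz; rewrite -vk -vk' kk eqxx.
Qed.

(** Along a core edge the square of the potential difference is at most the conductance ratio exp (-
    beta (q0 - p0) / M), so over the core the potential varies by at most 1 / 10; then
    [right_exit_le_close] applies. *)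
Lemma close_step_bound beta (u : edge n -> R) k t a : 0 <= beta -> injective f ->
  in_cell f u ->
  beta * (width%:R / M%:R) <= 2^-1 ->
  n%:R * expR (- (beta * ((q0 - p0)%:R / M%:R) / 2)) <= 10%:R^-1 ->
  (k < n.-1)%N -> close_step k -> a \in W k ->
  exit_prob beta u (W k) (right_exit (y k) (v k)) t a <= 9 / 10.
Proof.
move=> b0 inj hu bw bq kn /and4P [CW yC q0d /existsP [[y' w] /= /and4P [yC' wW ne dd]]] aW.
have MR : 0 < M%:R :> R by rewrite ltr0n.
have [yW vW _ _ _] := run kn.
have yW' : y' \in W k by exact: (fintype.subsetP CW).
have yv : y k != v k by apply: contraNneq vW => <-.
have yw : y' != w by apply: contraNneq wW => <-.
have cell_digit x x' : x != x' ->
    (digit x x')%:R / M%:R <= label u x x' < (digit x x').+1%:R / M%:R.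
  by move=> /edge_of_ex [e he]; rewrite /label /digit he; exact: hu.
have /andP [l1 l2] := cell_digit _ _ yv; have /andP [l1' l2'] := cell_digit _ _ yw.
rewrite eq_sym in ne.
apply: (@right_exit_le_close R n beta u n_gt1 (W k) (y k) (v k) yW vW t a y' w) => //.
  apply: le_trans bq; apply: (low_connected_dist _ C_conn) => //.
  move=> x x' xC xC' xx.
  have xW := fintype.subsetP CW x xC; have xW' := fintype.subsetP CW x' xC'.
  have := @right_exit_edge R n beta u n_gt1 (W k) (y k) (v k) yW vW t x x' xW xW'.
  have xnx : x != x' by apply: contraTneq xx => ->; rewrite /low edge_ofxx.
  set D := (_ - _ : R); rewrite !conductance_label // => H.
  have H1 : expR (- (beta * (p0%:R / M%:R))) * D ^+ 2 <= expR (- (beta * (q0%:R / M%:R))).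
    apply: (@le_trans _ _ (expR (- (beta * label u x x')) * D ^+ 2)).
      apply: ler_wpM2r; first exact: sqr_ge0.
      by rewrite ler_expR lerN2 ler_wpM2l //; exact: low_label hu xx.
    apply: le_trans H _; rewrite ler_expR lerN2 ler_wpM2l //.
    by apply: le_trans l1; rewrite ler_pM2r ?invr_gt0 // ler_nat.
  have H2 : D ^+ 2 <= expR (- (beta * ((q0 - p0)%:R / M%:R) / 2)) ^+ 2.
    rewrite -(ler_pM2l (expR_gt0 (- (beta * (p0%:R / M%:R))))); apply: le_trans H1 _.
    rewrite expr2 -!expRD ler_expR natrB //.
    by rewrite le_eqVlt; apply/orP; left; apply/eqP; field; exact: lt0r_neq0.
  rewrite -(ler_pXn2r (n := 2)) ?nnegrE ?expR_ge0 //.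
  by rewrite real_normK ?num_real.
rewrite !conductance_label //.
(* The factor 2 comes from exp (- 1 / 2) >= 1 - 1 / 2. *)
apply: (@le_trans _ _ (2 * (expR (- (beta * label u (y k) (v k))) * (1 - 2^-1)))).
  by rewrite le_eqVlt; apply/orP; left; apply/eqP; field.
apply: ler_wpM2l => //.
apply: (@le_trans _ _ (expR (- (beta * label u (y k) (v k))) * expR (- 2^-1))).
  apply: ler_wpM2l; first exact: expR_ge0.
  exact: expR_ge1Dx.
rewrite -expRD ler_expR -opprD lerN2.
apply: (@le_trans _ _ (beta * (label u (y k) (v k) + width%:R / M%:R))); last first.
  by rewrite mulrDr lerD2l.
apply: ler_wpM2l => //; apply: (@le_trans _ _ ((digit y' w).+1%:R / M%:R)); first exact: ltW.
apply: (@le_trans _ _ ((digit (y k) (v k))%:R / M%:R + width%:R / M%:R)); last by rewrite lerD2r.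
by rewrite -mulrDl ler_pM2r ?invr_gt0 // -natrD ler_nat.
Qed.

End close_steps.

(** * Independence of functions of disjoint sets of labels *)

Section dependence.
Variables (R : realType) (E : finType) (M : nat).
Hypothesis M_gt0 : (0 < M)%N.
Notation labeling := {ffun E -> 'I_M}.
Implicit Types (D : {set E}).

Definition depends_on (V : Type) D (F : labeling -> V) : Prop :=
  forall f g : labeling, {in D, f =1 g} -> F f = F g.

Lemma depends_on_mix_in V D (F : labeling -> V) f g :
  depends_on D F -> F (mix D f g) = F g.
Proof. by move=> h; apply: h => e eD; rewrite ffunE eD. Qed.

Lemma depends_on_mix_out V D D' (F : labeling -> V) f g :
  depends_on D' F -> (forall e, e \in D -> e \notin D') -> F (mix D f g) = F f.
Proof.
move=> h dis; apply: h => e eD'; rewrite ffunE; case: ifP => // /dis.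
by rewrite eD'.
Qed.

Lemma mean_prod_indep (I : eqType) (r : seq I) (D : I -> {set E}) (F : I -> labeling -> R) :
  uniq r -> (forall i, i \in r -> depends_on (D i) (F i)) ->
  (forall i j e, i \in r -> j \in r -> i != j -> e \in D i -> e \notin D j) ->
  mean (fun f => \prod_(i <- r) F i f) = \prod_(i <- r) mean (F i).
Proof.
elim: r => [|i r IH] /=.
  by move=> _ _ _; under eq_mean do rewrite big_nil; rewrite mean_cst // big_nil.
move=> /andP [ir ur] dep dis; under eq_mean do rewrite big_cons; rewrite big_cons.
rewrite (mean_indep M_gt0 (D := D i)).
- congr (_ * _); apply: IH => // [j jr|j k e jr kr]; first by apply: dep; rewrite inE jr orbT.
  by apply: dis; rewrite inE ?jr ?kr orbT.
- by move=> f g; apply: depends_on_mix_in; apply: dep; rewrite inE eqxx.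
- move=> f g; apply: eq_big_seq => j jr.
  apply: (depends_on_mix_out (D' := D j)); first by apply: dep; rewrite inE jr orbT.
  move=> e; apply: dis; rewrite ?inE ?eqxx ?jr ?orbT //.
  by apply: contraNneq ir => ->.
Qed.

End dependence.

Section stars.
Variables (R : realType) (n M : nat).
Hypothesis M_gt0 : (0 < M)%N.
Notation labeling := {ffun edge n -> 'I_M}.
Implicit Types (f g : labeling) (a b z : 'I_n) (e : edge n).

Lemma digit_agree f g a b : (forall e, edge_of a b = Some e -> f e = g e) ->
  digit f a b = digit g a b.
Proof. by rewrite /digit; case: edge_of => // e /(_ e erefl) ->. Qed.

Lemma low_agree f g p a b : (forall e, edge_of a b = Some e -> f e = g e) ->
  low f p a b = low g p a b.
Proof. by rewrite /low; case: edge_of => // e /(_ e erefl) ->. Qed.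

Variables (B : {set 'I_n}).

(** Stars of distinct vertices of [B] are disjoint, which makes their spots independent. *)
Definition star z : {set edge n} := cross [set z]%SET (~: B)%SET.

Lemma star_edge z b e : b \notin B -> edge_of z b = Some e -> e \in star z.
Proof. by move=> bB h; apply/crossP; exists z, b; rewrite !inE. Qed.

Lemma star_disjoint z z' e : z \in B -> z' \in B -> z != z' -> e \in star z -> e \notin star z'.
Proof.
move=> zB zB' zz /crossP [a [b [/set1P -> bB h]]]; apply/negP.
move=> /crossP [a' [b' [/set1P -> bB' h']]].
have [[e1 _]|[e1 _]] := edge_of_inj h h'; first by rewrite e1 eqxx in zz.
by move: bB'; rewrite inE -e1 zB.
Qed.

Lemma card_star_le z : z \in B -> (#|star z| <= n)%N.
Proof.
move=> zB; rewrite card_cross ?cards1 ?mul1n.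
  by rewrite -[X in (_ <= X)%N](card_ord n) max_card.
by apply/fintype.subsetP => x; rewrite !inE negbK => /eqP ->.
Qed.

Variables (C : {set 'I_n}) (q0 width p1 cells : nat).
Hypothesis CB : C \subset (~: B)%SET.
Hypothesis q0p1 : (q0 + cells * width <= p1)%N.
Hypothesis p1M : (p1 <= M)%N.
Implicit Types (O : {set 'I_cells}).

Definition hit z O g : bool :=
  [exists c : 'I_cells, (c \in O) && spot g B C q0 width p1 z c].

Let CnB a : a \in C -> a \notin B.
Proof. by move=> /(fintype.subsetP CB); rewrite inE. Qed.

Lemma spot_depends z c : z \in B ->
  depends_on (star z) (fun g => spot g B C q0 width p1 z c).
Proof.
move=> zB f g fg; apply: eq_existsb => a; case: (boolP (a \in C)) => //= aC.
have -> : digit f z a = digit g z a.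
  by apply: digit_agree => e he; apply: fg; apply: star_edge he; exact: CnB.
congr [&& _, _ & _]; apply: eq_forallb => b; rewrite inE; case: (boolP (b \in B)) => //= bB.
congr (_ ==> ~~ _); apply: low_agree => e he; apply: fg; exact: star_edge he.
Qed.

Lemma hit_depends z O : z \in B -> depends_on (star z) (hit z O).
Proof.
move=> zB f g fg; apply: eq_existsb => c; congr (_ && _).
exact: (spot_depends c zB fg).
Qed.

Definition in_window O (j : nat) : bool :=
  [exists c : 'I_cells, (c \in O) && (q0 + c * width <= j < q0 + c.+1 * width)%N].

Lemma card_in_window O : (#|O| * width <= #|[pred j : 'I_M | in_window O j]|)%N.
Proof.
have bnd (p : 'I_cells * 'I_width) : (q0 + p.1 * width + p.2 < M)%N.
  apply: leq_trans p1M; apply: leq_trans q0p1; case: p => c i /=.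
  rewrite -addnA ltn_add2l; apply: (@leq_trans (c.+1 * width)).
    by rewrite mulSn addnC ltn_add2r.
  by rewrite leq_mul2r ltn_ord orbT.
pose h p := Ordinal (bnd p).
have hinj : injective h.
  move=> [c i] [c' i'] /(congr1 val) /= /eqP; rewrite -!addnA eqn_add2l => /eqP E.
  have w0 : (0 < width)%N by exact: leq_ltn_trans (ltn_ord i).
  have ec : c = c'.
    apply: val_inj => /=; have := congr1 (divn^~ width) E.
    by rewrite !divnMDl // !divn_small ?addn0.
  by move: E; rewrite ec => /addnI ei; congr pair; exact: val_inj.
have -> : (#|O| * width)%N = #|(h @: finset.setX O [set: 'I_width]%SET)%SET|.
  by rewrite card_imset // cardsX cardsT card_ord.
apply: subset_leq_card; apply/fintype.subsetP => j /imsetP [[c i] /setXP [/= cO _] ->].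
rewrite inE /=; apply/existsP; exists c; rewrite cO /= leq_addr /=.
by rewrite mulSn [(width + _)%N]addnC addnA ltn_add2l.
Qed.

Lemma in_window_low O j : in_window O j -> (j < p1)%N.
Proof.
move=> /existsP [c /andP [_ /andP [_ h]]]; apply: leq_trans h _.
by apply: leq_trans q0p1; rewrite leq_add2l leq_mul2r ltn_ord orbT.
Qed.

(** Lower bound for the frequency of a spot in one given window: a core endpoint, a label in the
    window, and at most n further edges that are not low. *)
Definition hit_rate : R := #|C|%:R * (width%:R / M%:R) * (1 - p1%:R / M%:R) ^+ n.

Let MR : 0 < M%:R :> R.
Proof. by rewrite ltr0n. Qed.

Let x := 1 - p1%:R / M%:R : R.

Let x0 : 0 <= x.
Proof. by rewrite subr_ge0 ler_pdivrMr // mul1r ler_nat. Qed.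

Let x1 : x <= 1.
Proof. by rewrite gerBl divr_ge0. Qed.

Lemma hit_rate_ge0 : 0 <= hit_rate.
Proof. by rewrite !mulr_ge0 ?exprn_ge0 ?invr_ge0. Qed.

(** The events [Ev a] exclude one another, since [Ev b] makes the edge to [b] low and [Ev a] forbids
    this; their frequencies therefore add up over [a] in [C]. *)
Lemma freq_hit_ge z O : z \in B -> #|O|%:R * hit_rate <= freq R (hit z O).
Proof.
move=> zB.
pose S a e (j : 'I_M) := if edge_of z a == Some e then in_window O j
  else (e \in star z) ==> (p1 <= j)%N.
pose Ev a g := [forall e, S a e (g e)].
have Ev_low a b g : a \in C -> Ev a g -> b \notin B -> b != a -> ~~ low g p1 z b.
  move=> aC /forallP h bB ba.
  have zb : z != b by apply: contraNneq bB => <-.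
  have [e he] := edge_of_ex zb; rewrite /low he -leqNgt.
  have := h e; rewrite /S (star_edge bB he); case: eqP => //= za.
  have [[_ e1]|[e1 _]] := edge_of_inj he za; first by rewrite e1 eqxx in ba.
  by move: (CnB aC); rewrite -e1 zB.
have Ev_win a g : a \in C -> Ev a g -> in_window O (digit g z a).
  move=> aC /forallP h; have za : z != a by apply: contraTneq zB => ->; exact: CnB.
  have [e he] := edge_of_ex za; rewrite /digit he.
  by have := h e; rewrite /S he eqxx.
apply: (@le_trans _ _ (\sum_(a in C) freq R (Ev a))); last first.
  rewrite -mean_sum; apply: mean_le => // g.
  have [/existsP [a /andP [aC Ea]]|none] := boolP [exists a, (a \in C) && Ev a g]; last first.
    rewrite big1 // => a aC; move: none; rewrite negb_exists => /forallP /(_ a).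
    by rewrite aC /= => /negbTE ->.
  rewrite (bigD1 a) //= big1 ?addr0; last first.
    move=> b /andP [bC ba]; case: (boolP (Ev b g)) => // Eb.
    have := Ev_low a b g aC Ea (CnB bC) ba; rewrite lowE.
      by rewrite (in_window_low (Ev_win _ _ bC Eb)).
    by apply: contraTneq zB => ->; exact: CnB.
  rewrite Ea; suff -> : hit z O g by [].
  have /existsP [c /andP [cO /andP [d1 d2]]] := Ev_win _ _ aC Ea.
  apply/existsP; exists c; rewrite cO; apply/existsP; exists a; rewrite aC d1 d2 /=.
  apply/forallP => b; apply/implyP; rewrite inE => bB; apply/implyP.
  exact: (Ev_low a b g aC Ea bB).
have -> : #|O|%:R * hit_rate = \sum_(a in C) (#|O|%:R * (width%:R / M%:R) * x ^+ n).
  by rewrite sumr_const -[RHS]mulr_natl /hit_rate -/x; ring.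
apply: ler_sum => a aC; rewrite /freq.
have za : z != a by apply: contraTneq zB => ->; exact: CnB.
have [e0 he0] := edge_of_ex za.
have := freq_forall R (S a); rewrite /freq => ->.
rewrite (bigD1 e0) //=; apply: ler_pM.
- by rewrite mulr_ge0 // divr_ge0.
- by rewrite exprn_ge0.
- rewrite mulrA ler_pM2r ?invr_gt0 // -natrM ler_nat.
  apply: leq_trans (card_in_window O) _; apply: subset_leq_card.
  by apply/fintype.subsetP => j; rewrite inE => h; rewrite unfold_in /S he0 eqxx.
apply: (@le_trans _ _ (\prod_(e | e != e0) (if e \in star z then x else 1))).
  rewrite -big_mkcondr /= prodr_const; apply: ler_wiXn2l => //.
  apply: leq_trans (card_star_le zB); apply: subset_leq_card.
  by apply/fintype.subsetP => e; rewrite unfold_in => /andP [].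
apply: ler_prod => e ne; rewrite (_ : (if _ then _ else _) = #|S a e|%:R / M%:R).
  by rewrite divr_ge0 //=.
have ee : (edge_of z a == Some e) = false.
  by rewrite he0; apply/negbTE; apply: contra ne => /eqP [->].
case: (boolP (e \in star z)) => es.
  rewrite (_ : #|S a e| = (M - p1)%N); first by rewrite natrB // mulrBl divff ?gt_eqF.
  rewrite -(card_ord_itv p1 (leqnn M)); apply: eq_card => j.
  by rewrite !inE unfold_in /S ee es /= ltn_ord andbT.
rewrite (_ : #|S a e| = M) ?divff ?gt_eqF //.
rewrite -[RHS]card_ord; apply: eq_card => j.
by rewrite unfold_in /S ee (negbTE es).
Qed.

Variables (I1 I2 : {set 'I_n}).
Hypothesis I1B : I1 \subset B.
Hypothesis I2B : I2 \subset B.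
Hypothesis I12 : I1 \subset (~: I2)%SET.

Definition collision O g : bool :=
  [exists c : 'I_cells, (c \in O) && [exists z in B, [exists z' in B,
     [&& z != z', z \in I1 :|: I2, z' \in I1 :|: I2,
      spot g B C q0 width p1 z c & spot g B C q0 width p1 z' c]]]]%SET.

Definition occupied O g : {set 'I_cells} :=
  [set c in O | [exists z in I1, spot g B C q0 width p1 z c]]%SET.

(** The factors are independent because the stars are disjoint. The value 1/2 of [alpha] gives an
    exponential moment of the number of hits, and 0 gives the frequency of no hit at all. *)
Lemma mean_prod_hit (I : {set 'I_n}) O (alpha : R) : I \subset B -> 0 <= alpha <= 1 ->
  mean (fun g => \prod_(z in I) (if hit z O g then alpha else 1)) <=
    expR (- ((1 - alpha) * #|O|%:R * hit_rate)) ^+ #|I|.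
Proof.
move=> IB /andP [a0 a1].
under eq_mean do rewrite -big_enum /=.
rewrite (mean_prod_indep M_gt0 (D := star)); first last.
- move=> z z' e; rewrite !mem_enum => zI zI'; apply: star_disjoint; exact: (fintype.subsetP IB).
- move=> z; rewrite mem_enum => zI f g fg.
  by rewrite (hit_depends O (fintype.subsetP IB z zI) fg).
- exact: enum_uniq.
rewrite big_enum /= -prodr_const; apply: ler_prod => z zI; apply/andP; split.
  by apply: mean_ge0 => // g; case: ifP.
apply: le_trans (le1_expR _).
have -> : mean (fun g => if hit z O g then alpha else 1) = 1 - (1 - alpha) * freq R (hit z O).
  rewrite -[X in _ = X - _](mean_cst (edge n) M_gt0) -mulNr -meanZ -meanD.
  by apply: eq_mean => g; case: hit => /=; ring.
rewrite lerD2l lerN2 -mulrA ler_wpM2l ?subr_ge0 // freq_hit_ge //.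
exact: (fintype.subsetP IB).
Qed.

(* Birthday bound: many points of [I1] fall into the windows [O], into distinct
   ones unless they collide; a point of [I2] then has many windows to hit. *)
Lemma freq_no_collision O k :
  freq R (fun g => ~~ collision O g) <=
    2 ^+ k * expR (- (#|O|%:R * hit_rate / 2)) ^+ #|I1| +
    expR (- (k%:R * hit_rate)) ^+ #|I2|.
Proof.
pose S g := [set z in I1 | hit z O g]%SET.
have occ g : ~~ collision O g -> (#|S g| <= #|occupied O g|)%N.
  move=> nc; apply: (leq_card_rel (r := fun z c => c \in O /\ spot g B C q0 width p1 z c)).
    move=> z; rewrite inE => /andP [zI /existsP [c /andP [cO sc]]]; exists c => //.
    by rewrite inE cO; apply/existsP; exists z; rewrite zI.
  move=> z z' c; rewrite !inE => /andP [zI _] /andP [zI' _] [cO sc] [_ sc'].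
  apply/eqP; apply: contraNT nc => zz; apply/existsP; exists c; rewrite cO.
  apply/existsP; exists z; rewrite (fintype.subsetP I1B z zI).
  apply/existsP; exists z'; rewrite (fintype.subsetP I1B z' zI') /=.
  by rewrite zz !inE zI zI' sc sc'.
have noI2 g z : ~~ collision O g -> z \in I2 -> ~~ hit z (occupied O g) g.
  move=> nc zI; apply: contra nc => /existsP [c /andP []]; rewrite inE.
  move=> /andP [cO /existsP [z' /andP [zI' sc']]] sc; apply/existsP; exists c; rewrite cO.
  apply/existsP; exists z; rewrite (fintype.subsetP I2B z zI).
  apply/existsP; exists z'; rewrite (fintype.subsetP I1B z' zI') /=.
  rewrite !inE zI zI' sc sc' orbT /= !andbT.
  by apply: contraTneq (fintype.subsetP I12 z' zI') => <-; rewrite inE zI.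
pose F1 (g : labeling) : R := \prod_(z in I1) (if hit z O g then 2^-1 else 1).
pose F2 (g : labeling) : R := (k <= #|occupied O g|)%N%:R *
  \prod_(z in I2) (if hit z (occupied O g) g then 0 else 1).
have F1E g : F1 g = 2^-1 ^+ #|S g|.
  rewrite /F1 -big_mkcondr /= prodr_const; congr (_ ^+ _).
  by apply: eq_card => z; rewrite !inE.
have F20 g : 0 <= F2 g.
  by rewrite /F2 mulr_ge0 // prodr_ge0 // => z _; case: ifP.
apply: (@le_trans _ _ (mean (fun g => 2 ^+ k * F1 g + F2 g))).
  apply: mean_le => // g; case: (boolP (collision O g)) => nc /=.
    by rewrite addr_ge0 // F1E mulr_ge0 // exprn_ge0 // invr_ge0.
  (* Fewer than [k] hits from [I1] are charged to [F1]; otherwise at least [k] windows are occupied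
     and all of [I2] avoids them, which is charged to [F2]. *)
  have [Sk|Sk] := leqP k #|S g|; last first.
    apply: (@le_trans _ _ (2 ^+ k * F1 g)); last by rewrite lerDl.
    rewrite F1E -(subnK (ltnW Sk)) exprD -mulrA -exprMn divff ?pnatr_eq0 // expr1n mulr1.
    by apply: exprn_ege1; rewrite ler1n.
  apply: (@le_trans _ _ (F2 g)); last first.
    by rewrite lerDr F1E mulr_ge0 // exprn_ge0 // invr_ge0.
  rewrite /F2 (leq_trans Sk (occ g nc)) mul1r big1 // => z zI.
  by rewrite (negbTE (noI2 g z nc zI)).
rewrite meanD meanZ; apply: lerD.
  apply: ler_wpM2l; first exact: exprn_ge0.
  apply: le_trans (mean_prod_hit O (alpha := 2^-1) I1B _) _; first lra.
  rewrite le_eqVlt; apply/orP; left; apply/eqP; congr (expR (- _) ^+ _).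
  by field.
(* Resample only the stars of [I2]: the windows occupied by [I1] stay fixed. *)
rewrite (mean_mix M_gt0 (cross I2 (~: B)%SET)) -[leRHS](mean_cst (edge n) M_gt0).
apply: mean_le => // f.
have occE g : occupied O (mix (cross I2 (~: B)%SET) f g) = occupied O f.
  apply/setP => c; rewrite !inE; congr (_ && _); apply: eq_existsb => z.
  case: (boolP (z \in I1)) => //= zI; have zB := fintype.subsetP I1B z zI.
  apply: (depends_on_mix_out _ _ (spot_depends c zB)).
  move=> e /crossP [a [b [aI bB he]]]; apply/negP => /crossP [a' [b' [/set1P -> bB' he']]].
  have [[e1 _]|[e1 _]] := edge_of_inj he he'.
    by move: (fintype.subsetP I12 z zI); rewrite inE -e1 aI.
  by move: bB'; rewrite inE -e1 (fintype.subsetP I2B a aI).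
have [kf|kf] := leqP k #|occupied O f|; last first.
  apply: (@le_trans _ _ (mean (fun _ : labeling => 0 : R))); last first.
    by rewrite mean_cst // exprn_ge0 // expR_ge0.
  by apply: mean_le => // g; rewrite /F2 occE leqNgt kf mul0r.
apply: (@le_trans _ _ (mean (fun g => \prod_(z in I2) (if hit z (occupied O f) g then 0 else 1)))).
  apply: mean_le => // g; rewrite /F2 occE kf mul1r le_eqVlt; apply/orP; left; apply/eqP.
  apply: eq_bigr => z zI.
  have -> // : hit z (occupied O f) (mix (cross I2 (~: B)%SET) f g) = hit z (occupied O f) g.
  apply: (hit_depends _ (fintype.subsetP I2B z zI)) => e /crossP [a [b [/set1P -> bB he]]].
  rewrite ffunE ifT //; apply/crossP; by exists z, b.
apply: le_trans (mean_prod_hit (occupied O f) (alpha := 0) I2B _) _; first by rewrite lexx ler01.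
apply: lerXn2r; rewrite ?nnegrE ?expR_ge0 // ler_expR lerN2 subr0 mul1r.
by rewrite ler_wpM2r ?hit_rate_ge0 // ler_nat.
Qed.
End stars.

(** * Regular labelings and their frequency *)

Section regime.
Variables (R : realType) (n M : nat).
Hypothesis n_gt1 : (1 < n)%N.
Hypothesis M_gt0 : (0 < M)%N.
Notation labeling := {ffun edge n -> 'I_M}.
Implicit Types (f g : labeling) (a b z : 'I_n) (e : edge n).

Lemma giant_agree f f' p (A : {set 'I_n}) :
  (forall a b, a \in A -> b \in A -> low f p a b = low f' p a b) ->
  giant f p A = giant f' p A.
Proof.
move=> h; have E S : low_closed f p A S = low_closed f' p A S.
  rewrite /low_closed; case: (boolP (S \subset A)) => //= SA.
  apply: eq_forallb => a; case: (boolP (a \in S)) => //= aS.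
  apply: eq_forallb => b; rewrite inE; case: (boolP (b \in A)) => bA; rewrite ?andbF ?andbT //.
  by rewrite h // (fintype.subsetP SA).
by rewrite /giant; under eq_fun do rewrite E.
Qed.

Lemma cross_mix_out (Y D : {set 'I_n}) f g a b e : edge_of a b = Some e ->
  (a \notin Y) && (b \notin Y) || (a \notin D) && (b \notin D) -> mix (cross Y D) f g e = f e.
Proof.
move=> he h; rewrite ffunE ifF //; apply/negbTE/negP => /crossP [x [x' [xY xD hx]]].
by move: h; have [[-> ->]|[-> ->]] := edge_of_inj he hx; rewrite xY xD ?andbF.
Qed.

Variables (s : 'I_n) (B1 B2 : {set 'I_n}) (nB p0 q0 width p1 L m : nat).
Notation B := (B1 :|: B2)%SET.
Notation A := (~: (s |: B))%SET.
Notation cells := (L * m)%N.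
Hypothesis sB : s \notin B.
Hypothesis B12 : B1 \subset (~: B2)%SET.
Hypothesis cB1 : #|B1| = nB.
Hypothesis cB2 : #|B2| = nB.
Hypothesis nB_gt0 : (0 < nB)%N.
Hypothesis A2 : (n <= 2 * #|A|)%N.
Hypothesis p0q0 : (p0 <= q0)%N.
Hypothesis q0p1 : (q0 + cells * width <= p1)%N.
Hypothesis p1M : (p1 <= M)%N.
Hypothesis width_gt0 : (0 < width)%N.

Definition core f : {set 'I_n} := giant f p0 A.

(** Stands in for the expander property when labels are resampled: it depends only on the labels
    inside [A]. *)
Definition core_ok f : bool := (core f \subset A) && (n <= 8 * #|core f|)%N.

Definition source_ok f : bool := [exists a, (a \in core f) && low f p1 s a].

Definition free (Bi : {set 'I_n}) f : {set 'I_n} := [set z in Bi | low_isolated f B p1 z]%SET.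

Definition many_free Bi f : bool := (nB <= 2 * #|free Bi f|)%N.

(** The windows are divided into [L] groups of [m]; one collision per group yields [L] different
    close steps. *)
Definition window (l : nat) : {set 'I_cells} := [set c : 'I_cells | (l * m <= c < l.+1 * m)%N]%SET.

Definition collides l f : bool :=
  collision B (core f) q0 width p1 (free B1 f) (free B2 f) (window l) f.

Lemma card_window l : (l < L)%N -> #|window l| = m.
Proof.
move=> lL; have h : (l.+1 * m <= cells)%N by rewrite leq_mul2r lL orbT.
rewrite -[RHS](addnK (l * m)) -mulSn -(card_ord_itv (l * m) h).
by apply: eq_card => c; rewrite !inE.
Qed.

Let MR : 0 < M%:R :> R.
Proof. by rewrite ltr0n. Qed.

Lemma freq_low a b : freq R (fun f => low f p1 a b) <= p1%:R / M%:R.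
Proof.
rewrite /low; case: edge_of => [e|]; last first.
  by rewrite /freq mean_cst // divr_ge0.
have := freq_at R M_gt0 e (fun j : 'I_M => (j < p1)%N) => ->.
rewrite ler_pM2r ?invr_gt0 // ler_nat.
have := card_ord_itv_le M 0 p1; rewrite subn0; apply: leq_trans.
by apply: subset_leq_card; apply/fintype.subsetP => j; rewrite !inE.
Qed.

(** The core does not depend on the edges between [s] and [A]. With the core fixed, its edges to [s]
    are at least n / 8 independent chances for a low label. *)
Lemma freq_source : freq R (fun f => core_ok f && ~~ source_ok f) <=
  expR (- (p1%:R / M%:R * (n%:R / 8))).
Proof.
rewrite /freq (mean_mix M_gt0 (cross [set s]%SET A)) -[leRHS](mean_cst (edge n) M_gt0).
apply: mean_le => // f.
have coreE g : core (mix (cross [set s]%SET A) f g) = core f.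
  apply: giant_agree => a b aA bA; apply: low_agree => e he.
  apply: cross_mix_out he _; apply/orP; left.
  by move: aA bA; rewrite !inE !negb_or => /andP [-> _] /andP [-> _].
have [/andP [CA C8]|nok] := boolP (core_ok f); last first.
  apply: (@le_trans _ _ (mean (fun _ : labeling => 0 : R))); last first.
    by rewrite mean_cst // expR_ge0.
  by apply: mean_le => // g; rewrite /core_ok coreE -/(core_ok f) (negbTE nok).
pose x : R := 1 - p1%:R / M%:R.
have x0 : 0 <= x by rewrite subr_ge0 ler_pdivrMr // mul1r ler_nat.
have dis : [set s]%SET \subset (~: core f)%SET.
  apply/fintype.subsetP => a; rewrite !inE => /eqP ->.
  by apply/negP => /(fintype.subsetP CA); rewrite !inE eqxx.
apply: (@le_trans _ _ (freq R (fun g : labeling =>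
    [forall e, (e \in cross [set s]%SET (core f)) ==> (p1 <= g e)%N]))).
  apply: freq_sub => // g /andP [_ ns]; apply/forallP => e; apply/implyP.
  move=> /crossP [a [b [/set1P -> bC he]]]; rewrite leqNgt; apply: contra ns => lt.
  apply/existsP; exists b; rewrite coreE bC /low he ffunE ifT //.
  by apply/crossP; exists s, b; rewrite inE eqxx (fintype.subsetP CA b bC).
have := freq_forall R (fun e (j : 'I_M) => (e \in cross [set s]%SET (core f)) ==> (p1 <= j)%N).
move=> ->; apply: (@le_trans _ _ (\prod_e (if e \in cross [set s]%SET (core f) then x else 1))).
  apply: ler_prod => e _; rewrite divr_ge0 //=; case: ifP => ec.
    rewrite (_ : #|_| = (M - p1)%N); first by rewrite natrB // mulrBl divff ?gt_eqF.
    rewrite -(card_ord_itv p1 (leqnn M)); apply: eq_card => j.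
    by rewrite !inE unfold_in /= ltn_ord andbT.
  rewrite (_ : #|_| = M) ?divff ?gt_eqF //.
  by rewrite -[RHS]card_ord; apply: eq_card => j; rewrite unfold_in.
rewrite -big_mkcond prodr_const card_cross // cards1 mul1n.
apply: (@le_trans _ _ (expR (- (p1%:R / M%:R)) ^+ #|core f|)).
  by apply: lerXn2r; rewrite ?nnegrE ?expR_ge0 // le1_expR.
rewrite -expRM_natr ler_expR mulNr lerN2; apply: ler_wpM2l; first by rewrite divr_ge0.
rewrite ler_pdivrMr // -natrM ler_nat mulnC; exact: C8.
Qed.

(** First moment: if fewer than half of [Bi] is free, at least nB / 2 low pairs have their first
    vertex in [Bi] and the second in [B], while their mean number is at most 2 nB ^ 2 p1 / M. *)
Lemma freq_few_free (Bi : {set 'I_n}) : Bi \subset B -> #|Bi| = nB ->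
  freq R (fun f => ~~ many_free Bi f) <= 4 * nB%:R * (p1%:R / M%:R).
Proof.
move=> BiB cBi.
pose F f : R := \sum_(z in Bi) \sum_(z' in B) (low f p1 z z')%:R.
have nBR : 0 < nB%:R :> R by rewrite ltr0n.
have F0 f : 0 <= F f by apply: sumr_ge0 => z _; apply: sumr_ge0.
apply: le_trans (markov_mean (F := F) (c := nB%:R / 2) M_gt0 _ F0 _) _.
- by rewrite divr_gt0.
- move=> f few.
  have c := cardsID (free Bi f) Bi.
  have sub : (Bi :&: free Bi f = free Bi f)%SET.
    by apply/finset.setIidPr/fintype.subsetP => z; rewrite inE => /andP [].
  rewrite sub cBi in c.
  have big : (nB <= 2 * #|Bi :\: free Bi f|)%N.
    move: few; rewrite /many_free -ltnNge => few.
    have arith (x1 x2 : nat) : (x1 + x2 = nB -> 2 * x1 < nB -> nB <= 2 * x2)%N by lia.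
    exact: arith c few.
  apply: (@le_trans _ _ (#|Bi :\: free Bi f|%:R)).
    by rewrite ler_pdivrMr // -natrM ler_nat mulnC.
  rewrite -sum1_card natr_sum big_mkcond [leRHS]big_mkcond; apply: ler_sum => z _.
  rewrite !inE; case: (boolP (z \in Bi)) => //= zB; rewrite andbT; case: ifP => //=.
    rewrite negb_forall => /existsP [z']; rewrite negb_imply negbK => /andP [zB' lz].
    by rewrite (bigD1 z') //= lz lerDl sumr_ge0.
  by move=> _; exact: sumr_ge0.
rewrite ler_pdivrMr ?divr_gt0 //.
rewrite mean_sum; apply: (@le_trans _ _ (\sum_(z in Bi) \sum_(z' in B) p1%:R / M%:R)).
  apply: ler_sum => z _; rewrite mean_sum; apply: ler_sum => z' _; exact: freq_low.
rewrite !sumr_const cBi.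
have cB : (#|B| <= 2 * nB)%N.
  by apply: leq_trans (leq_card_setU _ _) _; rewrite cB1 cB2 addnn mul2n.
rewrite -[leLHS]mulr_natl -[X in _ * X <= _]mulr_natl.
have -> : 4 * nB%:R * (p1%:R / M%:R) * (nB%:R / 2) = nB%:R * ((2 * nB)%:R * (p1%:R / M%:R)) :> R.
  by rewrite natrM; field; exact: lt0r_neq0.
by rewrite ler_pM2l // ler_wpM2r ?divr_ge0 // ler_nat.
Qed.

Definition rate : R := n%:R / 8 * (width%:R / M%:R) * (1 - p1%:R / M%:R) ^+ n.

(** Resampling the edges between [B] and its complement changes neither the core, read off inside
    [A], nor the free vertices, read off inside [B]; the birthday bound applies with these fixed. *)
Lemma freq_not_collides l k : (l < L)%N ->
  freq R (fun f => [&& core_ok f, many_free B1 f, many_free B2 f & ~~ collides l f]) <=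
    2 ^+ k * expR (- (m%:R * rate * nB%:R / 4)) + expR (- (k%:R * rate * nB%:R / 2)).
Proof.
move=> lL; set D := cross B (~: B)%SET.
rewrite /freq (mean_mix M_gt0 D) -[leRHS](mean_cst (edge n) M_gt0).
apply: mean_le => // f.
have coreE g : core (mix D f g) = core f.
  apply: giant_agree => a b aA bA; apply: low_agree => e he.
  apply: cross_mix_out he _; apply/orP; left; apply/andP.
  by move: aA bA; rewrite !finset.in_setC !finset.in_setU1 !negb_or => /andP [_ ->] /andP [_ ->].
have freeE (Bi : {set 'I_n}) g : Bi \subset B -> free Bi (mix D f g) = free Bi f.
  move=> BiB; apply/setP => z; rewrite !inE; case: (boolP (z \in Bi)) => //= zBi.
  apply: eq_forallb => z'; case: (boolP (z' \in B)) => //= zB'.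
  congr (~~ _); apply: low_agree => e he; apply: cross_mix_out he _; apply/orP; right.
  by rewrite !(finset.in_setC, negbK) zB' (fintype.subsetP BiB).
have B1B : B1 \subset B by exact: finset.subsetUl.
have B2B : B2 \subset B by exact: finset.subsetUr.
set I1 := free B1 f; set I2 := free B2 f.
have I1B : I1 \subset B.
  by apply/fintype.subsetP => z; rewrite inE => /andP [zB _]; exact: (fintype.subsetP B1B).
have I2B : I2 \subset B.
  by apply/fintype.subsetP => z; rewrite inE => /andP [zB _]; exact: (fintype.subsetP B2B).
have I12 : I1 \subset (~: I2)%SET.
  apply/fintype.subsetP => z; rewrite inE => /andP [zB _]; rewrite !inE negb_and.
  by move/(fintype.subsetP B12): zB; rewrite inE => ->.
have RHS0 : 0 <= 2 ^+ k * expR (- (m%:R * rate * nB%:R / 4)) + expR (- (k%:R * rate * nB%:R / 2)) :> R.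
  by rewrite addr_ge0 ?mulr_ge0 ?exprn_ge0 ?expR_ge0.
have [/and3P [/andP [CA C8] mf1 mf2]|nok] := boolP [&& core_ok f, many_free B1 f & many_free B2 f]; last first.
  apply: (@le_trans _ _ (mean (fun _ : labeling => 0 : R))); last by rewrite mean_cst.
  apply: mean_le => // g; rewrite /core_ok /many_free coreE !freeE //.
  case: and4P => // -[h1 h2 h3 _]; case/negP: nok.
  by rewrite /core_ok /many_free h1 h2 h3.
have CB : core f \subset (~: B)%SET.
  apply: fintype.subset_trans CA _; rewrite finset.setCS; exact: finset.subsetUr.
have colE g : collides l (mix D f g) = collision B (core f) q0 width p1 I1 I2 (window l) g.
  rewrite /collides coreE !freeE //; apply: eq_existsb => c; congr (_ && _).
  have spE z : z \in B -> spot (mix D f g) B (core f) q0 width p1 z c =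
      spot g B (core f) q0 width p1 z c.
    move=> zB; apply: (spot_depends _ _ _ CB _ zB) => e /crossP [a [b [/set1P -> bB he]]].
    by rewrite ffunE ifT //; apply/crossP; exists z, b.
  apply: eq_existsb => z; case: (boolP (z \in B)) => //= zB.
  by apply: eq_existsb => z'; case: (boolP (z' \in B)) => //= zB'; rewrite !spE.
apply: (@le_trans _ _ (freq R (fun g => ~~ collision B (core f) q0 width p1 I1 I2 (window l) g))).
  by apply: freq_sub => // g /and4P [_ _ _]; rewrite colE.
apply: le_trans (freq_no_collision R M_gt0 CB q0p1 p1M I1B I2B I12 (window l) k) _.
have x0 : 0 <= 1 - p1%:R / M%:R :> R by rewrite subr_ge0 ler_pdivrMr // mul1r ler_nat.
set h := hit_rate _ _ _ _ _.
have rate0 : 0 <= rate by rewrite /rate !mulr_ge0 ?exprn_ge0 ?invr_ge0.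
have rh : rate <= h.
  rewrite /rate /h /hit_rate; apply: ler_wpM2r; first exact: exprn_ge0.
  by apply: ler_wpM2r; [rewrite divr_ge0 | rewrite ler_pdivrMr // -natrM ler_nat mulnC].
have half (c : nat) : (nB <= 2 * c)%N -> nB%:R / 2 <= c%:R :> R.
  by move=> hc; rewrite ler_pdivrMr // -natrM ler_nat mulnC.
rewrite -!expRM_natr card_window //; apply: lerD.
  apply: ler_wpM2l; first exact: exprn_ge0.
  rewrite ler_expR mulNr lerN2.
  have -> : m%:R * rate * nB%:R / 4 = (m%:R * rate / 2) * (nB%:R / 2) by field.
  apply: ler_pM; [exact: divr_ge0 (mulr_ge0 _ rate0) _|exact: divr_ge0| |exact: half].
  by apply: ler_wpM2r; [rewrite invr_ge0 | exact: ler_wpM2l].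
rewrite ler_expR mulNr lerN2 -[leLHS]mulrA.
apply: ler_pM; [exact: mulr_ge0|exact: divr_ge0| |exact: half].
exact: ler_wpM2l.
Qed.

Definition irregular f : bool :=
  [|| ~~ injectiveb f, ~~ expander p0 f, core_ok f && ~~ source_ok f,
      ~~ many_free B1 f, ~~ many_free B2 f |
      [exists l : 'I_L, [&& core_ok f, many_free B1 f, many_free B2 f & ~~ collides l f]]].

Lemma freq_irregular k : (p0 <= M)%N -> (p0 * n = 640 * M)%N ->
  freq R irregular <= (n ^ 4)%:R / M%:R + (4^-1 ^+ n +
    (expR (- (p1%:R / M%:R * (n%:R / 8))) + (4 * nB%:R * (p1%:R / M%:R) +
    (4 * nB%:R * (p1%:R / M%:R) +
    L%:R * (2 ^+ k * expR (- (m%:R * rate * nB%:R / 4)) + expR (- (k%:R * rate * nB%:R / 2))))))).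
Proof.
move=> p0M p0n.
apply: le_trans (freqU _ M_gt0 _ _) _; apply: lerD.
  apply: le_trans (freq_not_injective _ _ M_gt0) _.
  rewrite ler_pM2r ?invr_gt0 // ler_nat.
  by rewrite (expnM n 2 2) leq_exp2r // card_edge_le.
apply: le_trans (freqU _ M_gt0 _ _) _; apply: lerD; first exact: freq_not_expander.
apply: le_trans (freqU _ M_gt0 _ _) _; apply: lerD; first exact: freq_source.
apply: le_trans (freqU _ M_gt0 _ _) _; apply: lerD.
  by apply: freq_few_free => //; exact: finset.subsetUl.
apply: le_trans (freqU _ M_gt0 _ _) _; apply: lerD.
  by apply: freq_few_free => //; exact: finset.subsetUr.
apply: le_trans (freq_exists R M_gt0 (fun (l : 'I_L) f =>
  [&& core_ok f, many_free B1 f, many_free B2 f & ~~ collides l f]) predT) _.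
rewrite -[L in leRHS]card_ord mulr_natl -sumr_const; apply: ler_sum => l _.
exact: freq_not_collides.
Qed.

(** The steps found for different groups are different, because the vertex added at a step has its
    spot in a single window. *)
Lemma count_close_step f y v : ~~ irregular f -> prim_run (digits R f) s y v ->
  (L <= \sum_(0 <= k < n.-1) close_step R f s y v (core f) q0 width k)%N.
Proof.
rewrite !negb_or => /and5P [/negPn /injectiveP inj /negPn fexp src /negPn mf1 /andP [/negPn mf2 col]] run.
have [CA C8 Cconn] := giantP (ltnW n_gt1) A2 fexp.
have ok : core_ok f by rewrite /core_ok CA.
have s_conn : exists2 a, a \in core f & low f p1 s a.
  by move: src; rewrite ok /= => /negPn /existsP [a /andP [aC sa]]; exists a.
rewrite big_mkord -[X in (X <= _)%N](card_ord L) -cardsT.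
apply: (@leq_trans #|[set k : 'I_n.-1 | close_step R f s y v (core f) q0 width k]%SET|); last first.
  rewrite -sum1_card big_mkcond; apply: leq_sum => k _; rewrite inE.
  by case: close_step.
pose r (l : 'I_L) (k : 'I_n.-1) := v k \in B /\
  exists2 c : 'I_cells, c \in window l & spot f B (core f) q0 width p1 (v k) c.
apply: (leq_card_rel (r := r)).
  move=> l _; move: col; rewrite negb_exists => /forallP /(_ l).
  rewrite ok mf1 mf2 /= => /negPn /existsP [c /andP [cl /existsP [z /andP [zB /existsP [z']]]]].
  move=> /andP [zB' /and5P [zz zI zI' sz sz']].
  have iso x : x \in (free B1 f :|: free B2 f)%SET -> low_isolated f B p1 x.
    by rewrite !inE => /orP [] /andP [_].
  have [k [kn ck vB sk]] := spot_pair_close n_gt1 M_gt0 run sB CA Cconn p0q0 q0p1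
    s_conn zB zB' zz (iso _ zI) (iso _ zI') (ltn_ord c) sz sz'.
  exists (Ordinal kn); first by rewrite inE.
  by split=> //; exists c.
move=> l l' k _ _ [vB [c cl sc]] [_ [c' cl' sc']].
have E := spot_inj CA q0p1 width_gt0 vB (ltn_ord c) (ltn_ord c') sc sc'.
apply: val_inj => /=; move: cl cl'; rewrite !inE -E.
move=> /andP [h1 h2] /andP [h3 h4].
have l1 := leq_ltn_trans h1 h4; have l2 := leq_ltn_trans h3 h2.
have m0 : (0 < m)%N by case: (m) l1 => // ; rewrite !muln0.
by move: l1 l2; rewrite !ltn_pmul2r // !ltnS => l1 l2; apply/eqP; rewrite eqn_leq l1 l2.
Qed.

End regime.

Section large_beta.
Context d (T : measurableType d) (R : realType) (P : probability T R).
Variables (n : nat) (beta : R) (s : 'I_n).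
Variables (U : edge n -> {RV P >-> R}) (X : nat -> T -> 'I_n).
Hypothesis n_gt1 : (1 < n)%N.
Hypothesis beta_ge0 : 0 <= beta.
Hypothesis iidU : iid_uniform01 U.
Hypothesis walkX : walk_given_labels beta s U X.
Notation same := (same_run s (fun e => U e : T -> R) X).

Lemma prob_same_run_large_beta M (B1 B2 : {set 'I_n}) nB p0 q0 width p1 L m k :
  (0 < M)%N -> (s \notin B1 :|: B2)%SET -> B1 \subset (~: B2)%SET ->
  #|B1| = nB -> #|B2| = nB -> (0 < nB)%N -> (n <= 2 * #|(~: (s |: (B1 :|: B2)))%SET|)%N ->
  (p0 <= q0)%N -> (q0 + L * m * width <= p1)%N -> (p1 <= M)%N -> (0 < width)%N ->
  (p0 <= M)%N -> (p0 * n = 640 * M)%N ->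
  beta * (width%:R / M%:R) <= 2^-1 ->
  n%:R * expR (- (beta * ((q0 - p0)%:R / M%:R) / 2)) <= 10%:R^-1 ->
  (P same <= ((9 / 10) ^+ L + ((n ^ 4)%:R / M%:R + (4^-1 ^+ n +
    (expR (- (p1%:R / M%:R * (n%:R / 8))) + (4 * nB%:R * (p1%:R / M%:R) +
    (4 * nB%:R * (p1%:R / M%:R) +
    L%:R * (2 ^+ k * expR (- (m%:R * rate R n M width p1 * nB%:R / 4)) +
       expR (- (k%:R * rate R n M width p1 * nB%:R / 2)))))))))%:E)%E.
Proof.
move=> M_gt0 sB B12 cB1 cB2 nB0 A2 p0q0 q0p1 p1M w0 p0M p0n bw bq.
have k0 : 0 <= (9 / 10) ^+ L :> R by rewrite exprn_ge0.
have mS : measurable same by exact: measurable_same walkX.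
apply: le_trans (prob_le_cells iidU M_gt0
  (bad := irregular s B1 B2 nB p0 q0 width p1 L m) mS k0 _) _; last first.
  by rewrite lee_fin lerD2l -freqE freq_irregular.
move=> f reg; have [y [v run]] := prim_run_ex (digits R f) s n_gt1.
have inj : injective f by move: reg; rewrite negb_or => /andP [/negPn /injectiveP].
have fexp : expander p0 f by move: reg; rewrite !negb_or => /and5P [_ /negPn].
have [CA C8 Cconn] := giantP (ltnW n_gt1) A2 fexp.
apply: (cell_same_run n_gt1 beta_ge0 walkX M_gt0 inj run k0) => u t hu.
have [runu WE] := in_cell_run M_gt0 inj run hu.
rewrite -WE; apply: le_trans (success_le
  (good := close_step R f s y v (core s B1 B2 p0 f) q0 width)
  (q := 9 / 10) n_gt1 beta_ge0 runu _ _ _ _) _.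
- lra.
- lra.
- move=> k' t' a kn gk; rewrite WE => aW.
  exact: (close_step_bound n_gt1 M_gt0 run Cconn p0q0 t' beta_ge0 inj hu bw bq kn gk aW).
have cnt := count_close_step n_gt1 M_gt0 sB A2 p0q0 q0p1 w0 reg run.
by apply: ler_wiXn2l => //; lra.
Qed.
End large_beta.

Lemma subset_of_card (I : finType) (S : {set I}) k : (k <= #|S|)%N ->
  exists2 S' : {set I}, S' \subset S & #|S'| = k.
Proof.
move=> kS; exists [set x in take k (enum S)]%SET.
  by apply/fintype.subsetP => x; rewrite inE => /mem_take; rewrite mem_enum.
rewrite cardsE; have /card_uniqP -> := take_uniq k (enum_uniq S).
by rewrite size_takel // -cardE.
Qed.

(** * Elementary estimates for the choice of constants *)

Section constants.
Variable R : realType.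
Implicit Types (C eps x : R).

Lemma eventually_ge C : exists n0, forall n, (n0 <= n)%N -> C <= n%:R.
Proof.
exists (Num.truncn `|C|).+1 => n nn; apply: le_trans (ler_norm C) _.
apply: (@le_trans _ _ (Num.truncn `|C|).+1%:R); last by rewrite ler_nat.
by have /andP [_ /ltW] := truncn_itv (normr_ge0 C).
Qed.

Lemma expRN_le eps x : 0 < eps -> - ln eps <= x -> expR (- x) <= eps.
Proof.
move=> e0 h; rewrite -[leRHS](lnK (x := eps)) ?posrE // ler_expR; lra.
Qed.

Lemma exp_ge_sub x : 0 <= x -> x <= 2^-1 -> expR (- (2 * x)) <= 1 - x.
Proof.
move=> x0 x1; rewrite expRN invf_ple ?posrE ?expR_gt0 //; last by lra.
apply: le_trans (expR_ge1Dx (2 * x)); rewrite -div1r ler_pdivrMr; last by lra.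
nra.
Qed.

Lemma natdiv_ge (a b : nat) : (0 < b)%N -> (2 * b <= a)%N ->
  a%:R / (2 * b%:R) <= (a %/ b)%:R :> R.
Proof.
move=> b0 ab; rewrite ler_pdivrMr; last by rewrite mulr_gt0 // ltr0n.
rewrite -[2 * b%:R]natrM -natrM ler_nat.
have := divn_eq a b; have := ltn_pmod a b0; move: (a %/ b)%N (a %% b)%N => q r rb aE.
have q1 : (0 < q)%N by case: q aE => // aE; move: ab; rewrite aE; lia.
nia.
Qed.

End constants.

(** * Explicit bounds for fixed n *)

Section upper_bound.
Context d (T : measurableType d) (R : realType) (P : probability T R).
Variables (n : nat) (beta : R) (s : 'I_n).
Variables (U : edge n -> {RV P >-> R}) (X : nat -> T -> 'I_n).
Hypothesis n_gt1 : (1 < n)%N.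
Hypothesis beta_ge0 : 0 <= beta.
Hypothesis iidU : iid_uniform01 U.
Hypothesis walkX : walk_given_labels beta s U X.
Notation same := (same_run s (fun e => U e : T -> R) X).

Let nR : 0 < n%:R :> R.
Proof. by rewrite ltr0n; lia. Qed.

Lemma prob_not_same_run_le K : (0 < K)%N -> 8 * K%:R * (n%:R ^+ 3 * ln n%:R) <= beta ->
  (P (~` same) <= (n%:R^-1 + 3 / K%:R)%:E)%E.
Proof.
move=> K0 hb; have KR : 0 < K%:R :> R by rewrite ltr0n.
(* With [Delta] = n ^ 3 the gap is 1 / (K n ^ 3), so beta times half the gap is at least 4 ln n:
   this beats the factor n ^ 3 and leaves 1 / n. *)
have M0 : (0 < K * n ^ 6)%N by rewrite muln_gt0 K0 expn_gt0; lia.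
apply: le_trans (prob_not_same_run n_gt1 beta_ge0 iidU walkX (n ^ 3) M0) _.
rewrite lee_fin !natrX (natrM _ K) natrX; apply: lerD.
  have -> : n%:R^-1 = n%:R ^+ 3 * expR (- (ln n%:R *+ 4)) :> R.
    by rewrite -lnXn // expRN lnK ?posrE ?exprn_gt0 //; field; exact: lt0r_neq0.
  rewrite ler_pM2l ?exprn_gt0 // ler_expR lerN2.
  have -> : n%:R ^+ 3 / (K%:R * n%:R ^+ 6) = (K%:R * n%:R ^+ 3)^-1 :> R.
    by field; rewrite !lt0r_neq0.
  rewrite -(mulr_natr (ln _)) ler_pdivlMr // ler_pdivlMr ?mulr_gt0 ?exprn_gt0 //.
  by apply: le_trans hb; rewrite le_eqVlt; apply/orP; left; apply/eqP; ring.
have n1 : 1 <= n%:R :> R by rewrite ler1n; lia.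
have -> : 3 / K%:R = K%:R^-1 + 2 / K%:R :> R by field; exact: lt0r_neq0.
apply: lerD.
  rewrite ler_pdivrMr ?mulr_gt0 ?exprn_gt0 // mulKf ?lt0r_neq0 //.
  exact: ler_weXn2l.
rewrite mulrA ler_pdivrMr ?mulr_gt0 ?exprn_gt0 //.
have -> : 2 / K%:R * (K%:R * n%:R ^+ 6) = n%:R ^+ 3 * (n%:R ^+ 3 *+ 2) :> R.
  by field; exact: lt0r_neq0.
rewrite ler_pM2l ?exprn_gt0 // -natr1 natrX mulr2n lerD2l.
exact: exprn_ege1.
Qed.

(** Each of at least n / 8 second exits has a share of at least n ^ (- 1 / 2) / 2, so the exponent
    is of order n ^ (1 / 2); the weaker ln n suffices for the limit. *)
Lemma prob_same_run_le_small : (640 <= n)%N -> beta * (640 / n%:R) <= ln n%:R / 2 ->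
  (P same <= (expR (- (ln n%:R / 32)) + (n%:R^-1 + n%:R^-1))%:E)%E.
Proof.
move=> n640 hb; have M0 : (0 < n ^ 6)%N by rewrite expn_gt0; lia.
have p0M : (640 * n ^ 5 <= n ^ 6)%N by rewrite [leqRHS]expnS leq_mul2r n640 orbT.
have p0n : (640 * n ^ 5 * n = 640 * n ^ 6)%N by rewrite -mulnA -expnSr.
have n16 : (16 <= n)%N by exact: leq_trans n640.
apply: le_trans (prob_same_run_small_beta beta_ge0 iidU walkX n16 M0 p0M p0n) _.
rewrite lee_fin; apply: lerD.
  rewrite ler_expR lerN2.
  have -> : ln n%:R / 32 = (ln n%:R / 2) / 16 :> R by field.
  rewrite ler_pM2r ?invr_gt0 //.
  apply: (@le_trans _ _ (expR (ln n%:R / 2))).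
    by apply: le_trans (expR_ge1Dx _); rewrite lerDr.
  rewrite -[X in _ <= X * _](lnK (x := n%:R)) ?posrE // -expRD ler_expR.
  by move: hb; set bb := beta * _ => hb; lra.
have n1 : 1 <= n%:R :> R by rewrite ler1n; lia.
apply: lerD.
  rewrite !natrX ler_pdivrMr ?exprn_gt0 //.
  have -> : n%:R^-1 * n%:R ^+ 6 = n%:R ^+ 5 :> R by field; exact: lt0r_neq0.
  exact: ler_weXn2l.
rewrite exprVn lef_pV2 ?posrE ?exprn_gt0 // -natrX ler_nat.
exact/ltnW/ltn_expl.
Qed.

(** [c] bounds (1 - l1 / n) ^ n from below, the chance that no other edge of a vertex is low, and
    [theta] bounds the product of [m] and the rate from below. *)
Lemma prob_same_run_le_large (l1 L K H : nat) (c theta : R) :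
  c = expR (- (2 * l1%:R)) -> theta = c / (16 * L%:R) ->
  (10 * 640 <= l1)%N -> (0 < L)%N -> (0 < K)%N -> (8 <= H)%N ->
  (2 * l1 <= n)%N -> (2 * (K * L) <= n)%N -> (2 * H <= n)%N ->
  1 <= theta * n%:R / (16 * H%:R) ->
  beta * (K%:R / n%:R ^+ 3) <= 2^-1 ->
  ln n%:R / 2 <= beta * (640 / n%:R) ->
  (P same <= ((9 / 10) ^+ L + (n%:R^-1 + (n%:R^-1 + (expR (- (l1%:R / 8)) +
    (4 * l1%:R / H%:R + (4 * l1%:R / H%:R +
    L%:R * (expR (- (theta * n%:R / (16 * H%:R))) +
            expR (- (theta * c * K%:R / (1024 * H%:R ^+ 2))))))))))%:E)%E.
Proof.
move=> cE thE l16 L0 K0 H8 nl nKL nH th1 bK bln.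
have n_gt0 : (0 < n)%N by clear -n_gt1; lia.
have n1 : 1 <= n%:R :> R by rewrite ler1n.
have H0 : (0 < H)%N by clear -H8; lia.
have HR : 0 < H%:R :> R by rewrite ltr0n.
have KR : 0 < K%:R :> R by rewrite ltr0n.
have LR : 0 < L%:R :> R by rewrite ltr0n.
have c0 : 0 < c by rewrite cE expR_gt0.
have th0 : 0 < theta by rewrite thE divr_gt0 // mulr_gt0.
(* Divided by [M], the core level is 640 / n, the windows have width K / n ^ 3 and fill the labels
   from (l1 - 1) / n to l1 / n: there is room for [m] of them in each of [L] groups. Taking [nB] = n
   / H keeps low edges inside [B] rare; [k] is the number of occupied windows aimed at. *)
pose M := (n ^ 6)%N; pose w := (K * n ^ 3)%N; pose nB := (n %/ H)%N.
pose m := (n ^ 2 %/ (K * L))%N; pose k := Num.truncn (theta * n%:R / (16 * H%:R)).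
have M0 : (0 < M)%N by rewrite expn_gt0 n_gt0.
have nBle : (nB * H <= n)%N by exact: leq_trunc_div.
have nB8 : (8 * nB <= n)%N by apply: leq_trans nBle; rewrite mulnC leq_mul2l H8 orbT.
have nB0 : (0 < nB)%N by rewrite divn_gt0 //; clear -nH; lia.
have [B1 B1s cB1] : exists2 B1 : {set 'I_n}, B1 \subset (~: [set s])%SET & #|B1| = nB.
  apply: subset_of_card; have := cardsC [set s]%SET; rewrite cards1 card_ord.
  by move: #|(~: [set s])%SET| => x h; clear -nB8 nB0 h; lia.
have [B2 B2s cB2] : exists2 B2 : {set 'I_n}, B2 \subset (~: (s |: B1))%SET & #|B2| = nB.
  apply: subset_of_card; have sB1 : s \notin B1.
    by apply/negP => /(fintype.subsetP B1s); rewrite !inE eqxx.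
  have := cardsC (s |: B1)%SET; rewrite cardsU1 sB1 cB1 card_ord.
  by move: #|(~: (s |: B1))%SET| => x h; clear -nB8 nB0 h; lia.
have sB : (s \notin B1 :|: B2)%SET.
  rewrite inE negb_or; apply/andP; split; apply/negP.
    by move=> /(fintype.subsetP B1s); rewrite !inE eqxx.
  by move=> /(fintype.subsetP B2s); rewrite !inE eqxx.
have B12 : B1 \subset (~: B2)%SET.
  apply/fintype.subsetP => x xB; rewrite inE; apply/negP => /(fintype.subsetP B2s).
  by rewrite !inE xB orbT.
have A2 : (n <= 2 * #|(~: (s |: (B1 :|: B2)))%SET|)%N.
  have := cardsC (s |: (B1 :|: B2))%SET; rewrite cardsU1 sB card_ord.
  have : (#|B1 :|: B2| <= nB + nB)%N by rewrite -{1}cB1 -cB2; exact: leq_card_setU.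
  move: #|(B1 :|: B2)%SET| #|(~: (s |: (B1 :|: B2)))%SET| => x1 x2 h1 h2; clear -h1 h2 nB8 nB0; lia.
have p0q0 : (640 * n ^ 5 <= (l1 - 1) * n ^ 5)%N by rewrite leq_mul2r; apply/orP; right; clear -l16; lia.
have q0p1 : ((l1 - 1) * n ^ 5 + L * m * w <= l1 * n ^ 5)%N.
  have -> : (l1 * n ^ 5 = (l1 - 1) * n ^ 5 + n ^ 5)%N.
    by rewrite -{1}(subnK (_ : (1 <= l1)%N)) ?mulnDl ?mul1n //; clear -l16; lia.
  rewrite leq_add2l /w /m.
  have -> : (L * (n ^ 2 %/ (K * L)) * (K * n ^ 3) = n ^ 2 %/ (K * L) * (K * L) * n ^ 3)%N by ring.
  by rewrite (expnD n 2 3) leq_mul2r leq_trunc_div orbT.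
have p1M : (l1 * n ^ 5 <= M)%N.
  by rewrite /M [leqRHS]expnS leq_mul2r; apply/orP; right; clear -nl; lia.
have w0 : (0 < w)%N by rewrite muln_gt0 K0 expn_gt0 n_gt0.
have p0M : (640 * n ^ 5 <= M)%N.
  by rewrite /M [leqRHS]expnS leq_mul2r; apply/orP; right; clear -nl l16; lia.
have p0n : (640 * n ^ 5 * n = 640 * M)%N by rewrite -mulnA -expnSr.
have wM : w%:R / M%:R = K%:R / n%:R ^+ 3 :> R.
  by rewrite /w /M natrM !natrX; field; exact: lt0r_neq0.
have p1ME : (l1 * n ^ 5)%:R / M%:R = l1%:R / n%:R :> R.
  by rewrite /M natrM !natrX; field; exact: lt0r_neq0.
have bq : n%:R * expR (- (beta * (((l1 - 1) * n ^ 5 - 640 * n ^ 5)%:R / M%:R) / 2)) <= 10%:R^-1.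
  rewrite -mulnBl natrM /M !natrX.
  have -> : (l1 - 1 - 640)%:R * n%:R ^+ 5 / n%:R ^+ 6 = (l1 - 1 - 640)%:R / n%:R :> R.
    by field; exact: lt0r_neq0.
  (* Half the distance from core level to windows is at least 4 times 640 / n, so the exponent is at
     least 2 ln n and the variation over the core at most 1 / n. *)
  have x8 : 8 * 640 <= (l1 - 1 - 640)%:R :> R by rewrite -natrM ler_nat; clear -l16; lia.
  apply: (@le_trans _ _ (n%:R * expR (- (ln n%:R *+ 2)))).
    rewrite ler_pM2l // ler_expR lerN2.
    apply: (@le_trans _ _ (4 * (beta * (640 / n%:R)))).
      by rewrite mulr2n; move: bln; set bb := beta * _ => bln; lra.
    have -> : beta * ((l1 - 1 - 640)%:R / n%:R) / 2 = (l1 - 1 - 640)%:R / 2 * (beta / n%:R) by ring.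
    have -> : 4 * (beta * (640 / n%:R)) = 4 * 640 * (beta / n%:R) by ring.
    by apply: ler_wpM2r; [rewrite divr_ge0 // ltW | lra].
  rewrite -lnXn // expRN lnK ?posrE ?exprn_gt0 //.
  have -> : n%:R * (n%:R ^+ 2)^-1 = n%:R^-1 :> R by field; exact: lt0r_neq0.
  by rewrite lef_pV2 ?posrE // ler_nat; clear -nl l16; lia.
have bw : beta * (w%:R / M%:R) <= 2^-1 by rewrite wM.
apply: le_trans (prob_same_run_large_beta n_gt1 beta_ge0 iidU walkX k M0 sB B12 cB1 cB2 nB0 A2
  p0q0 q0p1 p1M w0 p0M p0n bw bq) _.
rewrite lee_fin lerD2l; apply: lerD.
  rewrite /M !natrX ler_pdivrMr ?exprn_gt0 //.
  have -> : n%:R^-1 * n%:R ^+ 6 = n%:R ^+ 5 :> R by field; exact: lt0r_neq0.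
  exact: ler_weXn2l.
apply: lerD.
  rewrite exprVn lef_pV2 ?posrE ?exprn_gt0 // -natrX ler_nat.
  exact/ltnW/ltn_expl.
rewrite p1ME; apply: lerD.
  rewrite le_eqVlt; apply/orP; left; apply/eqP; congr (expR (- _)).
  by field; exact: lt0r_neq0.
have few : 4 * nB%:R * (l1%:R / n%:R) <= 4 * l1%:R / H%:R :> R.
  rewrite ler_pdivlMr // mulrA mulrAC ler_pdivrMr //.
  have h : (nB * H)%:R <= n%:R :> R by rewrite ler_nat.
  rewrite natrM in h.
  have -> : 4 * nB%:R * l1%:R * H%:R = 4 * l1%:R * (nB%:R * H%:R) :> R by ring.
  by rewrite ler_wpM2l // mulr_ge0.
do 2!(apply: lerD; first exact: few).
rewrite ler_pM2l //.
have rate_ge : c * K%:R / (8 * n%:R ^+ 2) <= rate R n M w (l1 * n ^ 5).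
  rewrite /rate wM p1ME.
  have -> : c * K%:R / (8 * n%:R ^+ 2) = n%:R / 8 * (K%:R / n%:R ^+ 3) * c :> R.
    by field; exact: lt0r_neq0.
  apply: ler_wpM2l; first by rewrite mulr_ge0 // divr_ge0 // ?exprn_ge0 // ltW.
  have ln2 : l1%:R / n%:R <= 2^-1 :> R.
    by rewrite ler_pdivrMr // mulrC ler_pdivlMr // -natrM ler_nat mulnC.
  apply: (@le_trans _ _ (expR (- (2 * (l1%:R / n%:R))) ^+ n)).
    rewrite -expRM_natr cE ler_expR le_eqVlt; apply/orP; left; apply/eqP.
    by field; exact: lt0r_neq0.
  apply: lerXn2r; rewrite ?nnegrE ?expR_ge0 //; first lra.
  by apply: exp_ge_sub => //; rewrite divr_ge0 // ltW.
set rt := rate _ _ _ _ _ in rate_ge *.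
have rt0 : 0 < rt.
  by apply: lt_le_trans rate_ge; rewrite divr_gt0 ?mulr_gt0 ?exprn_gt0.
have nBge : n%:R / (2 * H%:R) <= nB%:R :> R by exact: natdiv_ge.
have m_ge : n%:R ^+ 2 / (2 * (K%:R * L%:R)) <= m%:R :> R.
  have := @natdiv_ge R (n ^ 2) (K * L); rewrite muln_gt0 K0 L0 => /(_ isT).
  rewrite natrX natrM; apply; apply: leq_trans nKL _.
  by rewrite expnS expn1 leq_pmull.
have th_m : theta <= m%:R * rt.
  apply: (@le_trans _ _ (n%:R ^+ 2 / (2 * (K%:R * L%:R)) * (c * K%:R / (8 * n%:R ^+ 2)))).
    rewrite thE le_eqVlt; apply/orP; left; apply/eqP; field.
    by rewrite !lt0r_neq0.
  by apply: ler_pM => //; rewrite divr_ge0 ?mulr_ge0 ?exprn_ge0 // ltW.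
have /andP [k1 k2] : k%:R <= theta * n%:R / (16 * H%:R) < k.+1%:R.
  by apply: truncn_itv; apply: le_trans th1.
set x := theta * n%:R / (16 * H%:R) in th1 k1 k2 *.
have k_ge : x / 2 <= k%:R.
  have k_gt0 : (0 < k)%N by rewrite /k truncn_gt0.
  have : 1 <= k%:R :> R by rewrite ler1n.
  by move: k2; rewrite -natr1; lra.
(* The entropy 2 ^ k <= exp x is paid for by exp (- 2 x), which is why [k] is capped at [x]. *)
apply: lerD.
  apply: (@le_trans _ _ (expR x * expR (- (x + x)))); last by rewrite -expRD ler_expR; lra.
  apply: ler_pM; rewrite ?exprn_ge0 ?expR_ge0 //.
    apply: (@le_trans _ _ (expR 1 ^+ k)).
      by apply: lerXn2r; rewrite ?nnegrE ?expR_ge0 // expR_2.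
    by rewrite -expRM_natr mul1r ler_expR.
  rewrite ler_expR lerN2.
  have -> : x + x = theta * (n%:R / (2 * H%:R)) / 4 by rewrite /x; field; exact: lt0r_neq0.
  rewrite ler_pM2r ?invr_gt0 //; apply: ler_pM => //; first exact: ltW.
rewrite ler_expR lerN2.
have -> : theta * c * K%:R / (1024 * H%:R ^+ 2) =
    (x / 2) * (c * K%:R / (8 * n%:R ^+ 2)) * (n%:R / (2 * H%:R)) / 2.
  by rewrite /x; field; rewrite !lt0r_neq0.
rewrite ler_pM2r ?invr_gt0 //.
have x0 : 0 <= x / 2 by lra.
apply: ler_pM => //.
- by rewrite mulr_ge0 // divr_ge0 ?mulr_ge0 ?exprn_ge0 // ltW.
- by apply: ler_pM => //; rewrite divr_ge0 ?mulr_ge0 ?exprn_ge0 // ltW.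
Qed.
End upper_bound.

(** * Passage to the limit *)

Section limits.
Variable R : realType.
Implicit Types (C eps x : R).

Lemma exists_nat_ge C k : exists2 N, (k <= N)%N & C <= N%:R.
Proof.
have [n0 h] := eventually_ge C; exists (maxn n0 k); first exact: leq_maxr.
exact/h/leq_maxl.
Qed.

Lemma near_ge C : \forall n \near \oo, C <= n%:R.
Proof. by have [n0 h] := eventually_ge C; exists n0. Qed.

Lemma near_shift2 (A : set nat) :
  (\forall n \near \oo, A n) -> \forall n \near \oo, A n.+2.
Proof. by case=> N _ h; exists N => // n /= Nn; apply: h => /=; lia. Qed.

Lemma much_larger_near (a b : nat -> R) K : 0 < K -> much_larger a b ->
  \forall n \near \oo, b n * K <= a n.
Proof.
move=> K0 [a0 /cvgrPdist_le /(_ K^-1)]; rewrite invr_gt0 => /(_ K0) h.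
near=> n; have an : 0 < a n by near: n.
have : `|0 - b n / a n| <= K^-1 by near: n.
rewrite sub0r normrN => /(le_trans (ler_norm _)).
by rewrite ler_pdivrMr // mulrC ler_pdivlMr.
Unshelve. all: by end_near. Qed.

Lemma cvge_to0 (F : nat -> \bar R) : (forall n, 0 <= F n)%E ->
  (forall eps, 0 < eps -> \forall n \near \oo, (F n <= eps%:E)%E) ->
  F n @[n --> \oo] --> 0%E.
Proof.
move=> F0 h.
have finF eps n : (F n <= eps%:E)%E -> F n \is a fin_num.
  by move=> le; rewrite ge0_fin_numE //; apply: le_lt_trans le _; rewrite ltry.
apply/fine_cvgP; split.
  near=> n; apply: (finF 1); near: n; exact: h.
apply/cvgrPdist_le => eps e0; near=> n.
have le : (F n <= eps%:E)%E by near: n; exact: h.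
rewrite /= sub0r normrN ger0_norm ?fine_ge0 //.
by rewrite -lee_fin fineK // (finF eps).
Unshelve. all: by end_near. Qed.

End limits.

Section two_regimes.
Variables (R : realType) (beta : nat -> R).
Hypothesis beta_ge0 : forall n, 0 <= beta n.
Variables (d : nat -> measure_display) (T : forall n, measurableType (d n)).
Variable P : forall n, probability (T n) R.
Variable s : forall n, 'I_n.+2.
Variable U : forall n, edge n.+2 -> {RV (P n) >-> R}.
Variable X : forall n, nat -> T n -> 'I_n.+2.
Hypothesis iidU : forall n, iid_uniform01 (@U n).
Hypothesis walkX : forall n, walk_given_labels (beta n.+2) (s n) (@U n) (@X n).
Notation same n := (same_run (s n) (fun e => @U n e : T n -> R) (@X n)).

Lemma prob_same_run_to1 : much_larger beta (fun n => n%:R ^+ 3 * ln n%:R) ->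
  P n (same n) @[n --> \oo] --> 1%E.
Proof.
move=> bn; have not_same : P n (~` same n) @[n --> \oo] --> 0%E.
  apply: cvge_to0 => [n|eps e0]; first exact: measure_ge0.
  have [K K0 hK] := exists_nat_ge (6 / eps) 1.
  have KR : 0 < K%:R :> R by rewrite ltr0n.
  have K8 : 0 < 8 * K%:R :> R by rewrite mulr_gt0.
  near=> n; have bK : n.+2%:R ^+ 3 * ln n.+2%:R * (8 * K%:R) <= beta n.+2.
    by near: n; exact: (near_shift2 (much_larger_near K8 bn)).
  have nR : 2 / eps <= n.+2%:R :> R by near: n; exact: (near_shift2 (near_ge _)).
  rewrite mulrC in bK.
  apply: le_trans (prob_not_same_run_le _ (beta_ge0 _) (@iidU n) (@walkX n) K0 bK) _ => //.
  rewrite lee_fin [leRHS]splitr; apply: lerD.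
    by rewrite invf_ple ?posrE ?divr_gt0 ?ltr0n // invf_div.
  by rewrite ler_pdivrMr // mulrAC ler_pdivlMr //; move: hK; rewrite ler_pdivrMr //; lra.
have -> : (fun n => P n (same n)) = (fun n => 1 - P n (~` same n))%E.
  by apply/funext => n; rewrite -probability_setC ?setCK //;
    apply: measurableC; exact: measurable_same (@walkX n).
rewrite -[X in _ --> X]sube0; apply: cvgeB => //; exact: cvg_cst.
Unshelve. all: by end_near. Qed.

Lemma prob_same_run_to0 : much_larger (fun n => n%:R ^+ 3) beta ->
  P n (same n) @[n --> \oo] --> 0%E.
Proof.
move=> bn; apply: cvge_to0 => [n|eps eps0]; first exact: measure_ge0.
(* One share [e] for each of the eight error terms. [L] and [l1] come first, then [H] given [l1],
   then [K] given the rest; only [K] and n meet the assumption on beta. *)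
pose e := eps / 8; have e0 : 0 < e by rewrite divr_gt0.
have [L L0 hL] := exists_nat_ge (10 * - ln e) 1.
have [l1 l16 hl1] := exists_nat_ge (8 * - ln e) (10 * 640).
have [H H8 hH] := exists_nat_ge (4 * l1%:R / e) 8.
pose c : R := expR (- (2 * l1%:R)); pose theta := c / (16 * L%:R).
have LR : 0 < L%:R :> R by rewrite ltr0n.
have HR : 0 < H%:R :> R by rewrite ltr0n; exact: leq_trans H8.
have c0 : 0 < c by exact: expR_gt0.
have th0 : 0 < theta by rewrite divr_gt0 ?mulr_gt0.
have eL0 : 0 < e / L%:R by rewrite divr_gt0.
have [K K0 hK] := exists_nat_ge (- ln (e / L%:R) * (1024 * H%:R ^+ 2) / (theta * c)) 1.
have D0 : 0 < 1024 * H%:R ^+ 2 :> R by apply: mulr_gt0; [rewrite ltr0n | rewrite exprn_gt0].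
have KR : 0 < K%:R :> R by rewrite ltr0n.
have K2 : 0 < 2 * K%:R :> R by rewrite mulr_gt0.
near=> n; have N0 : 0 < n.+2%:R :> R by rewrite ltr0n.
have ninv : n.+2%:R^-1 <= e.
  rewrite invf_ple ?posrE //; near: n; exact: (near_shift2 (near_ge _)).
(* Decided for each n separately, since beta may alternate between the two cases. *)
have [small|large] := leP (beta n.+2 * (640 / n.+2%:R)) (ln n.+2%:R / 2).
  apply: le_trans (prob_same_run_le_small _ (beta_ge0 _) (@iidU n) (@walkX n) _ small) _ => //.
    near: n; exact: (near_shift2 (nbhs_infty_ge _)).
  have lnn : expR (- (ln n.+2%:R / 32)) <= e.
    apply: expRN_le => //; rewrite ler_pdivlMr //.
    rewrite -ler_expR lnK ?posrE //; near: n; exact: (near_shift2 (near_ge _)).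
  have -> : eps = e + (e + (e + 5 * e)) by rewrite /e; field.
  rewrite lee_fin; do 2!(apply: lerD => //); apply: le_trans ninv _.
  by rewrite lerDl mulr_ge0 // ltW.
have nl : (2 * l1 <= n.+2)%N by near: n; exact: (near_shift2 (nbhs_infty_ge _)).
have nKL : (2 * (K * L) <= n.+2)%N by near: n; exact: (near_shift2 (nbhs_infty_ge _)).
have nH : (2 * H <= n.+2)%N by near: n; exact: (near_shift2 (nbhs_infty_ge _)).
have thn C : C * (16 * H%:R) / theta <= n.+2%:R -> C <= theta * n.+2%:R / (16 * H%:R).
  by rewrite ler_pdivrMr // ler_pdivlMr ?mulr_gt0 // [theta * _]mulrC.
have th1 : 1 <= theta * n.+2%:R / (16 * H%:R).
  by apply: thn; near: n; exact: (near_shift2 (near_ge _)).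
have thL : - ln (e / L%:R) <= theta * n.+2%:R / (16 * H%:R).
  by apply: thn; near: n; exact: (near_shift2 (near_ge _)).
have bK : beta n.+2 * (K%:R / n.+2%:R ^+ 3) <= 2^-1.
  have : beta n.+2 * (2 * K%:R) <= n.+2%:R ^+ 3.
    by near: n; exact: (near_shift2 (much_larger_near K2 bn)).
  rewrite [X in _ -> X <= _]mulrA ler_pdivrMr ?exprn_gt0 //.
  by rewrite ler_pdivlMl // mulrCA.
apply: le_trans (prob_same_run_le_large _ (beta_ge0 _) (@iidU n) (@walkX n)
  (erefl c) (erefl theta) l16 L0 K0 H8 nl nKL nH th1 bK (ltW large)) _ => //.
have t1 : (9 / 10) ^+ L <= e.
  apply: (@le_trans _ _ (expR (- (10^-1)) ^+ L)).
    apply: lerXn2r; rewrite ?nnegrE ?expR_ge0 //.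
    by apply: le_trans (expR_ge1Dx _); lra.
  by rewrite -expRM_natr mulNr; apply: expRN_le => //; move: hL; lra.
have t2 : expR (- (l1%:R / 8)) <= e by apply: expRN_le => //; move: hl1; lra.
have t3 : 4 * l1%:R / H%:R <= e.
  by rewrite ler_pdivrMr // [leRHS]mulrC -ler_pdivrMr.
have t4 : L%:R * (expR (- (theta * n.+2%:R / (16 * H%:R))) +
    expR (- (theta * c * K%:R / (1024 * H%:R ^+ 2)))) <= e + e.
  rewrite mulrDr; apply: lerD; rewrite mulrC -ler_pdivlMr //; apply: expRN_le => //.
  move: hK D0; move: (1024 * _) => D hK D0.
  by rewrite ler_pdivlMr // [leRHS]mulrC -ler_pdivrMr //; exact: mulr_gt0.
rewrite lee_fin; have -> : eps = e + (e + (e + (e + (e + (e + (e + e)))))).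
  by rewrite /e; field.
by do 6!(apply: lerD => //).
Unshelve. all: by end_near. Qed.

End two_regimes.

(* Index [n] stands for the network on [n.+2] vertices: the walk needs at least
   two vertices, and limits are unaffected by the shift. *)
Theorem theorem1p4 (R : realType) (beta : nat -> R)
    (beta_ge0 : forall n, 0 <= beta n)
    (d : nat -> measure_display) (T : forall n, measurableType (d n))
    (P : forall n, probability (T n) R)
    (s : forall n, 'I_n.+2)
    (U : forall n, edge n.+2 -> {RV (P n) >-> R})
    (X : forall n, nat -> T n -> 'I_n.+2)
    (iidU : forall n, iid_uniform01 (U n))
    (walkX : forall n, walk_given_labels (beta n.+2) (s n) (U n) (X n)) :
  (much_larger beta (fun n => n%:R ^+ 3 * ln n%:R) ->
   P n (same_run (s n) (fun e => U n e : T n -> R) (X n)) @[n --> \oo] --> 1%E)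
  /\
  (much_larger (fun n => n%:R ^+ 3) beta ->
   P n (same_run (s n) (fun e => U n e : T n -> R) (X n)) @[n --> \oo] --> 0%E).
Proof.
by split; [exact: prob_same_run_to1 iidU walkX | exact: prob_same_run_to0 iidU walkX].
Qed.
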